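(* Let $A$ be a jointly measurable stationary random field on $\mathbb{R}^d$. Given $\beta>0$, assume that for some constant $C_1>0$ either $A$ is $\alpha$-mixing with coefficient $\tilde\alpha(\ell,D;A)\le C_1(1+D)^{C_1}\exp(-\frac1{C_1}\ell^\beta)$ for all $D,\ell\ge0$, or $A$ satisfies ($\partial^{\mathrm{osc}}$-MCI) with weight $\pi(\ell)\le C_1\exp(-\frac1{C_1}\ell^\beta)$. Let $f(A)$ be a $\sigma(A)$-measurable random variable that is a.s. bounded by a deterministic constant and that is approximately $1$-local in the sense that for some $C_0>0$ and all $\ell\ge0$, $$\operatorname{sup\,ess}_A\big|f(A)-\mathbb{E}[f(A)\,\|\,A|_{B_\ell}]\big|\le C_0\,e^{-\frac{\ell}{C_0}}.$$ Set $F(x):=f(A(\cdot+x))$ and $X_L:=L^{-d}\int_{\mathbb{R}^d}e^{-\frac1L|y|}(F(y)-\mathbb{E}[F])\,dy$. Then there is a constant $C>0$ such that for all $\delta>0$ and $L\ge1$, $$\mathbb{P}[X_L>\delta]\le C\exp\Big(-\tfrac1C\,\delta^2\,(|\log\delta|+1)^{-\frac{d\beta}{d+\beta}}\,L^{\frac{d\beta}{d+\beta}}\Big).$$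
   Context: $B_r(x)$ denotes the Euclidean ball of radius $r$ centered at $x\in\mathbb{R}^d$, $B_r:=B_r(0)$; $\mathcal{B}(\mathbb{R}^d)$ is the Borel $\sigma$-algebra; $\mathbb{E}[\cdot\,\|\,\cdot]$ denotes conditional expectation; $\operatorname{sup\,ess}_A$ denotes the essential supremum over realizations of $A$. The constant $C$ is independent of $\delta,L$ (it depends only on $d$, $\beta$, $C_0$, $C_1$, and the bound on $f(A)$). Random field. $A:\mathbb{R}^d\times\Omega\to\mathbb{R}$ is a jointly measurable random field on a probability space $(\Omega,\mathcal{A},\mathbb{P})$, stationary: for all $z\in\mathbb{R}^d$, $A(\cdot+z,\cdot)$ has the same finite-dimensional distributions as $A$. $X(A),Y(A)$ denote real $\sigma(A)$-measurable random variables. The field $F$ is stationary, and $\mathbb{E}[F]$ denotes the common value of $\mathbb{E}[F(x)]$. Mixing. For sub-$\sigma$-algebras $\mathcal{G}_1,\mathcal{G}_2\subset\mathcal{A}$, $\alpha(\mathcal{G}_1,\mathcal{G}_2):=\sup\{|\mathbb{P}[G_1\cap G_2]-\mathbb{P}[G_1]\mathbb{P}[G_2]|:G_1\in\mathcal{G}_1,G_2\in\mathcal{G}_2\}$, and $$\tilde\alpha(R,D;A):=\sup\{\alpha(\sigma(A|_{S_1}),\sigma(A|_{S_2})):S_1,S_2\in\mathcal{B}(\mathbb{R}^d),\ d(S_1,S_2)\ge R,\ \mathrm{diam}(S_1),\mathrm{diam}(S_2)\le D\}.$$ $A$ is $\alpha$-mixing if $\tilde\alpha(R,D;A)\to0$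 as $R\uparrow\infty$ for all $D\in(0,\infty)$. Oscillation. For a Borel set $S\subset\mathbb{R}^d$, $\partial^{\mathrm{osc}}_{A,S}X(A):=\mathcal{M}[X(A)\|A|_{\mathbb{R}^d\setminus S}]+\mathcal{M}[-X(A)\|A|_{\mathbb{R}^d\setminus S}]$, where $\mathcal{M}[Y\|A|_{\mathbb{R}^d\setminus S}]$ is the conditional essential supremum of $Y$ given $\sigma(A|_{\mathbb{R}^d\setminus S})$, i.e. the a.s. smallest $\sigma(A|_{\mathbb{R}^d\setminus S})$-measurable random variable that dominates $Y$ a.s. (Formally: essential supremum minus essential infimum of $X(A')$ over $A'$ coinciding with $A$ outside $S$.) Multiscale covariance inequality. ($\partial^{\mathrm{osc}}$-MCI) with weight $\pi:\mathbb{R}_+\to\mathbb{R}_+$ (integrable): for all $X(A),Y(A)$, $\mathrm{Cov}[X(A);Y(A)]\le\int_0^\infty\int_{\mathbb{R}^d}\mathbb{E}[(\partial^{\mathrm{osc}}_{A,B_{\ell+1}(x)}X(A))^2]^{1/2}\,\mathbb{E}[(\partial^{\mathrm{osc}}_{A,B_{\ell+1}(x)}Y(A))^2]^{1/2}dx\,(\ell+1)^{-d}\pi(\ell)\,d\ell$. *)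

(* Defs.v *)
From HB Require Import structures.
From mathcomp Require Import all_boot all_order all_algebra.
From mathcomp Require Import all_classical all_reals all_analysis.
From mathcomp Require Import measurable_realfun ess_sup_inf.

Set Implicit Arguments.
Unset Strict Implicit.
Unset Printing Implicit Defensive.

Import Order.TTheory GRing.Theory Num.Theory.
Import numFieldNormedType.Exports.

Local Open Scope classical_set_scope.
Local Open Scope ring_scope.

(* R^n is 'rV[R]_n; the library gives it a topology (that of the sup norm) but
   no sigma-algebra. *)
Section borel_rV.
Context {R : realType} {n : nat}.

Let borel : set (set 'rV[R]_n) := <<s @open 'rV[R]_n >>.

Let borel0 : borel set0. Proof. exact: sigma_algebra0. Qed.

Let borelC A : borel A -> borel (~` A). Proof. exact: sigma_algebraC. Qed.

Let borel_bigcup (F : _^nat) :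
  (forall i, borel (F i)) -> borel (\bigcup_i (F i)).
Proof. exact: sigma_algebra_bigcup. Qed.

HB.instance Definition _ := @isMeasurable.Build default_measure_display
  'rV[R]_n borel borel0 borelC borel_bigcup.

End borel_rV.

Section lebesgue_rV.
Context {R : realType}.

Let rat_box n (p : 'rV[rat]_n * nat) :=
  [set v : 'rV[R]_n | forall i, `|ratr (p.1 ord0 i) - v ord0 i| <
    p.2.+1%:R^-1].

Lemma open_rV_bigcup n (U : set 'rV[R]_n) : open U ->
  U = \bigcup_(p in [set p | rat_box p `<=` U]) rat_box p.
Proof.
move=> oU; apply/seteqP; split=> [v Uv|v [p pU vp]]; last exact: pU.
have /nbhs_ballP[e /= e0 eU] : nbhs v U by apply: open_nbhs_nbhs.
have [k ke] : exists k : nat, k.+1%:R^-1 < e / 2.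
  have [k] := ltr_add_invr (divr_gt0 e0 (ltr0Sn R 1)).
  by rewrite add0r; exists k.
have kp : 0 < k.+1%:R^-1 :> R by rewrite invr_gt0.
have q_ex (i : 'I_n) : exists q : rat, `|ratr q - v ord0 i| < k.+1%:R^-1.
  have : v ord0 i < v ord0 i + k.+1%:R^-1 by rewrite ltrDl.
  move=> /rat_in_itvoo[q]; rewrite in_itv/= => /andP[q1 q2]; exists q.
  by rewrite gtr0_norm ?subr_gt0// ltrBlDl.
have [q qP] := choice q_ex.
exists (\row_i q i, k); last by move=> i /=; rewrite mxE.
move=> w /= wP; apply: eU; split=> // i j; rewrite (ord1 i) /ball/=.
have := wP j; rewrite mxE => wj.
rewrite -(subrKA (ratr (q j))) (le_lt_trans (ler_normD _ _))//.
rewrite (splitr e) ltrD// (lt_trans _ ke)//.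
by rewrite distrC.
Qed.

Lemma measurable_fun_rV d (T : measurableType d) n (f : T -> 'rV[R]_n) :
  (forall i, measurable_fun setT (fun x => f x ord0 i)) ->
  measurable_fun setT f.
Proof.
move=> mf; apply: (@measurability _ _ _ _ setT f (@open 'rV[R]_n)) => //.
move=> _ [U oU <-]; rewrite setTI (open_rV_bigcup oU) preimage_bigcup.
rewrite bigcup_mkcond.
apply: countable_bigcupT_measurable => [|p]; first exact: countableP.
case: ifPn => // _.
have -> : f @^-1` rat_box p = \bigcap_(i in [set: 'I_n])
    ((fun x => f x ord0 i) @^-1`
      ball (ratr (p.1 ord0 i) : R) (p.2.+1%:R^-1)).
  by apply/seteqP; split=> x xp i => [_|]; exact: xp.
apply: fin_bigcap_measurable; first exact: finite_finset.
move=> i _; rewrite -[_ @^-1` _]setTI; apply: mf => //.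
exact: measurable_ball.
Qed.

Lemma measurable_rV_coord n (i : 'I_n) :
  measurable_fun setT (fun v : 'rV[R]_n => v ord0 i).
Proof.
apply: (measurability _ (RGenOpens.measurableE R)).
move=> _ [_ [a [b ->]] <-]; rewrite setTI; apply: sub_sigma_algebra.
by apply: open_comp => [v _|]; [exact: coord_continuous|exact: interval_open].
Qed.

Definition rV_cons n (p : measurableTypeR R * 'rV[R]_n) : 'rV[R]_n.+1 :=
  \row_i (if unlift ord0 i is Some j then p.2 ord0 j else p.1).

Definition rV_uncons n (v : 'rV[R]_n.+1) : measurableTypeR R * 'rV[R]_n :=
  (v ord0 ord0, \row_j v ord0 (lift ord0 j)).

Let rV_consK n : cancel (@rV_cons n) (@rV_uncons n).
Proof.
move=> [t v]; rewrite /rV_uncons mxE unlift_none; congr pair.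
by apply/rowP => j; rewrite !mxE liftK.
Qed.

Let measurable_rV_cons n : measurable_fun setT (@rV_cons n).
Proof.
apply: measurable_fun_rV => i; case: (unliftP ord0 i) => [j ->|->].
  rewrite (_ : (fun _ => _) = (fun v : 'rV[R]_n => v ord0 j) \o snd).
    apply: measurableT_comp; first exact: measurable_rV_coord.
    exact: measurable_snd.
  by apply/funext => p; rewrite mxE liftK.
rewrite (_ : (fun _ => _) = fst); first exact: measurable_fst.
by apply/funext => p; rewrite mxE unlift_none.
Qed.

Let measurable_rV_uncons n : measurable_fun setT (@rV_uncons n).
Proof.
apply/measurable_fun_pair => /=; first exact: measurable_rV_coord.
apply: measurable_fun_rV => i.
rewrite (_ : (fun _ => _) = (fun v : 'rV[R]_n.+1 => v ord0 (lift ord0 i))).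
  exact: measurable_rV_coord.
by apply/funext => v; rewrite mxE.
Qed.

Section step.
Local Open Scope ereal_scope.
Variables (n : nat) (mu : {sigma_finite_measure set 'rV[R]_n -> \bar R}).

Definition lebesgue_rV_step : set 'rV[R]_n.+1 -> \bar R :=
  pushforward (@lebesgue_measure R \x mu) (@rV_cons n).

Let step0 : lebesgue_rV_step set0 = 0.
Proof. by rewrite /lebesgue_rV_step /pushforward preimage_set0 measure0. Qed.

Let step_ge0 A : 0 <= lebesgue_rV_step A.
Proof. exact: (measure_ge0 (@lebesgue_measure R \x mu)). Qed.

Let step_sigma_additive : semi_sigma_additive lebesgue_rV_step.
Proof.
pose m := measure_function_pushforward__canonical__measure_function_Measure
  (@lebesgue_measure R \x mu) (@measurable_rV_cons n).
exact: (@measure_semi_sigma_additive _ _ _ m).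
Qed.

HB.instance Definition _ := isMeasure.Build _ _ _ lebesgue_rV_step
  step0 step_ge0 step_sigma_additive.

Let step_sigma_finite : sigma_finite setT lebesgue_rV_step.
Proof.
have /sigma_finiteP[F [FT Fnd Foo]] := sigma_finiteT (@lebesgue_measure R).
have /sigma_finiteP[G [GT Gnd Goo]] := sigma_finiteT mu.
exists (fun i => @rV_uncons n @^-1` (F i `*` G i)).
  apply/seteqP; split=> // v _.
  have [i _ Fi] : (\bigcup_i F i) (rV_uncons v).1 by rewrite -FT.
  have [j _ Gj] : (\bigcup_i G i) (rV_uncons v).2 by rewrite -GT.
  exists (maxn i j) => //; split.
  - by move: Fi; exact/subsetPset/Fnd/leq_maxl.
  - by move: Gj; exact/subsetPset/Gnd/leq_maxr.
move=> i; have [mF Fioo] := Foo i; have [mG Gioo] := Goo i; split.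
  rewrite -[_ @^-1` _]setTI; apply: measurable_rV_uncons => //.
  exact: measurableX.
rewrite /lebesgue_rV_step /pushforward.
rewrite (_ : _ @^-1` _ = F i `*` G i).
  by rewrite product_measure1E// lte_mul_pinfty// ge0_fin_numE.
by apply/seteqP; split=> p; rewrite /preimage /mkset rV_consK.
Qed.

HB.instance Definition _ := Measure_isSigmaFinite.Build _ _ _ lebesgue_rV_step
  step_sigma_finite.

End step.

(* Lebesgue measure on R^n: the n-fold product of the measure of R, with
   'rV[R]_0 a single point of mass 1. *)
Fixpoint lebesgue_rV (n : nat) :
    {sigma_finite_measure set 'rV[R]_n -> \bar R} :=
  match n with
  | 0 => [the {sigma_finite_measure set 'rV[R]_0 -> \bar R} of
           dirac (0 : 'rV[R]_0)]
  | m.+1 => [the {sigma_finite_measure set 'rV[R]_m.+1 -> \bar R} of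
           lebesgue_rV_step (lebesgue_rV m)]
  end.

End lebesgue_rV.

Section euclidean.
Context {R : realType} {d : nat}.
Implicit Types (x : 'rV[R]_d) (S : set 'rV[R]_d).

(* The library's norm on matrices is the sup norm. *)
Definition enorm x : R := Num.sqrt (\sum_(i < d) x ord0 i ^+ 2).

Definition eball x (r : R) : set 'rV[R]_d := [set y | enorm (y - x) < r].

Definition set_dist S1 S2 : \bar R :=
  ereal_inf [set (enorm (x - y))%:E | x in S1 & y in S2].

Definition set_diam S : \bar R :=
  ereal_sup [set (enorm (x - y))%:E | x in S & y in S].

End euclidean.

(* sigma((Z_i)_{i in S}) for a family of real functions on U. For a random field
   A this is sigma(A|_S); for the evaluations on I -> R and S = setT it is the
   cylinder sigma-algebra on paths. *)
Definition sigma_gen {R : realType} {I U : Type} (Z : I -> U -> R) (S : set I) :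
    set (set U) :=
  <<s \bigcup_(i in S) preimage_set_system setT (Z i) measurable >>.

Definition measurable_wrt {U : Type} {dV} {V : measurableType dV}
    (G : set (set U)) (X : U -> V) : Prop :=
  preimage_set_system setT X measurable `<=` G.

Section conditioning.
Local Open Scope ereal_scope.
Context {R : realType} {dT} {T : measurableType dT} (P : probability T R).
Implicit Types (G : set (set T)) (X Y : T -> R) (Z : T -> \bar R).

Definition is_cond_exp G X Y : Prop :=
  [/\ measurable_wrt G Y,
      P.-integrable setT (EFin \o Y) &
      forall B, G B -> \int[P]_(w in B) (Y w)%:E = \int[P]_(w in B) (X w)%:E].

(* E[X || G]; a version is selected by choice, and all versions agree a.s. *)
Definition cond_exp G X : T -> R := xget (cst 0%R) [set Y | is_cond_exp G X Y].

(* Z may take the value +oo, as X need not be bounded. *)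
Definition is_cond_ess_sup G X Z : Prop :=
  [/\ measurable_wrt G Z,
      {ae P, forall w, (X w)%:E <= Z w} &
      forall Z' : T -> \bar R, measurable_wrt G Z' ->
        {ae P, forall w, (X w)%:E <= Z' w} -> {ae P, forall w, Z w <= Z' w}].

(* M[X || G], likewise a chosen version, unique up to null sets. *)
Definition cond_ess_sup G X : T -> \bar R :=
  xget (cst +oo) [set Z | is_cond_ess_sup G X Z].

Definition alpha_coef G1 G2 : \bar R :=
  ereal_sup [set `|P (B1 `&` B2) - P B1 * P B2| | B1 in G1 & B2 in G2].

End conditioning.

Section random_field.
Context {R : realType} {d : nat} {dT} {T : measurableType dT}.
Variables (P : probability T R) (A : 'rV[R]_d -> T -> R).

Definition jointly_measurable : Prop :=
  measurable_fun setT (fun p : 'rV[R]_d * T => A p.1 p.2).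

Definition stationary : Prop :=
  forall (z : 'rV[R]_d) (n : nat) (x : 'I_n -> 'rV[R]_d) (B : set (n.-tuple R)),
    measurable B ->
    P [set w | B [tuple A (x i + z) w | i < n]] =
    P [set w | B [tuple A (x i) w | i < n]].

Definition tilde_alpha (r D : R) : \bar R :=
  ereal_sup [set alpha_coef P (sigma_gen A S.1) (sigma_gen A S.2) |
    S in [set S : set 'rV[R]_d * set 'rV[R]_d |
      [/\ measurable S.1, measurable S.2, (r%:E <= set_dist S.1 S.2)%E,
          (set_diam S.1 <= D%:E)%E & (set_diam S.2 <= D%:E)%E]]].

Definition alpha_mixing : Prop :=
  forall D : R, 0 < D -> tilde_alpha r D @[r --> +oo] --> 0%E.

Definition osc (S : set 'rV[R]_d) (X : T -> R) (w : T) : \bar R :=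
  (cond_ess_sup P (sigma_gen A (~` S)) X w +
   cond_ess_sup P (sigma_gen A (~` S)) (\- X)%R w)%E.

Definition osc_L2 (S : set 'rV[R]_d) (X : T -> R) : \bar R :=
  ((\int[P]_w (osc S X w ^+ 2)) `^ 2^-1)%E.

(* X(A), Y(A) are taken square-integrable, so that the covariance is defined. *)
Definition osc_MCI (wt : R -> R) : Prop :=
  [/\ forall l, 0 <= l -> 0 <= wt l,
      (@lebesgue_measure R).-integrable `[0, +oo[ (EFin \o wt) &
      forall X Y : T -> R,
        measurable_wrt (sigma_gen A setT) X ->
        measurable_wrt (sigma_gen A setT) Y ->
        X \in Lfun P 2%:E -> Y \in Lfun P 2%:E ->
        (covariance P X Y <=
          \int[@lebesgue_measure R]_(l in `[0%R, +oo[)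
            ((\int[lebesgue_rV d]_x
                (osc_L2 (eball x (l + 1)) X * osc_L2 (eball x (l + 1)) Y)) *
             ((l + 1) ^- d * wt l)%:E))%E].

Definition local_field (f : ('rV[R]_d -> R) -> R) (x : 'rV[R]_d) (w : T) : R :=
  f (fun y => A (y + x) w).

(* Under stationarity E[F(x)] does not depend on x; E[F] is taken at x = 0. *)
Definition exp_average (F : 'rV[R]_d -> T -> R) (L : R) (w : T) : R :=
  L ^- d * \int[lebesgue_rV d]_y
    (expR (- (L^-1 * enorm y)) * (F y w - fine ('E_P[F 0%R])%E)).

End random_field.

(* Main.v *)
(* Let s = L^(d/(d+beta)). Cutting space into cubes of side s writes X_L, up to
   an exponentially small tail, as an average over y in a cube of the sums
   sum_z c(y+z) F(y+z), where z runs over a lattice of mesh s. By Jensen's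
   inequality an exponential moment of X_L is at most the average over y of those
   of the sums. In such a sum F(y+z) is close to a function of A on the ball of
   radius s/4 around y+z; these balls are at mutual distance at least s/2, so the
   exponential moment factorizes up to an error governed by the mixing
   coefficient, and a single factor is at most exp(C (t c)^2) since F is bounded
   and centered. The mixing coefficient exp(-s^beta/C) absorbs the growth of the
   error as long as t is a small multiple of delta s^beta, and
   s^beta = (L/s)^d = L^(d beta/(d+beta)), so Chernoff's inequality yields the
   bound; the logarithmic factor is at most 1 and only weakens it.

   The multiscale covariance inequality implies exponential mixing: applied to
   the indicators of events of sigma(A|S1) and sigma(A|S2), only the balls of
   radius l+1 that meet both S1 and S2 contribute, which forces
   2(l+1) >= d(S1,S2). *)

Require Import Defs.
From HB Require Import structures.
From mathcomp Require Import all_boot all_order all_algebra.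
From mathcomp Require Import all_classical all_reals all_analysis.
From mathcomp Require Import measurable_realfun ess_sup_inf.
From mathcomp Require Import ring lra.

Set Implicit Arguments.
Unset Strict Implicit.
Unset Printing Implicit Defensive.

Import Order.TTheory GRing.Theory Num.Theory.
Import numFieldNormedType.Exports.

Local Open Scope classical_set_scope.
Local Open Scope ring_scope.

(** * Lebesgue measure on R^d *)

(** The constant must not depend on the probability space, so it is fixed before the field. Three
    regimes are separated. If delta exceeds the deterministic bound of the average, the event is
    empty. If delta^2 L^g, with g = d beta/(d+beta), is below a constant, the right-hand side is at
    least 1. Otherwise delta is at least a negative power of L, and this is what lets two
    exponentially small errors, the tail outside a box and the distance from f to its local version,
    be charged to delta. The box has half-side about L^2: the tail is then exp(-L/2), while the
    number of cells and the diameter stay polynomial in L, so that a fraction of the mixing decay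
    absorbs them.

    Locality is assumed at the origin only. To get an approximant on every ball, the conditional
    expectation is factored through the path of A and evaluated on shifted paths; stationarity,
    given for finite-dimensional laws, is extended to the cylinder sigma-algebra in order to carry
    the almost sure error along. *)

Section lebesgue_rV_theory.
Context {R : realType}.
Implicit Types n : nat.

Lemma measurable_rV_cons n : measurable_fun setT (@rV_cons R n).
Proof.
apply: measurable_fun_rV => i; case: (unliftP ord0 i) => [j ->|->].
  rewrite (_ : (fun _ => _) = (fun v : 'rV[R]_n => v ord0 j) \o snd).
    apply: measurableT_comp; first exact: measurable_rV_coord.
    exact: measurable_snd.
  by apply/funext => p; rewrite mxE liftK.
rewrite (_ : (fun _ => _) = fst); first exact: measurable_fst.
by apply/funext => p; rewrite mxE unlift_none.
Qed.

Lemma rV_cons0 n t (v : 'rV[R]_n) : rV_cons (t, v) ord0 ord0 = t.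
Proof. by rewrite mxE unlift_none. Qed.

Lemma rV_consS n t (v : 'rV[R]_n) j :
  rV_cons (t, v) ord0 (lift ord0 j) = v ord0 j.
Proof. by rewrite mxE liftK. Qed.

Lemma measurable_rV_addr n (z : 'rV[R]_n) : measurable_fun setT (fun x : 'rV[R]_n => x + z).
Proof.
apply: measurable_fun_rV => i.
rewrite (_ : (fun _ => _) = (fun v : 'rV[R]_n => v ord0 i + z ord0 i)).
  by apply: measurable_funD => //; exact: measurable_rV_coord.
by apply/funext => v; rewrite mxE.
Qed.

Lemma measurable_enorm n : measurable_fun setT (@enorm R n).
Proof.
have msqrt : measurable_fun setT (@Num.sqrt R).
  by apply: continuous_measurable_fun; exact: sqrt_continuous.
rewrite /enorm; apply: (measurableT_comp msqrt).
apply: measurable_sum => i; apply: measurable_funX.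
exact: measurable_rV_coord.
Qed.

Local Open Scope ereal_scope.

Lemma lebesgue_measure_addr (c : R) (A : set (measurableTypeR R)) : measurable A ->
  (@lebesgue_measure R) ((+%R^~ c) @^-1` A) = lebesgue_measure A.
Proof.
move=> mA.
have mc : measurable_fun setT ((+%R^~ c) : measurableTypeR R -> measurableTypeR R).
  exact: measurable_funD.
pose m := measure_function_pushforward__canonical__measure_function_Measure
  (@lebesgue_measure R) mc.
rewrite -[LHS]/(m A) -(@lebesgue_measure_unique _ m)//.
move=> _ [[a b] /= _ <-]; rewrite /m/= /pushforward/=.
rewrite (_ : _ @^-1` _ = `](a - c)%R, (b - c)%R]%classic).
  rewrite !lebesgue_measure_itv/= !lte_fin ltrD2r.
  by case: ifPn => // _; rewrite -!EFinD; congr EFin; ring.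
by apply/seteqP; split=> x /=; rewrite !in_itv/= ltrBlDr lerBrDr.
Qed.

Lemma ge0_lebesgue_measure_shift (c : R) (f : measurableTypeR R -> \bar R) :
  measurable_fun setT f -> (forall x, 0 <= f x) ->
  \int[@lebesgue_measure R]_x f (x + c)%R = \int[@lebesgue_measure R]_x f x.
Proof.
move=> mf f0.
have mc : measurable_fun setT ((+%R^~ c) : measurableTypeR R -> measurableTypeR R).
  exact: measurable_funD.
rewrite -[LHS](@ge0_integral_pushforward _ _ _ _ _ _ mc _ setT)//.
pose m := measure_function_pushforward__canonical__measure_function_Measure
  (@lebesgue_measure R) mc.
apply: (@eq_measure_integral _ _ _ setT (@lebesgue_measure R) m) => A mA _.
exact: lebesgue_measure_addr.
Qed.

Lemma lebesgue_rV_tonelli n (f : 'rV[R]_n.+1 -> \bar R) :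
  measurable_fun setT f -> (forall x, 0 <= f x) ->
  \int[lebesgue_rV n.+1]_x f x =
  \int[@lebesgue_measure R]_t \int[lebesgue_rV n]_v f (rV_cons (t, v)).
Proof.
move=> mf f0.
rewrite /= /lebesgue_rV_step ge0_integral_pushforward//; last first.
  exact: measurable_rV_cons.
rewrite (fubini_tonelli1 (f \o @rV_cons R n))//.
  by apply: measurableT_comp => //; exact: measurable_rV_cons.
by move=> x; exact: f0.
Qed.

(** Induction on the dimension: [rV_cons] splits the shift into one of the first coordinate and one
    of the remaining n. *)
Lemma ge0_lebesgue_rV_shift n (z : 'rV[R]_n) (f : 'rV[R]_n -> \bar R) :
  measurable_fun setT f -> (forall x, 0 <= f x) ->
  \int[lebesgue_rV n]_x f (x + z)%R = \int[lebesgue_rV n]_x f x.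
Proof.
elim: n z f => [|n IH] z f mf f0.
  by apply: eq_integral => x _; rewrite [z]thinmx0 addr0.
have mfz : measurable_fun setT (fun x : 'rV[R]_n.+1 => f (x + z)%R).
  by apply: (measurableT_comp mf); exact: measurable_rV_addr.
rewrite (lebesgue_rV_tonelli mf f0).
have E1 := lebesgue_rV_tonelli mfz (fun x => f0 (x + z)%R).
rewrite {}E1.
pose zt := (\row_j z ord0 (lift ord0 j))%R.
have consD t v : (rV_cons (t, v) + z = rV_cons (t + z ord0 ord0, v + zt))%R.
  apply/rowP => i; rewrite !mxE; case: (unliftP ord0 i) => [j ->|->] /=.
    by rewrite !mxE.
  by [].
under eq_integral => t _.
  under eq_integral => v _ do rewrite consD.
  rewrite (IH zt (fun v => f (rV_cons (t + z ord0 ord0, v)%R)))//; last first.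
    apply: measurableT_comp => //.
    by apply: measurableT_comp; [exact: measurable_rV_cons|exact: pair1_measurable].
  over.
have mfc : measurable_fun setT (f \o @rV_cons R n).
  by apply: measurableT_comp => //; exact: measurable_rV_cons.
rewrite (@ge0_lebesgue_measure_shift (z ord0 ord0)
  (fun t => \int[lebesgue_rV n]_v f (rV_cons (t, v))))//.
  apply: (measurable_fun_fubini_tonelli_F (m2 := lebesgue_rV n) (f \o @rV_cons R n)) => //.
  by move=> x; exact: f0.
by move=> x; apply: integral_ge0.
Qed.

Lemma lebesgue_rV_prod n (g : R -> R) : measurable_fun setT g ->
  (forall t, 0 <= g t)%R ->
  \int[lebesgue_rV n]_x (\prod_(i < n) g (x ord0 i))%:E =
  (\int[@lebesgue_measure R]_t (g t)%:E) ^+ n.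
Proof.
move=> mg g0; have mprod m : measurable_fun setT
    (fun x : 'rV[R]_m => \prod_(i < m) g (x ord0 i))%R.
  apply: measurable_prod => i _.
  by apply: (measurableT_comp mg); exact: measurable_rV_coord.
have prod_ge0 m (x : 'rV[R]_m) : (0 <= \prod_(i < m) g (x ord0 i))%R.
  by apply: prodr_ge0.
elim: n => [|n IH].
  rewrite expe0 /= integral_dirac//= ?diracE ?in_setT ?mul1e ?big_ord0//.
  by apply/measurable_EFinP; exact: mprod.
rewrite lebesgue_rV_tonelli//; last 2 first.
- by apply/measurable_EFinP; exact: mprod.
- by move=> x; rewrite lee_fin; exact: prod_ge0.
under eq_integral => t _.
  under eq_integral => v _.
    rewrite big_ord_recl rV_cons0.
    under eq_bigr do rewrite rV_consS.
    rewrite EFinM; over.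
  rewrite ge0_integralZl_EFin//=; last 2 first.
  - by move=> x _; rewrite lee_fin; exact: prod_ge0.
  - by apply/measurable_EFinP; exact: mprod.
  rewrite IH; over.
rewrite ge0_integralZr//.
- by rewrite expeS.
- exact/measurable_EFinP.
- by move=> t _; rewrite lee_fin.
- by apply: expe_ge0; apply: integral_ge0 => t _; rewrite lee_fin.
Qed.

End lebesgue_rV_theory.

(** * The Euclidean norm *)

Section euclidean_theory.
Context {R : realType} {d : nat}.
Implicit Types x y : 'rV[R]_d.

Lemma enorm_ge0 x : 0 <= enorm x. Proof. exact: sqrtr_ge0. Qed.

Lemma ler_coord_enorm x i : `|x ord0 i| <= enorm x.
Proof.
rewrite -sqrtr_sqr /enorm ler_wsqrtr// (bigD1 i)//= lerDl.
by apply: sumr_ge0 => j _; exact: sqr_ge0.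
Qed.

Lemma enorm_le_sum x : enorm x <= \sum_(i < d) `|x ord0 i|.
Proof.
have s0 : 0 <= \sum_(i < d) `|x ord0 i| by exact: sumr_ge0.
rewrite -(@ler_pXn2r _ 2)// ?nnegrE ?enorm_ge0// sqr_sqrtr; last first.
  by apply: sumr_ge0 => i _; exact: sqr_ge0.
rewrite expr2 mulr_suml; apply: ler_sum => i _.
rewrite -real_normK ?num_real// expr2 ler_wpM2l// (bigD1 i)//= lerDl.
exact: sumr_ge0.
Qed.

Lemma enorm_le_dim x (c : R) : (forall i, `|x ord0 i| <= c) -> enorm x <= d%:R * c.
Proof.
move=> xc; apply: (le_trans (enorm_le_sum x)).
rewrite (le_trans (ler_sum _ (fun i _ => xc i)))//.
by rewrite sumr_const card_ord mulr_natl.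
Qed.

Lemma sum_coord_le_enorm x : \sum_(i < d) `|x ord0 i| <= d%:R * enorm x.
Proof.
rewrite (le_trans (ler_sum _ (fun i _ => ler_coord_enorm x i)))//.
by rewrite sumr_const card_ord mulr_natl.
Qed.

Lemma enormN x : enorm (- x) = enorm x.
Proof. by rewrite /enorm; under eq_bigr do rewrite mxE sqrrN. Qed.

Lemma enorm_distC x y : enorm (x - y) = enorm (y - x).
Proof. by rewrite -enormN opprB. Qed.

Lemma ler_enormD x y : enorm (x + y) <= enorm x + enorm y.
Proof.
pose s (u v : 'rV[R]_d) := \sum_(i < d) u ord0 i * v ord0 i.
have sq u : enorm u ^+ 2 = s u u.
  rewrite sqr_sqrtr; first by apply: eq_bigr => i _; rewrite expr2.
  by apply: sumr_ge0 => i _; exact: sqr_ge0.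
have CS : s x y <= enorm x * enorm y.
  have key : s x y ^+ 2 <= (enorm x * enorm y) ^+ 2.
    (* Cauchy-Schwarz comes from the nonnegative quadratic |t x + y|^2, evaluated below at its
       minimizer t = - s x y / s x x. *)
    have q0 (t : R) : 0 <= t ^+ 2 * s x x + 2 * t * s x y + s y y.
      rewrite /s !mulr_sumr -!big_split/=; apply: sumr_ge0 => i _.
      rewrite (_ : _ + _ = (t * x ord0 i + y ord0 i) ^+ 2) ?sqr_ge0//; ring.
    rewrite exprMn !sq.
    have [xx0|xx0] := eqVneq (s x x) 0.
      have xi i : x ord0 i = 0.
        move: xx0; rewrite -sq => /eqP; rewrite sqrf_eq0 => /eqP x0.
        by apply/eqP; rewrite -normr_le0 -x0; exact: ler_coord_enorm.
      rewrite [s x y]big1 ?expr0n/= ?xx0 ?mul0r// => i _.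
      by rewrite xi mul0r.
    have xxp : 0 < s x x by rewrite lt_neqAle eq_sym xx0 -sq sqr_ge0.
    have := q0 (- (s x y / s x x)).
    rewrite (_ : _ + _ + _ = s y y - s x y ^+ 2 / s x x); last by field.
    by rewrite subr_ge0 ler_pdivrMr// mulrC.
  have [sn|sp] := leP (s x y) 0.
    by rewrite (le_trans sn)// mulr_ge0// enorm_ge0.
  by rewrite -(@ler_pXn2r _ 2)// nnegrE ?mulr_ge0 ?enorm_ge0// ltW.
rewrite -(@ler_pXn2r _ 2)// ?nnegrE ?addr_ge0 ?enorm_ge0//.
rewrite sqrrD !sq (_ : s (x + y) _ = s x x + s x y *+ 2 + s y y).
  by rewrite lerD2r lerD2l lerMn2r CS orbT.
rewrite /s -sumrMnl -!big_split/=; apply: eq_bigr => i _; rewrite mxE.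
ring.
Qed.

Lemma enorm_triangle (z x y : 'rV[R]_d) : enorm (x - y) <= enorm (x - z) + enorm (z - y).
Proof. by rewrite -{1}(subrKA z) ler_enormD. Qed.

End euclidean_theory.

(** * Exponential weights and volumes of boxes *)

Section exponential_integrals.
Context {R : realType}.
Local Open Scope ereal_scope.

Lemma integral_expR_normr (a : R) : (0 < a)%R ->
  \int[@lebesgue_measure R]_t (expR (- (a^-1 * `|t|)))%:E = (2 * a)%:E.
Proof.
move=> a0; have ia0 : (0 < a^-1)%R by rewrite invr_gt0.
have ce : continuous (fun t : R => expR (- (a^-1 * `|t|))).
  move=> t; apply: continuous_comp; last exact: continuous_expR.
  apply: (@continuousN _ R^o); apply: (@continuousM _ R^o).
    exact: cst_continuous.
  exact: norm_continuous.
rewrite ge0_symfun_integralT//=; last first.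
  by move=> t /=; rewrite normrN.
have int1 : \int[@lebesgue_measure R]_(x in `[0%R, +oo[)
    (a^-1 * expR (- a^-1 * x))%:E = 1.
  rewrite integral_mkcond -(integral_exponential_pdf ia0).
  by apply: eq_integral => t _; rewrite /exponential_pdf !patchE; case: ifP.
rewrite EFinM; congr (_ * _).
rewrite -set_itvcy.
have mE : measurable_fun (`[0%R, +oo[%classic : set R) (fun t : R => (expR (- (a^-1 * `|t|)))%:E).
  apply/measurable_EFinP; apply: measurable_funTS.
  exact: continuous_measurable_fun.
have : a%:E * (a^-1%:E * \int[@lebesgue_measure R]_(x in `[0%R, +oo[)
    (expR (- (a^-1 * `|x|)))%:E) = a%:E * 1.
  congr (_ * _); rewrite -ge0_integralZl_EFin//; last exact: ltW.
  rewrite -int1; apply: eq_integral => t; rewrite inE/= in_itv/= andbT => t0.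
  by rewrite -EFinM ger0_norm// mulNr.
by rewrite muleA -EFinM mulfV ?gt_eqF// mul1e mule1.
Qed.

(** Since the sum of the |x_i| is at most d times the norm, the radial weight is dominated by a
    product over the coordinates, for which integrals and lattice sums factorize. *)
Lemma expR_enorm_le_prod d (b : R) (x : 'rV[R]_d) : (0 <= b)%R ->
  (expR (- (b * enorm x)) <=
   \prod_(i < d) expR (- ((d%:R / b)^-1 * `|x ord0 i|)))%R.
Proof.
move=> b0; rewrite -expR_sum ler_expR sumrN lerN2 -mulr_sumr.
rewrite invf_div mulrAC -mulrA.
case: d x => [|d] x; first by rewrite big_ord0 mul0r mulr0 mulr_ge0// enorm_ge0.
by rewrite ler_wpM2l// ler_pdivrMr// mulrC sum_coord_le_enorm.
Qed.

Lemma integral_expR_enorm d (b : R) : (0 < d)%N -> (0 < b)%R ->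
  \int[lebesgue_rV d]_x (expR (- (b * enorm x)))%:E <=
  ((2 * (d%:R / b)) ^+ d)%:E.
Proof.
move=> d0 b0; have db0 : (0 < d%:R / b :> R)%R by rewrite divr_gt0// ltr0n.
have mg : measurable_fun setT (fun t : R => expR (- ((d%:R / b)^-1 * `|t|))%R).
  apply: measurableT_comp => //; apply: measurable_funN.
  apply: measurable_funM => //; exact: measurable_normr.
rewrite EFin_expe -(integral_expR_normr db0) -lebesgue_rV_prod//.
apply: ge0_le_integral => //.
- apply/measurable_EFinP; apply: measurableT_comp => //; apply: measurable_funN.
  by apply: measurable_funM => //; exact: measurable_enorm.
- apply/measurable_EFinP; apply: measurable_prod => i _.
  by apply: (measurableT_comp mg); exact: measurable_rV_coord.
- by move=> x _; rewrite lee_fin expR_enorm_le_prod// ltW.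
Qed.

(** Used to measure the set of centres whose balls meet a set of given diameter; a sup-norm box
    replaces the Euclidean ball because its indicator is a product. *)
Lemma integral_box d (c : 'rV[R]_d) (rho : R) : (0 <= rho)%R ->
  \int[lebesgue_rV d]_x
    (\prod_(i < d) (`|x ord0 i - c ord0 i| <= rho)%R%:R)%:E = ((2 * rho) ^+ d)%:E.
Proof.
move=> rho0.
pose g (t : R) : R := \1_(`[(- rho)%R, rho]%classic : set R) t.
have mg : measurable_fun setT g by exact: measurable_indic.
have gE t : g t = (`|t| <= rho)%R%:R.
  by rewrite /g indicE mem_setE in_itv/= ler_norml.
rewrite EFin_expe (_ : (2 * rho)%:E = \int[@lebesgue_measure R]_t (g t)%:E).
  rewrite -lebesgue_rV_prod//.
  rewrite -[RHS](@ge0_lebesgue_rV_shift _ _ (- c)).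
  - by apply: eq_integral => x _; under [in RHS]eq_bigr do rewrite gE !mxE.
  - apply/measurable_EFinP; apply: measurable_prod => i _.
    by apply: (measurableT_comp mg); exact: measurable_rV_coord.
  - by move=> x; rewrite lee_fin prodr_ge0// => i _; rewrite gE.
transitivity (@lebesgue_measure R `[(- rho)%R, rho]); last first.
  by rewrite integral_indic// setIT.
rewrite lebesgue_measure_itv/= lte_fin.
case: ifPn; first by rewrite -EFinB; move=> _; congr EFin; ring.
by rewrite -leNgt => ?; congr EFin; lra.
Qed.

End exponential_integrals.

(** * Folding the space onto a cube *)

Section jensen.
Context {dT} {T : measurableType dT} {R : realType}.
Variables (mu : {measure set T -> \bar R}) (q : T -> R).
Hypotheses (mq : measurable_fun setT q) (q0 : forall x, 0 <= q x).
Hypothesis q1 : (\int[mu]_x (q x)%:E = 1)%E.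

Lemma integrable_density : mu.-integrable setT (EFin \o q).
Proof.
apply/integrableP; split; first exact/measurable_EFinP.
rewrite (_ : integral _ _ _ = 1%E) ?ltry// -q1; apply: eq_integral => x _ /=.
by rewrite ger0_norm.
Qed.

Lemma integrable_densityM (S : T -> R) (K : R) : measurable_fun setT S ->
  (forall x, q x != 0 -> `|S x| <= K) -> mu.-integrable setT (EFin \o (fun x => q x * S x)).
Proof.
move=> mS SK.
apply: (@le_integrable _ _ _ mu setT measurableT _ (EFin \o (fun x => K * q x))).
- by apply/measurable_EFinP; exact: measurable_funM.
- move=> x _ /=; rewrite lee_fin normrM [leLHS]mulrC.
  have [->|qx] := eqVneq (q x) 0; first by rewrite normr0 !mulr0 normr0.
  rewrite normrM ler_wpM2r// (le_trans (SK x qx))// ler_norm //.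
- have := integrableZl measurableT K integrable_density.
  by [].
Qed.

(** The exponential lies above its tangent at the mean m, that is above expR m * (1 + (S - m));
    integrated against the density q, this line returns expR m. *)
Lemma expR_jensen (S : T -> R) (K : R) : measurable_fun setT S ->
  (forall x, q x != 0 -> `|S x| <= K) ->
  ((expR (\int[mu]_x (q x * S x)))%:E <= \int[mu]_x (q x * expR (S x))%:E)%E.
Proof.
move=> mS SK; set m := \int[mu]_x (q x * S x).
have iqS := integrable_densityM mS SK.
have mE : (\int[mu]_x (q x * S x)%:E = m%:E)%E.
  by rewrite /m /Rintegral fineK// integrable_fin_num.
pose f x := expR m * (1 - m) * q x + expR m * (q x * S x).
have if1 : mu.-integrable setT (EFin \o (fun x => expR m * (1 - m) * q x)).
  exact: (integrableZl measurableT (expR m * (1 - m)) integrable_density).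
have if2 : mu.-integrable setT (EFin \o (fun x => expR m * (q x * S x))).
  exact: (integrableZl measurableT (expR m) iqS).
have <- : (\int[mu]_x (f x)%:E = (expR m)%:E)%E.
  under eq_integral do rewrite /f EFinD.
  rewrite integralD//.
  under eq_integral do rewrite EFinM.
  rewrite integralZl//; last exact: integrable_density.
  rewrite q1 mule1; under eq_integral do rewrite EFinM.
  rewrite integralZl// mE -EFinM -EFinD; congr EFin; ring.
apply: le_integral => //.
- by apply: eq_integrable (integrableD measurableT if1 if2).
- apply: (integrable_densityM (K := expR K)); first exact: measurableT_comp.
  by move=> x qx; rewrite ger0_norm ?expR_ge0// ler_expR (le_trans (ler_norm _))// SK.
- move=> x _; rewrite lee_fin /f.
  rewrite (_ : _ + _ = q x * (expR m * (1 + (S x - m)))); last by ring.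
  rewrite ler_wpM2l// (_ : expR (S x) = expR m * expR (S x - m)); last first.
    by rewrite -expRD addrC subrK.
  by rewrite ler_wpM2l ?expR_ge0// expR_ge1Dx.
Qed.

End jensen.

Section lattice.
Context {R : realType} {d : nat}.
Variables (r : R) (n : nat).
Hypothesis r0 : 0 < r.

Definition unif_pdf (t : R) : R := r^-1 * (0 <= t < r)%R%:R.

Definition cube_pdf (x : 'rV[R]_d) : R := \prod_(i < d) unif_pdf (x ord0 i).

(** Indices in [0, 2n) are recentred by n: the translates of [0, r)^d by these points tile the box
    of [box_indic]. *)
Definition lattice (z : {ffun 'I_d -> 'I_(n + n)}) : 'rV[R]_d :=
  \row_i (r * ((z i)%:R - n%:R)).

Definition box_indic (x : 'rV[R]_d) : R :=
  \prod_(i < d) (- (n%:R * r) <= x ord0 i < n%:R * r)%R%:R.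

Lemma unif_pdf_ge0 t : 0 <= unif_pdf t.
Proof. by rewrite /unif_pdf mulr_ge0// invr_ge0 ltW. Qed.

Lemma cube_pdf_ge0 x : 0 <= cube_pdf x.
Proof. by apply: prodr_ge0 => i _; exact: unif_pdf_ge0. Qed.

Lemma unif_pdfE t : unif_pdf t = r^-1 * \1_(`[0, r[%classic : set R) t.
Proof. by rewrite /unif_pdf indicE mem_setE in_itv/=. Qed.

Lemma measurable_unif_pdf : measurable_fun setT unif_pdf.
Proof.
rewrite (_ : unif_pdf = fun t => r^-1 * \1_(`[0, r[%classic : set R) t).
  by apply: measurable_funM => //; exact: measurable_indic.
by apply/funext => t; exact: unif_pdfE.
Qed.

Lemma measurable_cube_pdf : measurable_fun setT cube_pdf.
Proof.
apply: measurable_prod => i _.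
by apply: (measurableT_comp measurable_unif_pdf); exact: measurable_rV_coord.
Qed.

Lemma integral_cube_pdf : (\int[lebesgue_rV d]_x (cube_pdf x)%:E = 1)%E.
Proof.
rewrite lebesgue_rV_prod; last 2 first.
- exact: measurable_unif_pdf.
- exact: unif_pdf_ge0.
rewrite (_ : integral _ _ _ = 1%:E) -?EFin_expe ?expr1n//.
under eq_integral do rewrite unif_pdfE EFinM.
rewrite ge0_integralZl_EFin//; last 2 first.
- by apply/measurable_EFinP; exact: measurable_indic.
- by rewrite invr_ge0 ltW.
transitivity (r^-1%:E * @lebesgue_measure R `[0%R, r[)%E.
  by rewrite integral_indic// setIT.
rewrite lebesgue_measure_itv/= lte_fin r0 oppr0 adde0 -EFinM mulVf ?gt_eqF//.
Qed.

Lemma cube_pdf_neq0 x : cube_pdf x != 0 -> forall i, 0 <= x ord0 i < r.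
Proof.
move=> /prodf_neq0 + i => /(_ i isT).
by rewrite /unif_pdf; case: (0 <= x ord0 i < r); rewrite // mulr0 eqxx.
Qed.

Lemma sum_cube_pdf x : \sum_z cube_pdf (x - lattice z) = r ^- d * box_indic x.
Proof.
(* In one dimension the first m half-open intervals fill [-nr, (m-n)r), by induction on m; the
   product over the coordinates is then distributed over the sums. *)
have H (t : R) m : \sum_(k < m) unif_pdf (t - r * (k%:R - n%:R)) =
    r^-1 * (- (n%:R * r) <= t < (m%:R - n%:R) * r)%R%:R.
  elim: m => [|m IH].
    rewrite big_ord0 (_ : (_ <= t < _) = false) ?mulr0//; lra.
  rewrite big_ord_recr/= IH /unif_pdf -mulrDr; congr (_ * _).
  rewrite -natr1.
  have rn : 0 <= r * n%:R by rewrite mulr_ge0// ltW.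
  have rm : 0 <= r * m%:R by rewrite mulr_ge0// ltW.
  case: (ltP t ((m%:R - n%:R) * r)) => tm.
    rewrite (_ : (0 <= _) = false) ?addr0; last by lra.
    rewrite (_ : (m%:R + 1 - n%:R) * r = (m%:R - n%:R) * r + r); last by ring.
    by rewrite (lt_trans tm) ?ltrDl.
  rewrite andbF add0r (_ : (0 <= _) = true); last by lra.
  rewrite (_ : (- (n%:R * r) <= t) = true)/=; last by nra.
  by rewrite ltrBlDl (_ : (m%:R + 1 - n%:R) * r = r * (m%:R - n%:R) + r) //; ring.
rewrite /box_indic.
transitivity (\prod_(i < d) \sum_(k < n + n) unif_pdf (x ord0 i - r * (k%:R - n%:R))).
  by rewrite bigA_distr_bigA/=; apply: eq_bigr => z _; apply: eq_bigr => i _; rewrite !mxE.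
under eq_bigr => i _ do rewrite H natrD addrK.
by rewrite big_split/= prodr_const card_ord exprVn.
Qed.

Lemma lattice_sep z z' : z != z' -> r <= enorm (lattice z - lattice z').
Proof.
move=> zz'; have [i zi] : exists i, z i != z' i.
  apply/existsP; apply: contraNT zz'; rewrite negb_exists => /forallP H.
  by apply/eqP/ffunP => i; apply/eqP; have := H i; rewrite negbK.
apply: le_trans (ler_coord_enorm _ i); rewrite !mxE -mulrBr opprB addrA subrK.
rewrite normrM gtr0_norm//.
have H (a b : nat) : a != b -> 1 <= `|a%:R - b%:R| :> R.
  have H1 (e g : nat) : (e < g)%N -> 1 <= `|g%:R - e%:R| :> R.
    rewrite -(ler_nat R) -natr1 => eg; rewrite ger0_norm; lra.
  by rewrite neq_ltn => /orP[/H1|/H1//]; rewrite distrC.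
by rewrite -[leLHS]mulr1 ler_wpM2l ?(ltW r0)// H.
Qed.

Lemma lattice_dist z z' : enorm (lattice z - lattice z') <= d%:R * (2 * n%:R * r).
Proof.
apply: enorm_le_dim => i; rewrite !mxE -mulrBr opprB addrA subrK.
rewrite normrM gtr0_norm// mulrC ler_wpM2r ?(ltW r0)//.
have zn : (z i)%:R < n%:R + n%:R :> R by rewrite -natrD ltr_nat.
have zn' : (z' i)%:R < n%:R + n%:R :> R by rewrite -natrD ltr_nat.
have z0 : 0 <= (z i)%:R :> R by [].
have z0' : 0 <= (z' i)%:R :> R by [].
rewrite ler_norml; apply/andP; split; lra.
Qed.

(** The sum is at most 1 / (1 - expR (- u)), and expR u >= 1 + u gives 1 - expR (- u) >= u / (1 +
    u). *)
Lemma geometric_le (u : R) m : 0 < u ->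
  \sum_(k < m) expR (- (u * k%:R)) <= 1 + u^-1.
Proof.
move=> u0; set s := \sum_(k < m) _.
have E : (1 - expR (- u)) * s = 1 - expR (- (u * m%:R)).
  rewrite /s; elim: m {s} => [|m IH]; first by rewrite big_ord0 !mulr0 oppr0 expR0 subrr.
  rewrite big_ord_recr/= mulrDr IH -natr1 mulrDr mulr1 opprD expRD; ring.
have u1 : 0 < 1 + u by rewrite addr_gt0.
have eu : expR (- u) <= (1 + u)^-1.
  by rewrite expRN lef_pV2 ?posrE ?expR_gt0// expR_ge1Dx.
have H : u / (1 + u) <= 1 - expR (- u).
  rewrite lerBrDr -lerBrDl (le_trans eu)//.
  by rewrite (_ : 1 - _ = (1 + u)^-1)//; field; rewrite gt_eqF.
have p : 0 < u / (1 + u) by rewrite divr_gt0.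
rewrite (_ : 1 + u^-1 = (u / (1 + u))^-1); last by field; rewrite !gt_eqF.
rewrite -[leRHS]mul1r ler_pdivlMr// mulrC (le_trans (_ : _ <= (1 - expR (- u)) * s))//.
  by rewrite ler_wpM2r// sumr_ge0// => k _; exact: expR_ge0.
by rewrite E gerBl expR_ge0.
Qed.

Lemma lattice_sum (b : R) y : (0 < d)%N -> 0 < b -> cube_pdf y != 0 ->
  \sum_z expR (- (b * enorm (y + lattice z))) <= (2 * (1 + d%:R / (b * r))) ^+ d.
Proof.
move=> d0 b0 /cube_pdf_neq0 yP.
pose u := (d%:R / b)^-1 * r.
have u0 : 0 < u by rewrite mulr_gt0// invr_gt0 divr_gt0// ltr0n.
apply: (@le_trans _ _ (\prod_(i < d) \sum_(k < n + n)
    expR (- ((d%:R / b)^-1 * `|y ord0 i + r * (k%:R - n%:R)|)))).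
  rewrite bigA_distr_bigA/=; apply: ler_sum => z _.
  rewrite (le_trans (expR_enorm_le_prod _ (ltW b0)))//.
  by apply: ler_prod => i _; rewrite expR_ge0 !mxE lexx.
rewrite -[X in _ <= _ ^+ X](card_ord d) -prodr_const; apply: ler_prod => i _.
rewrite sumr_ge0/=; last by move=> k _; exact: expR_ge0.
rewrite big_split_ord/= (_ : 2 * _ = (1 + u^-1) + (1 + u^-1)); last first.
  by rewrite /u; field; rewrite !gt_eqF ?ltr0n.
have /andP[yi0 yir] := yP i.
(* For k < n the point is negative: with k = n - 1 - k' and y_i < r, it lies below - r k'. For k >=
   n it lies above r (k - n). Each half is a geometric sum. *)
apply: lerD.
  rewrite (reindex_inj rev_ord_inj)/= (le_trans _ (geometric_le n u0))//.
  apply: ler_sum => k _; rewrite ler_expR lerN2 /u -mulrA ler_wpM2l//.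
    by rewrite invr_ge0 divr_ge0// ltW.
  rewrite natrB//.
  have : r * 0 <= r * k%:R by rewrite ler_wpM2l// ltW.
  rewrite -natr1 => H.
  rewrite ler_normr; apply/orP; right; lra.
apply: (le_trans _ (geometric_le n u0)).
apply: ler_sum => k _; rewrite ler_expR lerN2 /u -mulrA ler_wpM2l//.
  by rewrite invr_ge0 divr_ge0// ltW.
apply: (le_trans _ (ler_norm _)); rewrite natrD addrAC subrr add0r.
by rewrite lerDr.
Qed.

End lattice.

Section folding.
Context {R : realType} {d : nat}.
Implicit Types (h : 'rV[R]_d -> R).

Lemma measurable_fun_shift (z : 'rV[R]_d) d' (V : measurableType d') (f : 'rV[R]_d -> V) :
  measurable_fun setT f -> measurable_fun setT (fun x : 'rV[R]_d => f (x + z)).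
Proof. by move=> mf; apply: (measurableT_comp mf); exact: measurable_rV_addr. Qed.

Lemma lebesgue_rV_shift (z : 'rV[R]_d) (f : 'rV[R]_d -> \bar R) :
  measurable_fun setT f ->
  (\int[lebesgue_rV d]_x f (x + z)%R = \int[lebesgue_rV d]_x f x)%E.
Proof.
move=> mf; rewrite integralE [RHS]integralE; congr (_ - _)%E.
- rewrite -[RHS](@ge0_lebesgue_rV_shift _ _ z)//.
    by apply: eq_integral => x _; rewrite funeposE funeposE.
  exact: measurable_funepos.
- rewrite -[RHS](@ge0_lebesgue_rV_shift _ _ z)//.
    by apply: eq_integral => x _; rewrite funenegE funenegE.
  exact: measurable_funeneg.
Qed.

Lemma integrable_shift (z : 'rV[R]_d) (f : 'rV[R]_d -> \bar R) :
  (lebesgue_rV d).-integrable setT f ->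
  (lebesgue_rV d).-integrable setT (fun x : 'rV[R]_d => f (x + z)).
Proof.
move=> /integrableP[mf foo]; apply/integrableP; split.
  exact: measurable_fun_shift.
rewrite (@lebesgue_rV_shift z (fun x => `|f x|)%E)//.
exact: measurableT_comp.
Qed.

Variables (r : R) (n : nat).
Hypothesis r0 : 0 < r.

(** The integral over the box becomes the mean, over y uniform in one cell, of a lattice sum: in the
    variable x = y + lattice z the density is cube_pdf (x - lattice z), and [sum_cube_pdf] sums
    these. *)
Lemma box_fold h (K : R) : measurable_fun setT h -> (forall x, `|h x| <= K) ->
  \int[lebesgue_rV d]_x (h x * box_indic r n x) =
  \int[lebesgue_rV d]_y (cube_pdf r y * (r ^+ d * \sum_z h (y + @lattice R d r n z))).
Proof.
move=> mh hK.
have iq := integrable_density (measurable_cube_pdf r) (cube_pdf_ge0 r0) (integral_cube_pdf r0 (d := d)).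
have mq := @measurable_cube_pdf R d r.
have iG z : (lebesgue_rV d).-integrable setT
    (fun y => (cube_pdf r y * (r ^+ d * h (y + @lattice R d r n z)))%:E).
  apply: (@integrable_densityM _ _ _ _ _ mq (cube_pdf_ge0 r0) (integral_cube_pdf r0)
    _ (r ^+ d * K)) => //.
  - by apply: measurable_funM => //; exact: measurable_fun_shift.
  - by move=> x _; rewrite normrM ger0_norm ?exprn_ge0 ?(ltW r0)// ler_wpM2l// exprn_ge0// ltW.
rewrite /Rintegral; congr fine.
pose G z x := (cube_pdf r (x - @lattice R d r n z) * (r ^+ d * h x))%:E.
have -> : (\int[lebesgue_rV d]_x (h x * box_indic r n x)%:E =
    \int[lebesgue_rV d]_x (\sum_z G z x)%R)%E.
  apply: eq_integral => x _; rewrite /G sumEFin -mulr_suml sum_cube_pdf//; congr EFin.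
  rewrite mulrACA [X in _ = X]mulrA; field.
  by rewrite expf_neq0// gt_eqF.
have -> : (\int[lebesgue_rV d]_y (cube_pdf r y *
      (r ^+ d * \sum_z h (y + @lattice R d r n z)))%:E =
    \int[lebesgue_rV d]_y (\sum_z G z (y + @lattice R d r n z))%R)%E.
  apply: eq_integral => x _; rewrite /G sumEFin; congr EFin.
  rewrite mulr_sumr mulr_sumr; apply: eq_bigr => z _.
  by rewrite addrK.
have iGz z : (lebesgue_rV d).-integrable setT (fun y => G z (y + @lattice R d r n z)).
  by apply: eq_integrable (iG z) => // y _; rewrite /G addrK.
have iG0 z : (lebesgue_rV d).-integrable setT (G z).
  apply: eq_integrable (integrable_shift (- @lattice R d r n z) (iGz z)) => // y _.
  by rewrite /= addrNK.
rewrite integral_sum// integral_sum//; apply: eq_bigr => z _.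
rewrite lebesgue_rV_shift//; exact: measurable_int (iG0 z).
Qed.

Lemma expR_box_le h (K t : R) : measurable_fun setT h -> (forall x, `|h x| <= K) ->
  ((expR (t * \int[lebesgue_rV d]_x (h x * box_indic r n x)))%:E <=
  \int[lebesgue_rV d]_y (cube_pdf r y *
    expR (t * (r ^+ d * \sum_z h (y + @lattice R d r n z))))%:E)%E.
Proof.
move=> mh hK.
have mq := @measurable_cube_pdf R d r.
pose S y := r ^+ d * \sum_z h (y + @lattice R d r n z).
have mS : measurable_fun setT S.
  apply: measurable_funM => //; apply: measurable_sum => z.
  exact: measurable_fun_shift.
pose K' := r ^+ d * \sum_(z : {ffun 'I_d -> 'I_(n + n)}) K.
have SK y : `|S y| <= K'.
  rewrite normrM ger0_norm ?exprn_ge0 ?(ltW r0)// ler_wpM2l ?exprn_ge0 ?(ltW r0)//.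
  by rewrite (le_trans (ler_norm_sum _ _ _))// ler_sum.
rewrite (box_fold mh hK) -RintegralZl//; last first.
  exact: (@integrable_densityM _ _ _ _ _ mq (cube_pdf_ge0 r0) (integral_cube_pdf r0)
    _ K' mS (fun x _ => SK x)).
under eq_Rintegral do rewrite mulrCA.
apply: (@expR_jensen _ _ _ _ _ _ _ _ (fun y => t * S y) (`|t| * K')) => //.
- exact: (cube_pdf_ge0 r0).
- exact: (integral_cube_pdf r0).
- exact: measurable_funM.
- by move=> x _; rewrite normrM ler_wpM2l.
Qed.

Lemma box_indic01 (x : 'rV[R]_d) : box_indic r n x = 1 \/
  (box_indic r n x = 0 /\ n%:R * r <= enorm x).
Proof.
rewrite /box_indic; have [/forallP H|] := boolP [forall i : 'I_d, - (n%:R * r) <= x ord0 i < n%:R * r].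
  by left; rewrite big1// => i _; rewrite H.
rewrite negb_forall => /existsP[i Hi]; right; split.
  by rewrite (bigD1 i)//= (negbTE Hi) mul0r.
apply: le_trans (ler_coord_enorm x i).
by move: Hi; rewrite negb_and -ltNge -leNgt => /orP[Hi|]; rewrite ler_normr; lra.
Qed.

Lemma measurable_box_indic : measurable_fun setT (@box_indic R d r n).
Proof.
apply: measurable_prod => i _.
rewrite (_ : (fun _ => _) = (\1_(`[- (n%:R * r), n%:R * r[%classic : set R) : R -> R) \o
   (fun x : 'rV[R]_d => x ord0 i)).
  by apply: measurableT_comp; [exact: measurable_indic|exact: measurable_rV_coord].
by apply/funext => x; rewrite /= indicE mem_setE in_itv.
Qed.

Lemma integrable_expR_enormM (b K : R) (Phi : 'rV[R]_d -> R) : (0 < d)%N -> 0 < b ->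
  measurable_fun setT Phi -> (forall x, `|Phi x| <= K) ->
  (lebesgue_rV d).-integrable setT (fun x => (expR (- (b * enorm x)) * Phi x)%:E).
Proof.
move=> d0 b0 mPhi PhiK.
have mE : measurable_fun setT (fun x : 'rV[R]_d => expR (- (b * enorm x))).
  apply: measurableT_comp => //; apply: measurable_funN.
  by apply: measurable_funM => //; exact: measurable_enorm.
apply: (@le_integrable _ _ _ _ setT measurableT _ (fun x => (K * expR (- (b * enorm x)))%:E)).
- by apply/measurable_EFinP; exact: measurable_funM.
- move=> x _ /=; rewrite lee_fin !normrM mulrC ler_wpM2r// (le_trans (PhiK x))//.
  exact: ler_norm.
- have iE : (lebesgue_rV d).-integrable setT (fun x => (expR (- (b * enorm x)))%:E).
    apply/integrableP; split; first exact/measurable_EFinP.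
    rewrite (_ : integral _ _ _ = \int[lebesgue_rV d]_x (expR (- (b * enorm x)))%:E)%E; last first.
      by apply: eq_integral => x _; rewrite gee0_abs// lee_fin expR_ge0.
    by rewrite (le_lt_trans (integral_expR_enorm d0 b0))// ltry.
  exact: (integrableZl measurableT K iE).
Qed.

(** Outside the box the norm is at least n r, so half of the exponent gives the small factor and the
    other half keeps the integral finite. The case n = 0 bounds the whole integral. *)
Lemma box_tail (b K : R) (Phi : 'rV[R]_d -> R) : (0 < d)%N -> 0 < b ->
  measurable_fun setT Phi -> (forall x, `|Phi x| <= K) ->
  `|\int[lebesgue_rV d]_x (expR (- (b * enorm x)) * Phi x) -
    \int[lebesgue_rV d]_x (expR (- (b * enorm x)) * Phi x * box_indic r n x)| <=
  K * expR (- (b / 2 * (n%:R * r))) * (2 * (d%:R / (b / 2))) ^+ d.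
Proof.
move=> d0 b0 mPhi PhiK.
have b2 : 0 < b / 2 by rewrite divr_gt0.
have K0 : 0 <= K by rewrite (le_trans _ (PhiK 0)).
have boxK (x : 'rV[R]_d) : `|box_indic r n x : R| <= 1.
  by case: (box_indic01 x) => [->|[-> _]]; rewrite ?normr1 ?normr0.
have i1 := integrable_expR_enormM d0 b0 mPhi PhiK.
have i2 : (lebesgue_rV d).-integrable setT
    (fun x => (expR (- (b * enorm x)) * Phi x * box_indic r n x)%:E).
  have mPb : measurable_fun setT (fun x => Phi x * box_indic r n x).
    by apply: measurable_funM => //; exact: measurable_box_indic.
  apply: eq_integrable (integrable_expR_enormM (K := K) d0 b0 mPb _) => //.
    by move=> x _; rewrite mulrA.
  by move=> x; rewrite normrM -[leRHS]mulr1 ler_pM.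
have mE : measurable_fun setT (fun x : 'rV[R]_d => expR (- (b / 2 * enorm x))).
  apply: measurableT_comp => //; apply: measurable_funN.
  by apply: measurable_funM => //; exact: measurable_enorm.
set c := K * expR (- (b / 2 * (n%:R * r))).
have c0 : 0 <= c by rewrite mulr_ge0// expR_ge0.
rewrite -RintegralB//.
set D := fun x => _ - _.
have iD : (lebesgue_rV d).-integrable setT (EFin \o D).
  by apply: eq_integrable (integrableB measurableT i1 i2).
apply: (le_trans (le_normr_Rintegral _ iD)) => //.
have iN := integrable_norm iD.
rewrite -lee_fin /Rintegral fineK; last exact: integrable_fin_num.
apply: (@le_trans _ _ (\int[lebesgue_rV d]_x (c * expR (- (b / 2 * enorm x)))%:E)%E).
  apply: ge0_le_integral => //.
  - exact: measurable_int iN.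
  - by apply/measurable_EFinP; exact: measurable_funM.
  - move=> x _; rewrite lee_fin /D.
    case: (box_indic01 x) => [->|[-> nrx]].
      by rewrite mulr1 subrr normr0 mulr_ge0// expR_ge0.
    rewrite mulr0 subr0 normrM ger0_norm ?expR_ge0// mulrC /c -mulrA -expRD.
    rewrite ler_pM ?expR_ge0// ler_expR.
    have := ler_wpM2l (ltW b2) nrx; lra.
under eq_integral do rewrite EFinM.
rewrite ge0_integralZl_EFin//.
  by rewrite [leRHS]EFinM; apply: lee_wpmul2l; rewrite ?lee_fin//; exact: integral_expR_enorm.
exact/measurable_EFinP.
Qed.

End folding.

(** * Decoupling under mixing *)

Section sigma_gen_theory.
Context {R : realType} {I : Type} {U : pointedType}.
Implicit Types (Z : I -> U -> R) (S : set I).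

Lemma sigma_gen_sub Z S1 S2 : S1 `<=` S2 -> sigma_gen Z S1 `<=` sigma_gen Z S2.
Proof. by move=> S12; apply: sub_sigma_algebra2; exact: bigcup_subset. Qed.

(** Makes the closure properties of [measurable_fun] available for generated sub-sigma-algebras. *)
Lemma measurable_wrt_sigmaP (G : set (set U)) dV (V : measurableType dV) (X : U -> V) :
  measurable_wrt <<s G >> X <->
  measurable_fun (setT : set (g_sigma_algebraType G)) (X : g_sigma_algebraType G -> V).
Proof.
split=> [mX _ B mB|mX _ [B mB <-]].
- by apply: mX; exists B.
- exact: mX.
Qed.

Lemma measurable_wrt_sub (G1 G2 : set (set U)) dV (V : measurableType dV) (X : U -> V) :
  G1 `<=` G2 -> measurable_wrt G1 X -> measurable_wrt G2 X.
Proof. by move=> G12 mX B /mX /G12. Qed.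

End sigma_gen_theory.

Lemma measurable_wrt_comp {U : Type} (G : set (set U)) d1 d2 (V1 : measurableType d1)
    (V2 : measurableType d2) (h : V1 -> V2) (X : U -> V1) : measurable_fun setT h ->
  measurable_wrt G X -> measurable_wrt G (h \o X).
Proof.
move=> mh mX _ [B mB <-]; apply: mX; exists (h @^-1` B) => //.
by rewrite -[_ @^-1` _]setTI; exact: mh.
Qed.

Section bounded_expectation.
Context {R : realType} {dT} {T : measurableType dT} (P : probability T R).

Lemma bounded_integrable (X : T -> R) (K : R) : measurable_fun setT X ->
  (forall w, `|X w| <= K) -> P.-integrable setT (EFin \o X).
Proof.
move=> mX XK.
apply: (@le_integrable _ _ _ P setT measurableT _ (cst K%:E)).
- exact/measurable_EFinP.
- by move=> w _; rewrite /= lee_fin (le_trans (XK w))// ler_norm.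
- exact: finite_measure_integrable_cst.
Qed.

Lemma integrable_scale (c : R) (X : T -> R) : P.-integrable setT (EFin \o X) ->
  P.-integrable setT (EFin \o (fun w => c * X w)).
Proof. by move=> iX; have := integrableZl measurableT c iX. Qed.

Lemma Rintegral_prob_cst (c : R) : \int[P]_w c = c.
Proof.
have P1 : fine (P setT) = 1 by rewrite probability_setT.
exact: etrans (Rintegral_cst P measurableT c) (etrans (congr1 ( *%R c) P1) (mulr1 c)).
Qed.

Lemma Rintegral_sum (J : Type) (s : seq J) (f : J -> T -> R) :
  (forall i, P.-integrable setT (EFin \o f i)) ->
  \int[P]_w (\sum_(i <- s) f i w) = \sum_(i <- s) \int[P]_w f i w.
Proof.
move=> intf; elim: s => [|i s IH].
  under eq_Rintegral do rewrite big_nil.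
  by rewrite Rintegral_prob_cst big_nil.
under eq_Rintegral do rewrite big_cons.
rewrite RintegralD//; first by rewrite IH big_cons.
have := integrable_sum measurableT s (P := xpredT) (fun i _ => intf i).
by apply: eq_integrable => // w _; rewrite /= sumEFin.
Qed.

Lemma Rintegral_indic (B : set T) : measurable B ->
  \int[P]_w (\1_B w : R) = fine (P B).
Proof. by move=> mB; rewrite /Rintegral integral_indic// setIT. Qed.

Lemma indic_integrable (B : set T) : measurable B ->
  P.-integrable setT (EFin \o (\1_B : T -> R)).
Proof.
move=> mB; apply: (@bounded_integrable _ 1); first exact: measurable_indic.
by move=> w; rewrite indicE ger0_norm ?ler0n// lern1 leq_b1.
Qed.

Lemma Rintegral_bounds (X : T -> R) (a b : R) : measurable_fun setT X ->
  (forall w, a <= X w <= b) -> a <= \int[P]_w X w <= b.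
Proof.
move=> mX aXb.
have iX : P.-integrable setT (EFin \o X).
  apply: (@bounded_integrable _ (`|a| + `|b|)) => // w.
  have /andP[aX Xb] := aXb w; rewrite ler_norml.
  by apply/andP; split; [have := ler_norm (- a); rewrite normrN|have := ler_norm b];
    have := normr_ge0 a; have := normr_ge0 b; lra.
have ic c : P.-integrable setT (EFin \o (fun=> c : R)).
  exact: finite_measure_integrable_cst.
apply/andP; split.
- rewrite -[leLHS]Rintegral_prob_cst; apply: le_Rintegral => // w _.
  by case/andP: (aXb w).
- rewrite -[leRHS]Rintegral_prob_cst; apply: le_Rintegral => // w _.
  by case/andP: (aXb w).
Qed.

End bounded_expectation.

Section mixing.
Context {R : realType} {dT} {T : measurableType dT} (P : probability T R).

(** For t >= 0 this is the integer part of t capped at N, written as a sum of threshold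
    indicators. *)
Definition level_count (N : nat) (t : R) : R := \sum_(k < N) (k.+1%:R <= t)%R%:R.

Lemma level_countP N t :
  (N%:R <= t -> level_count N t = N%:R) /\
  (0 <= t <= N%:R -> level_count N t <= t <= level_count N t + 1).
Proof.
elim: N => [|N [IH1 IH2]]; split.
- by rewrite /level_count big_ord0.
- by rewrite /level_count big_ord0 => /andP[? ?]; apply/andP; split; lra.
- rewrite /level_count big_ord_recr/= => Nt; rewrite Nt -/(level_count N t) IH1 ?natr1//.
  by rewrite (le_trans _ Nt)// ler_nat.
- rewrite /level_count big_ord_recr/= -/(level_count N t) => /andP[t0 tN].
  have [Nt|Nt] := leP N.+1%:R t.
    rewrite IH1; last by rewrite (le_trans _ Nt)// ler_nat.
    by move: Nt tN; rewrite -natr1 => * /=; apply/andP; split; lra.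
  rewrite addr0; have [tN'|tN'] := leP t N%:R; first by apply: IH2; rewrite t0.
  rewrite (IH1 (ltW tN')); move: Nt; rewrite -natr1 => *; apply/andP; split; lra.
Qed.

Lemma measurable_level (t : R) (X : T -> R) : measurable_fun setT X ->
  measurable [set w | t <= X w].
Proof.
move=> mX; rewrite (_ : [set _ | _] = setT `&` X @^-1` `[t, +oo[%classic).
  exact: mX.
by rewrite setTI; apply/seteqP; split=> w /=; rewrite in_itv/= andbT.
Qed.

Lemma measurable_wrt_level (G : set (set T)) (t : R) (X : T -> R) : measurable_wrt G X ->
  G [set w | t <= X w].
Proof.
move=> mX; apply: mX; exists `[t, +oo[%classic => //.
by rewrite setTI; apply/seteqP; split=> w /=; rewrite in_itv/= andbT.
Qed.

Lemma covariance_alpha01 (G1 G2 : set (set T)) (a : R) (X Y : T -> R) :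
  G1 `<=` measurable -> G2 `<=` measurable ->
  (alpha_coef P G1 G2 <= a%:E)%E ->
  measurable_wrt G1 X -> measurable_wrt G2 Y ->
  (forall w, 0 <= X w <= 1) -> (forall w, 0 <= Y w <= 1) ->
  \int[P]_w (X w * Y w) <= (\int[P]_w X w) * (\int[P]_w Y w) + a.
Proof.
move=> G1m G2m alphaa mX mY X01 Y01.
have mX' : measurable_fun setT X by move=> _ B mB; apply/G1m/mX; exists B.
have mY' : measurable_fun setT Y by move=> _ B mB; apply/G2m/mY; exists B.
have ev B1 B2 : G1 B1 -> G2 B2 ->
    fine (P (B1 `&` B2)) <= fine (P B1) * fine (P B2) + a.
  move=> GB1 GB2.
  have mB1 := G1m _ GB1; have mB2 := G2m _ GB2.
  have : (`|P (B1 `&` B2) - P B1 * P B2| <= a%:E)%E.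
    apply: le_trans alphaa; apply: ereal_sup_ubound; exists B1 => //; exists B2 => //.
  rewrite -[P (B1 `&` B2)]fineK ?fin_num_measure//; last exact: measurableI.
  rewrite -[P B1]fineK ?fin_num_measure// -[P B2]fineK ?fin_num_measure//.
  rewrite -EFinM -EFinB abse_EFin lee_fin => /(le_trans (ler_norm _)) /=; lra.
(* Up to [1 / N], [X] and [Y] are averages of the indicators of the events
   [k / N <= X] and [k / N <= Y], which belong to [G1] and [G2]. *)
apply/ler_addgt0Pr => e e0.
(* The cost of discretizing both functions is 3/N: if p, q and 1/N lie in [0, 1], then (p + 1/N)(q +
   1/N) <= p q + 3/N. *)
have [N0 N0e] : exists N : nat, 3 * N.+1%:R^-1 < e.
  have [k] := ltr_add_invr (divr_gt0 e0 (ltr0Sn R 2)).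
  by rewrite add0r => ke; exists k; move: ke; rewrite ltr_pdivlMr// mulrC.
pose N := N0.+1.
have N0' : 0 < N%:R :> R by rewrite ltr0n.
pose lev (Z : T -> R) (k : nat) := [set w | k.+1%:R / N%:R <= Z w].
pose D (Z : T -> R) w := \sum_(k < N) N%:R^-1 * \1_(lev Z k) w : R.
have DE (Z : T -> R) w : D Z w = N%:R^-1 * level_count N (N%:R * Z w).
  rewrite /D -mulr_sumr /level_count; congr (_ * _); apply: eq_bigr => k _.
  rewrite indicE (_ : (w \in _) = (k.+1%:R / N%:R <= Z w)); last first.
    by apply/idP/idP; rewrite inE.
  by rewrite ler_pdivrMr// mulrC.
have DP (Z : T -> R) w : 0 <= Z w <= 1 -> D Z w <= Z w <= D Z w + N%:R^-1.
  move=> /andP[Z0 Z1]; rewrite DE.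
  have [_ /(_ _)/andP[]] := level_countP N (N%:R * Z w).
    by rewrite mulr_ge0 ?(ltW N0')//= ler_piMr// ltW.
  move=> H1 H2; apply/andP; split.
    by rewrite ler_pdivrMl.
  by rewrite -[X in _ + X]mulr1 -mulrDr ler_pdivlMl.
have mlev Z k : measurable_fun setT Z -> measurable (lev Z k).
  exact: measurable_level.
have ind01 (B : set T) w : 0 <= (\1_B w : R) <= 1.
  by rewrite indicE ler0n lern1 leq_b1.
have D01 (Z : T -> R) w : 0 <= Z w <= 1 -> 0 <= D Z w <= 1.
  move=> Z01; have /andP[H1 H2] := DP Z w Z01; case/andP: Z01 => Z0 Z1.
  rewrite (le_trans H1 Z1) andbT; apply: sumr_ge0 => k _.
  by apply: mulr_ge0; [rewrite invr_ge0|case/andP: (ind01 (lev Z k) w)].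
have mD (Z : T -> R) : measurable_fun setT Z -> measurable_fun setT (D Z).
  move=> mZ; apply: measurable_sum => k; apply: measurable_funM => //.
  by apply: measurable_indic; exact: mlev.
have nrm1 (z : R) : 0 <= z <= 1 -> `|z| <= 1.
  by move=> /andP[z0 z1]; rewrite ger0_norm.
have iD (Z : T -> R) : measurable_fun setT Z -> (forall w, 0 <= Z w <= 1) ->
    P.-integrable setT (EFin \o D Z).
  by move=> mZ Z01; apply: (@bounded_integrable _ _ _ _ _ 1) => [|w]; [exact: mD|exact/nrm1/D01].
have i1 (Z : T -> R) : measurable_fun setT Z -> (forall w, 0 <= Z w <= 1) ->
    P.-integrable setT (EFin \o Z).
  by move=> mZ Z01; apply: (@bounded_integrable _ _ _ _ _ 1) => // w; exact/nrm1/Z01.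
have iDD : P.-integrable setT (EFin \o (fun w => D X w * D Y w)).
  apply: (@bounded_integrable _ _ _ _ _ 1) => [|w].
    by apply: measurable_funM; exact: mD.
  by rewrite normrM mulr_ile1//; exact/nrm1/D01.
have DEint (Z : T -> R) : measurable_fun setT Z ->
    \int[P]_w D Z w = \sum_(k < N) N%:R^-1 * fine (P (lev Z k)).
  move=> mZ; rewrite /D Rintegral_sum.
    apply: eq_bigr => k _; rewrite RintegralZl//; last by apply/indic_integrable/mlev.
    by rewrite Rintegral_indic//; exact: mlev.
  by move=> k; apply: integrable_scale; apply/indic_integrable/mlev.
have DDint : \int[P]_w (D X w * D Y w) <= (\int[P]_w D X w) * (\int[P]_w D Y w) + a.
  have -> : \int[P]_w (D X w * D Y w) = \sum_(k < N) \sum_(j < N)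
      N%:R^-1 * N%:R^-1 * fine (P (lev X k `&` lev Y j)).
    have E w : D X w * D Y w = \sum_(k < N) \sum_(j < N)
        N%:R^-1 * N%:R^-1 * \1_(lev X k `&` lev Y j) w.
      rewrite /D big_distrlr/=; apply: eq_bigr => k _; apply: eq_bigr => j _.
      by rewrite !indicE in_setI -mulnb natrM; ring.
    under eq_Rintegral do rewrite E.
    have ikj k j : P.-integrable setT (EFin \o (fun w => N%:R^-1 * N%:R^-1 * \1_(lev X k `&` lev Y j) w : R)).
      apply: integrable_scale.
      by apply: indic_integrable; apply: measurableI; exact: mlev.
    rewrite Rintegral_sum; last first.
      move=> k; have := integrable_sum measurableT (index_enum 'I_N) (P := xpredT) (fun j _ => ikj k j).
      by apply: eq_integrable => // w _; rewrite /= sumEFin.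
    apply: eq_bigr => k _; rewrite Rintegral_sum//; apply: eq_bigr => j _.
    rewrite RintegralZl//; last first.
      by apply: indic_integrable; apply: measurableI; exact: mlev.
    by rewrite Rintegral_indic//; apply: measurableI; exact: mlev.
  rewrite !DEint// big_distrlr/=.
  (* The N^2 pairs of levels, each of weight N^-2, contribute a single [a] in total. *)
  have -> : a = \sum_(k < N) \sum_(j < N) N%:R^-1 * N%:R^-1 * a.
    have cc (c : R) : c != 0 -> a = c * (c * (c^-1 * c^-1 * a)) by move=> c0; field.
    rewrite !sumr_const !card_ord -(mulr_natl (N%:R^-1 * N%:R^-1 * a) N).
    by rewrite -(mulr_natl (_ * _) N); apply: cc; rewrite gt_eqF.
  rewrite -big_split/=; apply: ler_sum => k _; rewrite -big_split/=; apply: ler_sum => j _.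
  rewrite [X in _ <= X + _](_ : _ = N%:R^-1 * N%:R^-1 * (fine (P (lev X k)) * fine (P (lev Y j)))); last by ring.
  rewrite -mulrDr; apply: ler_wpM2l; first by rewrite mulr_ge0 ?invr_ge0 ?ler0n.
  by apply: ev; exact: measurable_wrt_level.
have leD (Z : T -> R) : measurable_fun setT Z -> (forall w, 0 <= Z w <= 1) ->
    0 <= \int[P]_w D Z w <= \int[P]_w Z w.
  move=> mZ Z01; apply/andP; split.
    by apply: Rintegral_ge0 => w _; case/andP: (D01 Z w (Z01 w)).
  apply: le_Rintegral => //; [exact: iD|exact: i1|].
  by move=> w _; case/andP: (DP Z w (Z01 w)).
have step : \int[P]_w (X w * Y w) <= \int[P]_w (D X w * D Y w + 3 * N%:R^-1).
  apply: le_Rintegral => //.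
  - apply: (@bounded_integrable _ _ _ _ _ 1) => [|w]; first exact: measurable_funM.
    by rewrite normrM mulr_ile1//; exact/nrm1.
  - have := integrableD measurableT iDD (finite_measure_integrable_cst P (3 * N%:R^-1) measurableT).
    by apply: eq_integrable.
  move=> w _; have /andP[x1 x2] := DP X w (X01 w); have /andP[y1 y2] := DP Y w (Y01 w).
  have /andP[dx0 dx1] := D01 X w (X01 w); have /andP[dy0 dy1] := D01 Y w (Y01 w).
  have n0 : (0 : R) <= N%:R^-1 by rewrite invr_ge0.
  have n1 : N%:R^-1 <= (1 : R) by rewrite -[leRHS]invr1 lef_pV2 ?posrE ?ler1n.
  have x0 : 0 <= X w by case/andP: (X01 w).
  have y0 : 0 <= Y w by case/andP: (Y01 w).
  have H : X w * Y w <= (D X w + N%:R^-1) * (D Y w + N%:R^-1) by rewrite ler_pM.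
  apply: (le_trans H); move: n0 n1 dx0 dx1 dy0 dy1.
  by move: (D X w) (D Y w) (N%:R^-1) => p q c *; nra.
have E : \int[P]_w (D X w * D Y w + 3 * N%:R^-1) = \int[P]_w (D X w * D Y w) + 3 * N%:R^-1.
  rewrite RintegralD//; first by congr (_ + _); exact: Rintegral_prob_cst.
  exact: (finite_measure_integrable_cst P _ measurableT).
rewrite {}E in step.
have /andP[a1 a2] := leD X mX' X01; have /andP[b1 b2] := leD Y mY' Y01.
have prod : (\int[P]_w D X w) * (\int[P]_w D Y w) <= (\int[P]_w X w) * (\int[P]_w Y w).
  by rewrite ler_pM.
rewrite (le_trans step)//; move: DDint prod N0e; rewrite -/N.
by move: (3 * _) (\int[P]_w (D X w * D Y w)) (_ * (\int[P]_w D Y w)) => *; lra.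
Qed.

Lemma covariance_alpha (G1 G2 : set (set T)) (a u v : R) (X Y : T -> R) :
  G1 `<=` measurable -> G2 `<=` measurable -> 0 < u -> 0 < v ->
  (alpha_coef P G1 G2 <= a%:E)%E ->
  measurable_wrt G1 X -> measurable_wrt G2 Y ->
  (forall w, 0 <= X w <= u) -> (forall w, 0 <= Y w <= v) ->
  \int[P]_w (X w * Y w) <= (\int[P]_w X w) * (\int[P]_w Y w) + a * (u * v).
Proof.
move=> G1m G2m u0 v0 alphaa mX mY Xu Yv.
have mX' : measurable_fun setT X by move=> _ B mB; apply/G1m/mX; exists B.
have mY' : measurable_fun setT Y by move=> _ B mB; apply/G2m/mY; exists B.
have sc (G : set (set T)) (c : R) (Z : T -> R) : measurable_wrt G Z -> measurable_wrt G (fun w => c * Z w).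
  move=> mZ _ [B mB <-]; apply: mZ; exists ((fun z => c * z) @^-1` B) => //.
  have mc : measurable_fun setT (fun z : R => c * z) by exact: measurable_funM.
  by rewrite -[_ @^-1` _]setTI; exact: mc.
have iX : P.-integrable setT (EFin \o X).
  apply: (@bounded_integrable _ _ _ _ _ u) => // w.
  by case/andP: (Xu w) => x0 xu; rewrite ger0_norm.
have iY : P.-integrable setT (EFin \o Y).
  apply: (@bounded_integrable _ _ _ _ _ v) => // w.
  by case/andP: (Yv w) => x0 xu; rewrite ger0_norm.
have iXY : P.-integrable setT (EFin \o (fun w => X w * Y w)).
  apply: (@bounded_integrable _ _ _ _ _ (u * v)); first exact: measurable_funM.
  move=> w; case/andP: (Xu w) => x0 xu; case/andP: (Yv w) => y0 yv.
  by rewrite ger0_norm ?mulr_ge0// ler_pM.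
have H : \int[P]_w (u^-1 * X w * (v^-1 * Y w)) <=
    (\int[P]_w (u^-1 * X w)) * (\int[P]_w (v^-1 * Y w)) + a.
  apply: (covariance_alpha01 G1m G2m alphaa (sc _ _ _ mX) (sc _ _ _ mY)) => w.
  - by case/andP: (Xu w) => x0 xu; rewrite mulr_ge0 ?invr_ge0 ?(ltW u0)//= ler_pdivrMl// mulr1.
  - by case/andP: (Yv w) => x0 xu; rewrite mulr_ge0 ?invr_ge0 ?(ltW v0)//= ler_pdivrMl// mulr1.
move: H; under eq_Rintegral do rewrite mulrACA.
rewrite !RintegralZl// => H.
rewrite -(@ler_pM2l _ (u^-1 * v^-1)) ?mulr_gt0 ?invr_gt0//.
apply: (le_trans H); rewrite le_eqVlt; apply/orP; left; apply/eqP; field.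
by rewrite !gt_eqF.
Qed.

End mixing.

Section field_mixing.
Context {R : realType} {d : nat} {dT} {T : measurableType dT}.
Variables (P : probability T R) (A : 'rV[R]_d -> T -> R).
Hypothesis mA : jointly_measurable A.

Lemma measurable_field (x : 'rV[R]_d) : measurable_fun setT (A x).
Proof. exact: (measurableT_comp mA (pair1_measurable x)). Qed.

Lemma sigma_gen_measurable (S : set 'rV[R]_d) : sigma_gen A S `<=` measurable.
Proof.
apply: smallest_sub; first exact: sigma_algebra_measurable.
by move=> _ [x _ [B mB <-]]; exact: measurable_field.
Qed.

Lemma sigma_gen_fun (S : set 'rV[R]_d) dV (V : measurableType dV) (X : T -> V) :
  measurable_wrt (sigma_gen A S) X -> measurable_fun setT X.
Proof. by move=> mX _ B mB; apply: (@sigma_gen_measurable S); apply: mX; exists B. Qed.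

Lemma measurable_eball (x : 'rV[R]_d) l : measurable (eball x l).
Proof.
rewrite (_ : eball x l = setT `&` (fun y => enorm (y - x)) @^-1` `]-oo, l[%classic).
  apply: (measurableT_comp (@measurable_enorm R d)) => //.
  exact: measurable_rV_addr.
by rewrite setTI; apply/seteqP; split=> y; rewrite /eball/= in_itv.
Qed.

Lemma alpha_coef_tilde (r D a : R) (S1 S2 : set 'rV[R]_d) :
  measurable S1 -> measurable S2 -> (tilde_alpha P A r D <= a%:E)%E ->
  (forall x y, S1 x -> S2 y -> r <= enorm (x - y)) ->
  (forall x y, S1 x -> S1 y -> enorm (x - y) <= D) ->
  (forall x y, S2 x -> S2 y -> enorm (x - y) <= D) ->
  (alpha_coef P (sigma_gen A S1) (sigma_gen A S2) <= a%:E)%E.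
Proof.
move=> mS1 mS2 ta S12 D1 D2; apply: le_trans ta; apply: ereal_sup_ubound.
exists (S1, S2) => //=; split => //=.
- by apply: le_ereal_inf_tmp => _ [x Sx [y Sy <-]]; rewrite lee_fin S12.
- by apply: ge_ereal_sup => _ [x Sx [y Sy <-]]; rewrite lee_fin D1.
- by apply: ge_ereal_sup => _ [x Sx [y Sy <-]]; rewrite lee_fin D2.
Qed.

Lemma measurable_wrt_prod (S : set 'rV[R]_d) (I : eqType) (s : seq I) (U : I -> T -> R) :
  (forall i, i \in s -> measurable_wrt (sigma_gen A S) (U i)) ->
  measurable_wrt (sigma_gen A S) (fun w => \prod_(i <- s) U i w).
Proof.
move=> mU; apply/measurable_wrt_sigmaP; apply: measurable_prod => i si.
by apply/measurable_wrt_sigmaP; exact: mU.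
Qed.

(** Factors are split off one at a time. The remaining product depends on A in the union of the
    other balls, at distance at least r from the ball removed, so [covariance_alpha] costs [a] times
    the product of the bounds still present; the error of the remaining product is multiplied by a
    mean that is at most [b i]. Hence one error term per factor. *)
Lemma expectation_prod_mixing (I : eqType) (s : seq I) (x : I -> 'rV[R]_d)
    (U : I -> T -> R) (b : I -> R) (l r D a : R) :
  uniq s ->
  (forall i, measurable_wrt (sigma_gen A (eball (x i) l)) (U i)) ->
  (forall i w, 0 <= U i w <= b i) -> (forall i, 0 < b i) ->
  (forall i j, i != j -> r + 2 * l <= enorm (x i - x j)) ->
  (forall i j, enorm (x i - x j) <= D) ->
  0 <= a -> (tilde_alpha P A r (D + 2 * l) <= a%:E)%E ->
  \int[P]_w (\prod_(i <- s) U i w) <=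
  \prod_(i <- s) \int[P]_w U i w + (size s)%:R * a * \prod_(i <- s) b i.
Proof.
move=> us mU Ub b0 sep dia a0 ta; elim: s us => [_|i s IH /= /andP[is_ us]].
  under eq_Rintegral do rewrite big_nil.
  by rewrite !big_nil /= !mul0r addr0 Rintegral_prob_cst.
pose S2 := \bigcup_(j in [set` s]) eball (x j) l.
have mU' j : measurable_fun setT (U j) by exact: sigma_gen_fun (mU j).
have Eb j : 0 <= \int[P]_w U j w <= b j by apply: Rintegral_bounds.
have bp : 0 < \prod_(j <- s) b j by apply: prodr_gt0 => j _.
have Vb w : 0 <= \prod_(j <- s) U j w <= \prod_(j <- s) b j.
  apply/andP; split; first by apply: prodr_ge0 => j _; case/andP: (Ub j w).
  exact: ler_prod.
have ball2 u u' v v' : eball (x u) l v -> eball (x u') l v' ->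
    enorm (x u - x u') - 2 * l <= enorm (v - v') <= enorm (x u - x u') + 2 * l.
  rewrite /eball/= => h1 h2; rewrite (enorm_distC v) in h1.
  have t1 := enorm_triangle v (x u) (x u'); have t2 := enorm_triangle v' v (x u').
  have t3 := enorm_triangle (x u) v v'; have t4 := enorm_triangle (x u') (x u) v'.
  rewrite (enorm_distC v (x u)) in t3; rewrite (enorm_distC (x u') v') in t4.
  by apply/andP; split; lra.
have alpha : (alpha_coef P (sigma_gen A (eball (x i) l)) (sigma_gen A S2) <= a%:E)%E.
  apply: (alpha_coef_tilde _ _ ta).
  - exact: measurable_eball.
  - apply: fin_bigcup_measurable => [|j _]; last exact: measurable_eball.
    exact: finite_seq.
  - move=> u v xu [j /= sj xv]; have /andP[+ _] := ball2 _ _ _ _ xu xv.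
    apply: le_trans; rewrite lerBrDr sep//.
    by apply: contraNneq is_ => ->.
  - move=> u v xu xv; have /andP[_] := ball2 _ _ _ _ xu xv => /le_trans; apply.
    by rewrite lerD2r dia.
  - move=> u v [j /= sj xu] [k /= sk xv]; have /andP[_] := ball2 _ _ _ _ xu xv => /le_trans; apply.
    by rewrite lerD2r dia.
have mV : measurable_wrt (sigma_gen A S2) (fun w => \prod_(j <- s) U j w).
  apply: measurable_wrt_prod => j sj; apply: measurable_wrt_sub (mU j).
  by apply: sigma_gen_sub => y xy; exists j.
under eq_Rintegral do rewrite big_cons.
rewrite !big_cons.
have cov := covariance_alpha (@sigma_gen_measurable _) (@sigma_gen_measurable _) (b0 i) bp alpha (mU i) mV (Ub i) Vb.
apply: (le_trans cov).
have /andP[E0 E1] := Eb i.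
apply: (@le_trans _ _ (\int[P]_w U i w *
    (\prod_(j <- s) \int[P]_w U j w + (size s)%:R * a * \prod_(j <- s) b j) +
    a * (b i * \prod_(j <- s) b j))).
  by rewrite lerD2r ler_wpM2l// IH.
rewrite mulrDr -addrA lerD2l -natr1.
have c0 : 0 <= (size s)%:R * a * \prod_(j <- s) b j by rewrite !mulr_ge0// ltW.
have := ler_wpM2r c0 E1; lra.
Qed.

End field_mixing.

Section exponential_moment.
Context {R : realType} {dT} {T : measurableType dT} (P : probability T R).

Lemma expR_le_quadratic (x : R) : x <= 1 -> expR x <= 1 + x + 2 * x ^+ 2.
Proof.
move=> x1; have h : 0 < 1 - x / 2 by lra.
have e1 : expR (x / 2) <= (1 - x / 2)^-1.
  rewrite -[x / 2]opprK expRN lef_pV2 ?posrE ?expR_gt0 ?opprK//.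
  by have := expR_ge1Dx (- (x / 2)).
rewrite {1}(splitr x) expRD (@le_trans _ _ ((1 - x / 2)^-1 * (1 - x / 2)^-1))//.
  by rewrite ler_pM ?expR_ge0.
rewrite -invfM -[leLHS]mul1r ler_pdivrMr ?mulr_gt0//.
(* (1 + x + 2 x^2) (1 - x/2)^2 - 1 = x^2 (1 - x) (5 - 2 x) / 4. *)
have : 0 <= x ^+ 2 * ((1 - x) * (5 - 2 * x)).
  by rewrite mulr_ge0 ?sqr_ge0// mulr_ge0; lra.
nra.
Qed.

(** In the integrated quadratic bound the linear term vanishes by centering, and 1 + y <= expR y
    concludes. *)
Lemma exponential_moment (X : T -> R) (K t : R) : measurable_fun setT X ->
  (forall w, `|X w| <= K) -> \int[P]_w X w = 0 -> 0 <= t -> t * K <= 1 ->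
  \int[P]_w expR (t * X w) <= expR (2 * (t * K) ^+ 2).
Proof.
move=> mX XK X0 t0 tK.
have iX : P.-integrable setT (EFin \o X) by exact: bounded_integrable XK.
have cst_int (c : R) : P.-integrable setT (EFin \o (fun=> c)).
  exact: (finite_measure_integrable_cst P _ measurableT).
have iE : P.-integrable setT (EFin \o (fun w => expR (t * X w))).
  apply: (@bounded_integrable _ _ _ _ _ (expR (t * K))).
    by apply: measurableT_comp => //; exact: measurable_funM.
  move=> w; rewrite ger0_norm ?expR_ge0// ler_expR ler_wpM2l//.
  exact: le_trans (ler_norm _) (XK w).
have iQ : P.-integrable setT (EFin \o (fun w => t * X w + (1 + 2 * (t * K) ^+ 2))).
  have := integrableD measurableT (integrable_scale t iX) (cst_int (1 + 2 * (t * K) ^+ 2)).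
  by apply: eq_integrable.
apply: (@le_trans _ _ (\int[P]_w (t * X w + (1 + 2 * (t * K) ^+ 2)))).
  apply: le_Rintegral => // w _.
  have tX : `|t * X w| <= t * K by rewrite normrM ger0_norm// ler_wpM2l.
  have H : t * X w <= 1 by rewrite (le_trans (ler_norm _))// (le_trans tX).
  apply: (le_trans (expR_le_quadratic H)).
  have sq : (t * X w) ^+ 2 <= (t * K) ^+ 2.
    by rewrite -real_normK ?num_real// ler_pXn2r ?nnegrE ?normr_ge0// (le_trans _ tX).
  lra.
rewrite RintegralD//; last exact: integrable_scale.
rewrite RintegralZl// X0 mulr0 add0r.
by rewrite [leLHS](_ : _ = 1 + 2 * (t * K) ^+ 2) ?expR_ge1Dx//; exact: Rintegral_prob_cst.
Qed.

End exponential_moment.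

(** * Paths and stationarity *)

Section doob_dynkin.
Context {R : realType} {U W : pointedType} (phi : U -> W) (G : set (set W)).

Let WG := g_sigma_algebraType G.

Lemma measurable_fun_two_values (E : set W) (c1 c2 : \bar R) : <<s G >> E ->
  measurable_fun (setT : set WG) (fun a : WG => if a \in E then c1 else c2).
Proof.
move=> GE _ Y mY; rewrite setTI.
rewrite (_ : _ @^-1` Y = (if c1 \in Y then E else set0) `|` (if c2 \in Y then ~` E else set0)).
  have mE : measurable (E : set WG) by [].
  apply: measurableU; case: ifPn => // _; exact: measurableC.
apply/seteqP; split=> [a|a [|]]; rewrite /preimage/=.
- have [aE|aE] := pselect (E a).
    by rewrite (mem_set aE) => /mem_set ->; left.
  by rewrite (memNset aE) => /mem_set ->; right.
- by case: ifPn => // /set_mem c1Y aE; rewrite (mem_set aE).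
- by case: ifPn => // /set_mem c2Y aE; rewrite (memNset aE).
Qed.

(** For each rational q the event q < X is the preimage of some [E q], and g a is the supremum of
    the q with a in [E q]. This supremum may be infinite off the range of [phi], hence [fine]. *)
Lemma doob_dynkin (X : U -> R) :
  measurable_wrt (preimage_set_system setT phi <<s G >>) X ->
  exists g : W -> R, measurable_wrt <<s G >> g /\ forall w, X w = g (phi w).
Proof.
move=> mX.
have HE (q : rat) : exists E : set W, <<s G >> E /\ phi @^-1` E = [set w | ratr q < X w].
  have : preimage_set_system setT phi <<s G >> [set w | ratr q < X w].
    apply: mX; exists `]ratr q, +oo[%classic => //.
    by rewrite setTI; apply/seteqP; split=> w; rewrite /= in_itv/= andbT.
  by case=> E GE; rewrite setTI => <-; exists E.
have [E EP] := choice HE.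
pose h (n : nat) (a : WG) : \bar R :=
  if unpickle n is Some q then (if a \in E q then (ratr q)%:E else -oo%E) else -oo%E.
have mh n : measurable_fun setT (h n).
  rewrite /h; case: unpickle => [q|]; last exact: measurable_cst.
  by apply: measurable_fun_two_values; case: (EP q).
have mg := measurable_fun_esups mh 0.
exists (fun a => fine (esups (h^~ a) 0)); split.
  apply/measurable_wrt_sigmaP; exact: (measurableT_comp (fine_measurable measurableT) mg).
move=> w; rewrite (_ : esups _ _ = (X w)%:E)//; apply/eqP; rewrite eq_le; apply/andP; split.
- apply: ge_ereal_sup => _ [n _ <-]; rewrite /h; case: unpickle => [q|]; last exact: leNye.
  have [Eq|Eq] := pselect (E q (phi w)); last by rewrite (memNset Eq) leNye.
  rewrite (mem_set Eq) lee_fin; have [_ /seteqP[H _]] := EP q.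
  exact/ltW/(H w).
- apply/lee_addgt0Pr => e e0.
  have : X w - e < X w by lra.
  move=> /rat_in_itvoo[q]; rewrite in_itv/= => /andP[q1 q2].
  apply: (@le_trans _ _ ((ratr q)%:E + e%:E)%E); first by rewrite -EFinD lee_fin; lra.
  rewrite leeD2r//; apply: ereal_sup_ubound; exists (pickle q) => //.
  rewrite /h pickleK ifT//; apply/mem_set; have [_ /seteqP[_ H]] := EP q.
  exact: (H w).
Qed.

End doob_dynkin.

Section path_space.
Context {R : realType} {d : nat} {dT} {T : measurableType dT}.
Variables (P : probability T R) (A : 'rV[R]_d -> T -> R).
Hypothesis mA : jointly_measurable A.

Let W := ('rV[R]_d -> R : pointedType).

Definition coord_ev (x : 'rV[R]_d) (a : 'rV[R]_d -> R) : R := a x.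

(** [local_field A f x w] is convertible to [f (shift_path A x w)], so the law of F(x) is read off
    that of the shifted path. *)
Definition shift_path (x : 'rV[R]_d) (w : T) : 'rV[R]_d -> R := fun y => A (y + x) w.

Lemma shift_path_preimage (x : 'rV[R]_d) (S S' : set 'rV[R]_d) (E : set W) :
  (forall y, S y -> S' (y + x)) -> sigma_gen coord_ev S E ->
  sigma_gen A S' (shift_path x @^-1` E).
Proof.
move=> SS'; suff : sigma_gen coord_ev S `<=`
    image_set_system setT (shift_path x) (sigma_gen A S').
  by move=> H /H; rewrite /image_set_system/= setTI.
apply: smallest_sub; first exact/sigma_algebra_image/smallest_sigma_algebra.
move=> _ [y Sy [B mB <-]]; rewrite /image_set_system/= !setTI.
apply: sub_sigma_algebra; exists (y + x); first exact: SS'.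
by exists B => //; rewrite setTI.
Qed.

Lemma sigma_gen_path (S : set 'rV[R]_d) :
  sigma_gen A S `<=` preimage_set_system setT (shift_path 0) (sigma_gen coord_ev S).
Proof.
apply: smallest_sub; first exact/sigma_algebra_preimage/smallest_sigma_algebra.
move=> _ [y Sy [B mB <-]]; exists ((coord_ev y) @^-1` B).
  by apply: sub_sigma_algebra; exists y => //; exists B => //; rewrite setTI.
by rewrite !setTI; apply/seteqP; split=> w; rewrite /preimage /shift_path /coord_ev/= addr0.
Qed.

Let G := \bigcup_(x in [set: 'rV[R]_d]) preimage_set_system [set: W] (coord_ev x) measurable.
Let WG := g_sigma_algebraType G.

Let mshift x : measurable_fun setT (shift_path x : T -> WG).
Proof.
move=> _ E mE; rewrite setTI; apply: (sigma_gen_measurable mA (S := setT)).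
exact: (@shift_path_preimage x setT).
Qed.

Let cylinders : set (set WG) :=
  [set C | exists n (x : 'I_n -> 'rV[R]_d) (B : 'I_n -> set R),
    (forall i, measurable (B i)) /\ C = [set a | forall i, B i (a (x i))]].

Let sigma_cylinders : (measurable : set (set WG)) = <<s cylinders >>.
Proof.
apply/seteqP; split.
- apply: smallest_sub; first exact: smallest_sigma_algebra.
  move=> _ [x _ [B mB <-]]; rewrite setTI; apply: sub_sigma_algebra.
  exists 1%N, (fun=> x), (fun=> B); split => //.
  by apply/seteqP; split=> a; rewrite /preimage/= => aB; [move=> _|exact: (aB ord0)].
- apply: smallest_sub; first exact: sigma_algebra_measurable.
  move=> _ [n [x [B [mB ->]]]].
  rewrite (_ : [set _ | _] = \bigcap_(i in [set: 'I_n]) (coord_ev (x i) @^-1` B i)); last first.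
    by apply/seteqP; split=> a H i => [_|]; exact: H.
  apply: fin_bigcap_measurable; first exact: finite_finset.
  move=> i _; apply: sub_sigma_algebra; exists (x i) => //.
  by exists (B i) => //; rewrite setTI.
Qed.

Let cylindersI : setI_closed cylinders.
Proof.
move=> _ _ [n1 [x1 [B1 [mB1 ->]]]] [n2 [x2 [B2 [mB2 ->]]]].
exists (n1 + n2)%N, (fun i => match fintype.split i with inl j => x1 j | inr j => x2 j end),
  (fun i => match fintype.split i with inl j => B1 j | inr j => B2 j end); split.
  by move=> i; case: fintype.split.
apply/seteqP; split=> [a [H1 H2] i|a H]; first by case: fintype.split.
split=> i.
- by have := H (lshift n2 i); case: (split_ordP (lshift n2 i)) => j; [move=> /lshift_inj <-|move/eqP; rewrite eq_lrshift].
- by have := H (rshift n1 i); case: (split_ordP (rshift n1 i)) => j; [move/eqP; rewrite eq_rlshift|move=> /rshift_inj <-].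
Qed.

Hypothesis sA : stationary P A.

(** Stationarity concerns finitely many points at a time. The two laws on path space thus agree on
    cylinders, which are stable under intersection and generate the sigma-algebra. *)
Lemma law_shift (x : 'rV[R]_d) (E : set W) : sigma_gen coord_ev setT E ->
  P (shift_path x @^-1` E) = P (shift_path 0 @^-1` E).
Proof.
move=> mE.
pose m1 := measure_function_pushforward__canonical__measure_function_Measure P (mshift x).
pose m2 := measure_function_pushforward__canonical__measure_function_Measure P (mshift 0).
apply: (@measure_unique _ R WG cylinders (fun=> setT) sigma_cylinders cylindersI _ _ m1 m2) => //.
- move=> _; exists 0%N, (fun=> 0), (fun=> setT); split => //.
  by apply/seteqP; split=> // a _ [].
- by apply/seteqP; split=> // a _; exists 0%N.
- move=> _ [n [y [B [mB ->]]]].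
  pose B' := [set t : n.-tuple R | forall i, B i (tnth t i)].
  have mB' : measurable B'.
    rewrite (_ : B' = \bigcap_(i in [set: 'I_n]) ((fun t => tnth t i) @^-1` B i)); last first.
      by apply/seteqP; split=> t H i => [_|]; exact: H.
    apply: fin_bigcap_measurable; first exact: finite_finset.
    by move=> i _; rewrite -[_ @^-1` _]setTI; apply: measurable_tnth.
  have H (z : 'rV[R]_d) : shift_path z @^-1` [set a | forall i, B i (a (y i))] =
      [set w | B' [tuple A (y i + z) w | i < n]].
    by apply/seteqP; split=> w; rewrite /preimage /shift_path /B'/= => H i;
      have := H i; rewrite tnth_mktuple.
  rewrite /m1 /m2 /= /pushforward !H (sA x y mB') -(sA 0 y mB').
  by [].
- move=> _; rewrite /m1/= /pushforward preimage_setT probability_setT; exact: ltry.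
Qed.

Lemma integral_shift_path (x : 'rV[R]_d) (g : W -> \bar R) :
  measurable_wrt (sigma_gen coord_ev setT) g ->
  (\int[P]_w g (shift_path x w) = \int[P]_w g (shift_path 0 w))%E.
Proof.
move=> /measurable_wrt_sigmaP mg.
pose m z := measure_function_pushforward__canonical__measure_function_Measure P (mshift z).
have H (z : 'rV[R]_d) (k : WG -> \bar R) : measurable_fun setT k -> (forall a, 0 <= k a)%E ->
    (\int[P]_w k (shift_path z w) = \int[m z]_a k a)%E.
  by move=> mk k0; rewrite (ge0_integral_pushforward (mshift z)).
have Hm (k : WG -> \bar R) : (\int[m x]_a k a = \int[m 0%R]_a k a)%E.
  by apply: eq_measure_integral => E mE _; exact: law_shift.
have pos := measurable_funepos mg; have neg := measurable_funeneg mg.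
have Hk (k : WG -> \bar R) : measurable_fun setT k -> (forall a, 0 <= k a)%E ->
    (\int[P]_w k (shift_path x w) = \int[P]_w k (shift_path 0%R w))%E.
  by move=> mk k0; rewrite !H// Hm.
rewrite integralE [RHS]integralE; congr (_ - _)%E.
- apply: etrans (etrans _ (Hk _ pos (fun a => funepos_ge0 _ a))) _;
    by apply: eq_integral => w _; rewrite !funeposE.
- apply: etrans (etrans _ (Hk _ neg (fun a => funeneg_ge0 _ a))) _;
    by apply: eq_integral => w _; rewrite !funenegE.
Qed.

(** The exceptional set is the preimage of an event of the cylinder sigma-algebra, and its
    probability does not depend on the shift. *)
Lemma ae_shift_path (x : 'rV[R]_d) (h : W -> R) (c : R) :
  measurable_wrt (sigma_gen coord_ev setT) h ->
  {ae P, forall w, h (shift_path 0 w) <= c} ->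
  {ae P, forall w, h (shift_path x w) <= c}.
Proof.
move=> mh.
have mN : sigma_gen coord_ev setT [set a | c < h a].
  apply: mh; exists `]c, +oo[%classic => //.
  by rewrite setTI; apply/seteqP; split=> a; rewrite /= in_itv/= andbT.
have E (z : 'rV[R]_d) : ~` [set w | h (shift_path z w) <= c] = shift_path z @^-1` [set a | c < h a].
  by apply/seteqP; split=> w; rewrite /preimage/= ltNge => /negP.
have mz z : measurable (shift_path z @^-1` [set a | c < h a]).
  by rewrite -[_ @^-1` _]setTI; apply: mshift.
rewrite /almost_everywhere/= /prop_near1 /nbhs/= /almost_everywhere !E.
move=> /(negligibleP P (mz 0)) H; apply/(negligibleP P (mz x)).
exact: etrans (law_shift x mN) H.
Qed.

End path_space.

(** * From the multiscale covariance inequality to mixing *)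

Section monotone_integral.
Context {dT} {T : measurableType dT} {R : realType}.
Local Open Scope ereal_scope.

(* Unlike [ge0_le_integral], no measurability is needed: the integral of a
   nonnegative function is a supremum over the simple functions below it. *)
Lemma ge0_le_integral_nonmeas (mu : {measure set T -> \bar R}) (D : set T)
    (f g : T -> \bar R) : (forall x, D x -> 0 <= f x) ->
  (forall x, D x -> f x <= g x) ->
  \int[mu]_(x in D) f x <= \int[mu]_(x in D) g x.
Proof.
move=> f0 fg; have g0 x : D x -> 0 <= g x by move=> Dx; exact: le_trans (f0 x Dx) (fg x Dx).
rewrite !ge0_integralE//; apply: le_ereal_sup => _ [h /= hf <-]; exists h => //= x.
apply: le_trans (hf x) _; rewrite !patchE; case: ifPn => // /set_mem; exact: fg.
Qed.

End monotone_integral.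

Lemma ae_and {R : realType} {dT} {T : measurableType dT} (mu : {measure set T -> \bar R})
    (Q1 Q2 : T -> Prop) :
  {ae mu, forall w, Q1 w} -> {ae mu, forall w, Q2 w} -> {ae mu, forall w, Q1 w /\ Q2 w}.
Proof. by move=> H1 H2; apply: filterS2 H1 H2 => w. Qed.

(** * Conditional essential suprema of indicators *)

Section cond_ess_sup_theory.
Context {R : realType} {dT} {T : measurableType dT} (P : probability T R).
Variable G : set (set T).
Hypotheses (sG : sigma_algebra setT G) (Gm : G `<=` measurable).
Local Open Scope ereal_scope.

Lemma measurable_wrt_fun d1 (V1 : measurableType d1) (X : T -> V1) :
  measurable_wrt G X -> measurable_fun setT X.
Proof. by move=> mX _ B mB; apply: Gm; apply: mX; exists B. Qed.

Lemma measurable_wrt_cst d1 (V1 : measurableType d1) (c : V1) :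
  measurable_wrt G (cst c : T -> V1).
Proof.
case: sG => G0 GC _; have GT : G setT by rewrite -(setD0 setT); exact: GC.
move=> _ [B mB <-]; rewrite setTI preimage_cst; case: ifPn => // _.
Qed.

Lemma measurable_wrt_indic (B : set T) : G B -> measurable_wrt G (fun w => (\1_B w : R)).
Proof.
move=> GB; case: (sG) => G0 GC _.
have GT : G setT by rewrite -(setD0 setT); exact: GC.
have GcB : G (~` B) by rewrite -setTD; exact: GC.
move=> _ [Y mY <-]; rewrite setTI preimage_indic.
by case: ifPn => _; case: ifPn => _.
Qed.

Lemma cond_ess_supP (X : T -> R) (Z : T -> \bar R) : is_cond_ess_sup P G X Z ->
  is_cond_ess_sup P G X (cond_ess_sup P G X).
Proof. by move=> H; rewrite /cond_ess_sup; case: xgetP => [Y _ //|/(_ Z)]. Qed.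

(** Versions are constructed for indicators only; the opposite of the indicator of B is that of the
    complement minus 1. *)
Lemma is_cond_ess_supD (X : T -> R) (Z : T -> \bar R) (c : R) :
  is_cond_ess_sup P G X Z ->
  is_cond_ess_sup P G (fun w => X w + c)%R (fun w => Z w + c%:E).
Proof.
move=> [mZ XZ minZ]; split.
- apply: (@measurable_wrt_comp _ _ _ _ _ _ (fun z => z + c%:E)) => //.
  exact: emeasurable_funD.
- by apply: filterS XZ => w XZ; rewrite EFinD leeD2r.
- move=> Z' mZ' XZ'; apply: filterS (minZ (fun w => Z' w - c%:E) _ _).
  + by move=> w; rewrite leeBrDr.
  + apply: (@measurable_wrt_comp _ _ _ _ _ _ (fun z => z - c%:E)) => //.
    exact: emeasurable_funB.
  + by apply: filterS XZ' => w; rewrite leeBrDr// EFinD.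
Qed.

Lemma is_cond_ess_sup_id (X : T -> R) : measurable_wrt G X ->
  is_cond_ess_sup P G X (EFin \o X).
Proof.
move=> mX; split => //; first exact: measurable_wrt_comp.
by apply: aeW => w; exact: lexx.
Qed.

Lemma cond_ess_sup_indic (B : set T) : measurable B ->
  exists Z, is_cond_ess_sup P G (fun w => (\1_B w : R)) Z.
Proof.
move=> mB; case: (sG) => G0 GC GU.
have GcC E : G E -> G (~` E) by rewrite -setTD; exact: GC.
have GT : G setT by rewrite -(setD0 setT); exact: GC.
have GI (F : (set T)^nat) : (forall n, G (F n)) -> G (\bigcap_n F n).
  move=> GF; rewrite -[X in G X]setCK setC_bigcap; apply/GcC/GU => n.
  exact: GcC.
have GI2 E F : G E -> G F -> G (E `&` F).
  by move=> GE GF; rewrite -bigcap2E; apply: GI => -[|[|?]] //=.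
(* The version is the indicator of an event of least probability among those
   of [G] that contain [B] up to a null set. *)
pose cand := [set E | G E /\ P.-negligible (B `\` E)].
pose m := ereal_inf [set P E | E in cand].
have m0 : 0 <= m by apply: le_ereal_inf_tmp => _ [E _ <-]; exact: measure_ge0.
have mfin : m \is a fin_num.
  rewrite ge0_fin_numE//; apply: (@le_lt_trans _ _ (P setT)); last by rewrite probability_setT ltry.
  apply: ereal_inf_lbound; exists setT => //; split => //.
  by rewrite setDT; exact: negligible_set0.
have HE (n : nat) : exists E, cand E /\ P E < m + (n.+1%:R^-1)%:E.
  have n0 : (0 < n.+1%:R^-1 :> R)%R by rewrite invr_gt0.
  have [_ [E cE <-] PE] := lb_ereal_inf_adherent n0 mfin.
  by exists E.
have [En EnP] := choice HE.
pose E := \bigcap_n En n.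
have GE : G E by apply: GI => n; case: (EnP n) => -[].
have BE : P.-negligible (B `\` E).
  rewrite /E setDE setC_bigcap setI_bigcupr; apply: negligible_bigcup => n.
  by rewrite -setDE; case: (EnP n) => -[].
have PEm : P E <= m.
  apply/lee_addgt0Pr => e e0.
  have [k ke] : exists k : nat, (k.+1%:R^-1 < e)%R.
    by have [k] := ltr_add_invr e0; rewrite add0r; exists k.
  apply: (@le_trans _ _ (P (En k))).
    apply: le_measure; rewrite ?inE; [exact: Gm|apply: Gm; by case: (EnP k) => -[]|].
    exact: bigcap_inf.
  have [_ /ltW/le_trans] := EnP k; apply; rewrite leeD2l// lee_fin; exact: ltW.
exists (fun w => (\1_E w)%:E); split.
- apply: (@measurable_wrt_comp _ _ _ _ _ _ EFin (fun w => \1_E w : R)) => //.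
  exact: measurable_wrt_indic.
- apply: negligibleS BE => w /= /negP; rewrite -ltNge lte_fin !indicE.
  by case: (boolP (w \in B)); case: (boolP (w \in E)); rewrite ?ltxx ?ltr01 ?ltr10// => /negP wE wB _; split; [exact: set_mem|move=> /mem_set].
- move=> Z' mZ' BZ'.
  (* The intersection of E and F contains B up to a null set, so by minimality of the probability of
     E the part of E outside F is null. Off E it is enough that Z' dominates the indicator, which is
     nonnegative. *)
  pose F := [set w | 1 <= Z' w]; pose H := [set w | 0 <= Z' w].
  have GF : G F.
    apply: mZ'; exists `[1, +oo[%classic; first exact: emeasurable_itv.
    rewrite setTI; apply/seteqP; split=> w; rewrite /F/= in_itv/= andbT//.
  have BF : P.-negligible (B `\` F).
    apply: negligibleS BZ' => w [Bw Fw] /=; rewrite indicE mem_set//.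
  have EF : P (E `\` F) = 0.
    have GEF := GI2 _ _ GE GF.
    have cEF : cand (E `&` F).
      split => //; rewrite setDIr; exact: negligibleU.
    have mle : m <= P (E `&` F) by apply: ereal_inf_lbound; exists (E `&` F).
    rewrite measureD; [|exact: Gm|exact: Gm|]; last first.
      by rewrite -ge0_fin_numE ?fin_num_measure//; exact: Gm.
    apply/eqP; rewrite eq_le; apply/andP; split.
      by rewrite sube_le0 (le_trans PEm).
    rewrite sube_ge0; last by rewrite fin_num_measure//; exact: Gm.
    apply: le_measure; rewrite ?inE; [exact: Gm|exact: Gm|exact: subIsetl].
  have nEF : P.-negligible (E `\` F).
    have mEF : measurable (E `\` F) by apply: measurableD; exact: Gm.
    exact/(negligibleP P mEF).
  have := negligibleU nEF BZ'.
  apply: negligibleS => w /= /negP Zw.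
  have [Ew|Ew] := pselect (E w).
    have [Fw|Fw] := pselect (F w); last by left.
    by exfalso; move/negP: Zw; apply; rewrite indicE mem_set.
  right=> Bw; move/negP: Zw; apply; rewrite indicE memNset//=; apply: le_trans Bw.
  by rewrite lee_fin indicE.
Qed.

End cond_ess_sup_theory.

(** * Oscillation of indicators *)

Section oscillation.
Context {R : realType} {d : nat} {dT} {T : measurableType dT}.
Variables (P : probability T R) (A : 'rV[R]_d -> T -> R).
Hypothesis mA : jointly_measurable A.
Local Open Scope ereal_scope.

Let sG S : sigma_algebra setT (sigma_gen A S). Proof. exact: smallest_sigma_algebra. Qed.
Let Gm S := sigma_gen_measurable mA (S := S).

Lemma expe2_ge0 (x : \bar R) : 0 <= x ^+ 2.
Proof.
by rewrite expe2; case: x => [r| |]; rewrite ?mulyy ?mulNyNy ?leey// -EFinM lee_fin -expr2 sqr_ge0.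
Qed.

(** By minimality the suprema of the indicator and of its opposite are at most 1 and 0; their sum is
    nonnegative because each dominates its function. *)
Lemma osc_indic_le1 (S : set 'rV[R]_d) (B : set T) : measurable B ->
  osc_L2 P A S (fun w => \1_B w : R) <= 1.
Proof.
move=> mB; set G := sigma_gen A (~` S).
have [Z /cond_ess_supP[mZ XZ minZ]] := cond_ess_sup_indic P (sG (~` S)) (@Gm (~` S)) mB.
have [Z1 H1] := cond_ess_sup_indic P (sG (~` S)) (@Gm (~` S)) (measurableC mB).
have NE : (fun w => (\1_(~` B) w + - 1 : R)%R) = (\- (fun w => (\1_B w : R)))%R.
  by apply/funext => w /=; rewrite !indicE in_setC; case: (w \in B) => /=; rewrite ?sub0r ?subrr ?oppr0.
have := is_cond_ess_supD (-1)%R H1; rewrite NE => /cond_ess_supP[mZ' XZ' minZ'].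
have mcst (c : \bar R) : measurable_wrt (sigma_gen A (~` S)) (cst c : T -> \bar R).
  exact: measurable_wrt_cst.
have Zle1 := minZ (cst 1) (mcst 1).
have Z'le0 := minZ' (cst 0) (mcst 0).
have osc01 : {ae P, forall w, 0 <= osc P A S (fun w => \1_B w : R) w <= 1}.
  have h1 : {ae P, forall w, (\1_B w)%:E <= cst (1 : \bar R) w}.
    by apply: aeW => w; rewrite lee_fin indicE lern1 leq_b1.
  have h2 : {ae P, forall w, ((\- (fun w => (\1_B w : R))) w)%R%:E <= cst (0 : \bar R) w}.
    by apply: aeW => w; rewrite lee_fin/= oppr_le0 indicE.
  have := ae_and (ae_and (Zle1 h1) (Z'le0 h2)) (ae_and XZ XZ').
  apply: filterS => w [[a b] [c e]]; rewrite /osc; apply/andP; split.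
    by rewrite -(subee (x := (\1_B w)%:E))// leeD.
  by rewrite -[leRHS]adde0 leeD.
have mosc : measurable_fun setT (osc P A S (fun w => \1_B w : R)).
  by apply: emeasurable_funD; exact: measurable_wrt_fun (@Gm (~` S)) _ _ _ _.
have I1 : \int[P]_w (osc P A S (fun w => \1_B w : R) w ^+ 2) <= 1.
  have E1 : \int[P]_w cst (1 : \bar R) w = 1.
    by apply: etrans (integral_cst P measurableT 1) _; rewrite mul1e; exact: probability_setT.
  rewrite -[leRHS]E1.
  apply: ae_ge0_le_integral => //.
  - by move=> w _; exact: expe2_ge0.
  - under eq_fun do rewrite expe2; exact: emeasurable_funM.
  - apply: filterS osc01 => w /andP[p0 p1] _; rewrite expe2 /cst -[leRHS]mule1.
    exact: lee_pmul.
rewrite /osc_L2 -(poweR1r 2^-1) gt0_ler_poweR ?invr_ge0// in_itv/= ?leey ?andbT//.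
apply: integral_ge0 => w _; exact: expe2_ge0.
Qed.

(** An indicator that is measurable with respect to A outside S is its own conditional essential
    supremum, and so is its opposite. *)
Lemma osc_indic_eq0 (S S1 : set 'rV[R]_d) (B : set T) : S1 `<=` ~` S ->
  sigma_gen A S1 B -> osc_L2 P A S (fun w => \1_B w : R) = 0.
Proof.
move=> S1S GB'; have GB : sigma_gen A (~` S) B by exact: (sigma_gen_sub S1S).
have mX := measurable_wrt_indic (sG _) GB (R := R).
have mNX : measurable_wrt (sigma_gen A (~` S)) (\- (fun w => (\1_B w : R)))%R.
  have mN : measurable_fun setT (fun z : R => - z)%R by exact: measurable_funN.
  exact: (measurable_wrt_comp mN mX).
have idX := is_cond_ess_sup_id P mX; have idNX := is_cond_ess_sup_id P mNX.
have [mZ XZ minZ] := cond_ess_supP idX; have [mZ' XZ' minZ'] := cond_ess_supP idNX.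
have [mX' XX _] := idX; have [mNX' NXX _] := idNX.
have osc0 : {ae P, forall w, osc P A S (fun w => \1_B w : R) w = 0}.
  have := ae_and (ae_and (minZ _ mX' XX) (minZ' _ mNX' NXX)) (ae_and XZ XZ').
  apply: filterS => w [[a b] [c e]]; rewrite /osc.
  have -> : cond_ess_sup P (sigma_gen A (~` S)) (fun w => \1_B w : R) w = (\1_B w)%:E.
    by apply/eqP; rewrite eq_le a c.
  have -> : cond_ess_sup P (sigma_gen A (~` S)) (\- (fun w => \1_B w : R))%R w = (- \1_B w)%:E.
    by apply/eqP; rewrite eq_le b e.
  by rewrite -EFinD subrr.
rewrite /osc_L2 (_ : integral _ _ _ = 0) ?poweR0r ?invr_eq0//.
have mosc : measurable_fun setT (osc P A S (fun w => \1_B w : R)).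
  by apply: emeasurable_funD; exact: measurable_wrt_fun (@Gm (~` S)) _ _ _ _.
transitivity (\int[P]_w cst 0 w); last exact: integral0.
apply: ae_eq_integral => //.
- under eq_fun do rewrite expe2; exact: emeasurable_funM.
- by apply: filterS osc0 => w -> _; rewrite expe2 mul0e.
Qed.

End oscillation.

(** * Powers against stretched exponentials *)

Section powR_expR.
Context {R : realType}.

(** The n-th power of u <= expR u for u = c y / n. *)
Lemma exprn_le_expR (n : nat) (c y : R) : (0 < n)%N -> 0 < c -> 0 <= y ->
  y ^+ n <= (n%:R / c) ^+ n * expR (c * y).
Proof.
move=> n0 c0 y0; have nR : 0 < n%:R :> R by rewrite ltr0n.
have -> : expR (c * y) = expR (c * y / n%:R) ^+ n.
  by rewrite -expRM_natl; congr expR; field; rewrite gt_eqF.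
rewrite -exprMn ler_pXn2r ?nnegrE//; last first.
  by rewrite mulr_ge0 ?expR_ge0// divr_ge0// ltW.
rewrite (@le_trans _ _ (n%:R / c * (c * y / n%:R)))//.
  by rewrite le_eqVlt; apply/orP; left; apply/eqP; field; rewrite !gt_eqF.
rewrite ler_wpM2l ?divr_ge0 ?(ltW c0)//.
have := expR_ge1Dx (c * y / n%:R); lra.
Qed.

Lemma powR_le_expR (p c g : R) : 0 < c -> 0 < g ->
  exists K : R, 0 < K /\ forall x, 1 <= x -> x `^ p <= K * expR (c * x `^ g).
Proof.
move=> c0 g0.
have [n /andP[n0 png]] : exists n : nat, (0 < n)%N && (p <= g * n%:R).
  exists (Num.truncn (`|p| / g)).+1; rewrite ltn0Sn/=.
  rewrite mulrC -ler_pdivrMr//.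
  have H : `|p| / g < (Num.truncn (`|p| / g)).+1%:R by rewrite truncnS_gt.
  rewrite (le_trans _ (ltW H))// ler_pM2r ?invr_gt0//; exact: ler_norm.
exists ((n%:R / c) ^+ n); split; first by rewrite exprn_gt0// divr_gt0// ltr0n.
move=> x x1; apply: (@le_trans _ _ (x `^ (g * n%:R))).
  exact: ler_powR.
rewrite powRrM powR_mulrn ?powR_ge0//; apply: exprn_le_expR => //.
exact: powR_ge0.
Qed.

End powR_expR.

Section mci_mixing.
Context {R : realType}.

Lemma bounded_Lfun {dT} {T : measurableType dT} (P : probability T R) (X : T -> R) (K r : R) :
  measurable_fun setT X -> (forall w, `|X w| <= K) -> 1 <= r -> X \in Lfun P r%:E.
Proof.
move=> mX XK r1; rewrite inE/=; apply/andP; split; rewrite inE//=.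
rewrite /finite_norm unlock poweR_lty//.
have r0 : r != 0 by rewrite gt_eqF// (lt_le_trans _ r1).
apply: (@le_lt_trans _ _ (\int[P]_w (cst (K `^ r)%:E w))%E); last first.
  rewrite integral_cst//; apply: lte_mul_pinfty; rewrite ?lee_fin ?powR_ge0//.
  by apply: (le_lt_trans (probability_le1 P measurableT)); rewrite ltry.
apply: ge0_le_integral_nonmeas => w _; first exact: poweR_ge0.
rewrite poweR_EFin lee_fin ge0_ler_powR ?nnegrE ?(le_trans _ r1)//.
  by rewrite (le_trans _ (XK w)).
Qed.

Lemma measurable_box d (c : 'rV[R]_d) (rho : R) : measurable_fun setT
  (fun x : 'rV[R]_d => \prod_(i < d) (`|x ord0 i - c ord0 i| <= rho)%R%:R : R).
Proof.
apply: measurable_prod => i _.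
rewrite (_ : (fun _ => _) = (\1_(`[c ord0 i - rho, c ord0 i + rho]%classic : set R) : R -> R) \o
   (fun x : 'rV[R]_d => x ord0 i)).
  by apply: measurableT_comp; [exact: measurable_indic|exact: measurable_rV_coord].
by apply/funext => x; rewrite /= indicE mem_setE in_itv/= -ler_distl.
Qed.

(** One constant serves as prefactor, as power of 1 + D and as inverse rate, so that the bound
    weakens as K grows and two sources of mixing can share a K. *)
Definition mixing_bound d {dT} {T : measurableType dT} (P : probability T R)
    (A : 'rV[R]_d -> T -> R) (beta K : R) : Prop :=
  forall D l : R, 0 <= D -> 0 <= l ->
    (tilde_alpha P A l D <= (K * (1 + D) `^ K * expR (- (K^-1 * l `^ beta)))%:E)%E.

Lemma mixing_bound_weaken d {dT} {T : measurableType dT} (P : probability T R)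
    (A : 'rV[R]_d -> T -> R) (beta K K' : R) : 0 < K -> K <= K' ->
  mixing_bound P A beta K -> mixing_bound P A beta K'.
Proof.
move=> K0 KK' H D l D0 l0; have K'0 := lt_le_trans K0 KK'.
apply: (le_trans (H D l D0 l0)); rewrite lee_fin ler_pM ?mulr_ge0 ?powR_ge0 ?expR_ge0 ?(ltW K0)//.
  rewrite ler_pM ?powR_ge0 ?(ltW K0)//; apply: ler_powR => //; lra.
by rewrite ler_expR lerN2 ler_wpM2r ?powR_ge0// lef_pV2.
Qed.

Lemma covariance_indic {dT} {T : measurableType dT} (P : probability T R) (B1 B2 : set T) :
  measurable B1 -> measurable B2 ->
  (covariance P (fun w => \1_B1 w : R) (fun w => \1_B2 w : R) =
   P (B1 `&` B2) - P B1 * P B2)%E.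
Proof.
move=> mB1 mB2.
have L (B : set T) : measurable B -> (fun w => \1_B w : R) \in Lfun P 1.
  move=> mB; apply: (@bounded_Lfun _ _ _ _ 1) => //; first exact: measurable_indic.
  by move=> w; rewrite indicE ger0_norm ?ler0n// lern1 leq_b1.
have E (B : set T) : measurable B -> ('E_P[(fun w => \1_B w : R)] = P B)%E.
  by move=> mB; rewrite unlock integral_indic// setIT.
have I : ((fun w => \1_B1 w : R) * (fun w => \1_B2 w : R))%R = (fun w => \1_(B1 `&` B2) w : R).
  by apply/funext => w; rewrite /= !indicE in_setI -mulnb natrM.
rewrite covarianceE ?I ?L//; last exact: measurableI.
by rewrite !E//; exact: measurableI.
Qed.

Section tail_weight.
Variables (beta C1 : R).
Hypotheses (beta0 : 0 < beta) (C10 : 0 < C1).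

(** The decay in s is split into halves. One beats 1 + s^2, whose inverse has integral pi / 2 over
    the scales s >= 0. The other becomes decay in l: for l >= 4 the constraint gives l / 4 <= s, so
    (l / 4)^beta <= 1 + s^beta in all cases. *)
Lemma expR_powR_tail : exists K : R, 0 < K /\ forall l s : R, 0 <= l -> 0 <= s -> l <= 2 * (s + 1) ->
  expR (- (C1^-1 * s `^ beta)) <=
  K * (oneDsqr s)^-1 * expR (- ((2 * C1 * 4 `^ beta)^-1 * l `^ beta)).
Proof.
pose c := (2 * C1)^-1.
have c0 : 0 < c by rewrite invr_gt0 mulr_gt0.
have [K2 [K20 HK2]] := powR_le_expR 2 c0 beta0.
exists ((2 + 2 * K2) * expR c); split.
  by rewrite mulr_gt0 ?expR_gt0// addr_gt0// mulr_gt0.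
move=> l s l0 s0 ls.
have -> : C1^-1 * s `^ beta = c * s `^ beta + c * s `^ beta by rewrite /c; field; rewrite gt_eqF.
rewrite opprD expRD.
have h1 : expR (- (c * s `^ beta)) <= (2 + 2 * K2) * (oneDsqr s)^-1.
  rewrite expRN -[leLHS]mul1r ler_pdivlMr; last by rewrite (lt_le_trans _ (oneDsqr_ge1 s)).
  rewrite mulrAC ler_pdivrMr ?expR_gt0// mul1r /oneDsqr.
  have e1 : 1 <= expR (c * s `^ beta) by rewrite -expR0 ler_expR mulr_ge0 ?powR_ge0// ltW.
  have [s1|s1] := leP 1 s.
    have := HK2 s s1; rewrite powR_mulrn// => h.
    have : 1 <= s ^+ 2 by rewrite exprn_ege1.
    nra.
  have : s ^+ 2 <= 1 by rewrite expr_le1// ltW.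
  nra.
have h2 : expR (- (c * s `^ beta)) <= expR c * expR (- ((2 * C1 * 4 `^ beta)^-1 * l `^ beta)).
  rewrite -expRD ler_expR.
  have -> : (2 * C1 * 4 `^ beta)^-1 * l `^ beta = c * (l / 4) `^ beta.
    rewrite powRM// invfM -mulrA; congr (_ * _); rewrite mulrC; congr (_ * _).
    by rewrite -powR_inv1// -powRrM mulN1r powRN.
  suff H : (l / 4) `^ beta <= 1 + s `^ beta by have := ler_wpM2l (ltW c0) H; lra.
  have [l4|l4] := leP 4 l.
    have : (l / 4) `^ beta <= s `^ beta.
      by rewrite ge0_ler_powR ?nnegrE ?(ltW beta0) ?divr_ge0//; lra.
    lra.
  have : (l / 4) `^ beta <= 1.
    rewrite [leRHS](_ : 1 = 1 `^ beta); last by rewrite powR1.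
    rewrite ge0_ler_powR ?nnegrE ?(ltW beta0) ?divr_ge0//; lra.
  have := powR_ge0 s beta; lra.
apply: (le_trans (ler_pM (expR_ge0 _) (expR_ge0 _) h1 h2)).
by rewrite le_eqVlt; apply/orP; left; apply/eqP; ring.
Qed.

End tail_weight.

Lemma osc_MCI_mixing_bound (d : nat) (beta C1 : R) : 0 < beta -> 0 < C1 ->
  exists K : R, 0 < K /\
  forall (dT : measure_display) (T : measurableType dT) (P : probability T R)
    (A : 'rV[R]_d -> T -> R) (wt : R -> R), jointly_measurable A -> osc_MCI P A wt ->
  (forall l : R, 0 <= l -> wt l <= C1 * expR (- (C1^-1 * l `^ beta))) ->
  mixing_bound P A beta K.
Proof.
move=> beta0 C10.
have [K1 [K10 HK1]] := expR_powR_tail beta0 C10.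
(* The set of centres has volume at most (2 (1 + D))^d relative to (s + 1)^d; the other factors come
   from the weight, its tail bound and the integral of 1 / (1 + s^2). *)
pose K0 := 2 ^+ d * C1 * K1 * (pi / 2).
pose Ce := 2 * C1 * 4 `^ beta.
have Ce0 : 0 < Ce by rewrite !mulr_gt0// powR_gt0.
have pi2 : 0 < pi / 2 :> R by rewrite divr_gt0// pi_gt0.
have K00 : 0 < K0 by rewrite mulr_gt0// !mulr_gt0 ?exprn_gt0.
(* The maximum of what is required of the prefactor, of the power of 1 + D and of the inverse
   rate. *)
exists (Num.max (Num.max K0 d%:R) Ce); split.
  by rewrite lt_max Ce0 orbT.
move=> dT T P A wt mA [wt0 iwt mci] wtb D l D0 l0.
set K := Num.max _ _.
have K0K : K0 <= K by rewrite !le_max lexx.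
have dK : d%:R <= K by rewrite !le_max lexx orbT.
have CeK : Ce <= K by rewrite le_max lexx orbT.
have Kp : 0 < K by exact: lt_le_trans K00 K0K.
pose a := K0 * (1 + D) ^+ d * expR (- (Ce^-1 * l `^ beta)).
have aK : a <= K * (1 + D) `^ K * expR (- (K^-1 * l `^ beta)).
  have Dp : 0 <= 1 + D by lra.
  have aux : 0 <= K0 * (1 + D) ^+ d by apply: mulr_ge0; [exact: ltW|exact: exprn_ge0].
  apply: ler_pM => //.
    apply: ler_pM => //; [exact: ltW|exact: exprn_ge0|].
    by rewrite -powR_mulrn//; apply: ler_powR => //; lra.
  by rewrite ler_expR lerN2 ler_wpM2r ?powR_ge0// lef_pV2.
apply: (@le_trans _ _ a%:E); last by rewrite lee_fin.
apply: ge_ereal_sup => _ [[S1 S2] /= [mS1 mS2 dist di1 di2] <-].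
have S12 x y : S1 x -> S2 y -> l <= enorm (x - y).
  move=> Sx Sy; rewrite -lee_fin; apply: (le_trans dist); apply: ereal_inf_lbound.
  by exists x => //; exists y.
have D1 x y : S1 x -> S1 y -> enorm (x - y) <= D.
  move=> Sx Sy; rewrite -lee_fin; apply: le_trans di1; apply: ereal_sup_ubound.
  by exists x => //; exists y.
(* Any point of S1 serves as centre; for S1 empty the condition is void. The centres of the balls of
   radius s + 1 that meet S1 then lie in a box of half-side D + s + 1 around c. *)
have [c cP] : exists c : 'rV[R]_d, forall p, S1 p -> enorm (p - c) <= D.
  have [[c Sc]|S10] := pselect (exists c, S1 c); first by exists c => p Sp; exact: D1.
  by exists 0 => p Sp; case: S10; exists p.
have cov (B1 B2 : set T) : sigma_gen A S1 B1 -> sigma_gen A S2 B2 ->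
    (covariance P (fun w => \1_B1 w : R) (fun w => \1_B2 w : R) <= a%:E)%E.
  move=> GB1 GB2.
  have mB1 := sigma_gen_measurable mA GB1; have mB2 := sigma_gen_measurable mA GB2.
  have wrt S (B : set T) : sigma_gen A S B -> measurable_wrt (sigma_gen A setT) (fun w => \1_B w : R).
    move=> GB; apply: (measurable_wrt_indic (smallest_sigma_algebra _ _)).
    exact: (sigma_gen_sub (@subsetT _ S)).
  have L (B : set T) : measurable B -> (fun w => \1_B w : R) \in Lfun P 2%:E.
    move=> mB; apply: (@bounded_Lfun _ _ _ _ 1) => //; [exact: measurable_indic| |by rewrite ler1n].
    by move=> w; rewrite indicE ger0_norm ?ler0n// lern1 leq_b1.
  apply: (le_trans (mci _ _ (wrt _ _ GB1) (wrt _ _ GB2) (L _ mB1) (L _ mB2))).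
  have Q0 : 0 <= (2 * (1 + D)) ^+ d * C1 * K1 * expR (- (Ce^-1 * l `^ beta)).
    apply: mulr_ge0 => //; apply: mulr_ge0; last exact: ltW.
    apply: mulr_ge0; last exact: ltW.
    by rewrite exprn_ge0// mulr_ge0//; lra.
  have od0 (s : R) : 0 <= (oneDsqr s)^-1 by rewrite invr_ge0 (le_trans ler01)// oneDsqr_ge1.
  pose q s x := (osc_L2 P A (eball x (s + 1)) (fun w => \1_B1 w : R) *
                 osc_L2 P A (eball x (s + 1)) (fun w => \1_B2 w : R))%E.
  have q0 s x : (0 <= q s x)%E by rewrite mule_ge0 ?poweR_ge0.
  have qle s x : (q s x <= (l <= 2 * (s + 1))%R%:R%:E *
      (\prod_(i < d) (`|x ord0 i - c ord0 i| <= D + (s + 1))%R%:R)%:E)%E.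
    (* The oscillation of an indicator vanishes unless the ball meets the set
       that carries the event. *)
    have [[p [Sp xp]]|H1] := pselect (exists p, S1 p /\ eball x (s + 1) p); last first.
      rewrite /q (@osc_indic_eq0 _ _ _ _ _ _ mA _ S1)//; last first.
        by move=> p Sp xp; apply: H1; exists p.
      by rewrite mul0e mule_ge0// lee_fin ?ler0n// prodr_ge0.
    have [[p' [Sp' xp']]|H2] := pselect (exists p, S2 p /\ eball x (s + 1) p); last first.
      rewrite /q [X in (_ * X)%E](@osc_indic_eq0 _ _ _ _ _ _ mA _ S2)//; last first.
        by move=> p' Sp' xp'; apply: H2; exists p'.
      by rewrite mule0 mule_ge0// lee_fin ?ler0n// prodr_ge0.
    move: xp xp'; rewrite /eball/= => xp xp'.
    have -> : (l <= 2 * (s + 1))%R = true.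
      apply: (le_trans (S12 _ _ Sp Sp')); apply: (le_trans (enorm_triangle x p p')).
      rewrite [X in _ + X]enorm_distC; lra.
    rewrite big1 ?mul1e.
      rewrite -[leRHS]mule1; apply: lee_pmul; rewrite ?poweR_ge0//; exact: osc_indic_le1.
    move=> i _; rewrite (_ : (_ <= _)%R = true)//.
    have := ler_coord_enorm (x - c) i; rewrite !mxE => /le_trans; apply.
    apply: (le_trans (enorm_triangle p x c)); rewrite enorm_distC.
    have := cP p Sp; lra.
  apply: (@le_trans _ _ (\int[@lebesgue_measure R]_(s in `[0%R, +oo[)
      ((2 * (1 + D)) ^+ d * C1 * K1 * expR (- (Ce^-1 * l `^ beta)) * (oneDsqr s)^-1)%:E)%E).
    apply: ge0_le_integral_nonmeas => s; rewrite /= in_itv/= andbT => s0.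
      rewrite mule_ge0//; first by apply: integral_ge0 => x _; exact: q0.
      by rewrite lee_fin mulr_ge0 ?wt0// invr_ge0 exprn_ge0//; lra.
    have c0 : 0 <= (s + 1) ^- d * wt s.
      by rewrite mulr_ge0 ?wt0// invr_ge0 exprn_ge0//; lra.
    apply: (@le_trans _ _ (((l <= 2 * (s + 1))%R%:R%:E * ((2 * (D + (s + 1))) ^+ d)%:E) *
        ((s + 1) ^- d * wt s)%:E)%E).
      rewrite lee_wpmul2r ?lee_fin//.
      apply: (@le_trans _ _ (\int[lebesgue_rV d]_x ((l <= 2 * (s + 1))%R%:R%:E *
          (\prod_(i < d) (`|x ord0 i - c ord0 i| <= D + (s + 1))%R%:R)%:E))%E).
        by apply: ge0_le_integral_nonmeas => x _; [exact: q0|exact: qle].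
      rewrite ge0_integralZl_EFin//; last 2 first.
      - by move=> x _; rewrite lee_fin prodr_ge0.
      - by apply/measurable_EFinP; exact: measurable_box.
      by rewrite integral_box//; lra.
    have [ls|_] := leP l (2 * (s + 1)); last first.
      by rewrite mul0e mul0e lee_fin mulr_ge0.
    rewrite mul1e -EFinM lee_fin mulrA.
    have s1 : 0 < s + 1 by lra.
    have -> : (2 * (D + (s + 1))) ^+ d / (s + 1) ^+ d = (2 * (D + (s + 1)) / (s + 1)) ^+ d.
      by rewrite expr_div_n.
    set X := 2 * (D + (s + 1)) / (s + 1).
    have X0 : 0 <= X by apply: divr_ge0; [apply: mulr_ge0; lra|exact: ltW].
    have XD : X <= 2 * (1 + D) by rewrite ler_pdivrMr//; nra.
    have Xd : X ^+ d <= (2 * (1 + D)) ^+ d by apply: lerXn2r; rewrite ?nnegrE//; lra.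
    have ws : wt s <= C1 * (K1 * (oneDsqr s)^-1 * expR (- (Ce^-1 * l `^ beta))).
      by apply: (le_trans (wtb s s0)); rewrite ler_pM2l//; exact: HK1.
    apply: (le_trans (ler_pM (exprn_ge0 d X0) (wt0 s s0) Xd ws)).
    by rewrite le_eqVlt; apply/orP; left; apply/eqP; ring.
  under eq_integral do rewrite EFinM.
  rewrite ge0_integralZl_EFin//; last first.
    apply/measurable_EFinP; apply: measurable_funTS.
    by apply: continuous_measurable_fun; exact: continuous_oneDsqrV.
  rewrite integral0y_oneDsqr -EFinM lee_fin /a /K0 exprMn.
  by rewrite le_eqVlt; apply/orP; left; apply/eqP; ring.
apply: ge_ereal_sup => _ [B1 GB1 [B2 GB2 <-]].
have mB1 := sigma_gen_measurable mA GB1; have mB2 := sigma_gen_measurable mA GB2.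
have := cov _ _ GB1 GB2; rewrite covariance_indic// => h1.
(* The inequality for [~` B1] is the lower bound for [B1]. *)
have GcB1 : sigma_gen A S1 (~` B1).
  by have [_ H _] := smallest_sigma_algebra setT (\bigcup_(i in S1) preimage_set_system setT (A i) measurable); rewrite -setTD; exact: H.
have := cov _ _ GcB1 GB2; rewrite covariance_indic//; last exact: measurableC.
move: h1; have fP (B : set T) : measurable B -> P B = (fine (P B))%:E.
  by move=> mB; rewrite fineK// fin_num_measure.
have -> : P (~` B1 `&` B2) = (P B2 - P (B1 `&` B2))%E.
  rewrite setIC -setDE measureD//; last by rewrite -ge0_fin_numE// fin_num_measure.
  by rewrite setIC.
rewrite probability_setC// (fP B1)// (fP B2)// (fP (B1 `&` B2)); last exact: measurableI.
rewrite -[1%E]/(1%:E) -!EFinB !lee_fin => h1 h2.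
rewrite ler_norml; apply/andP; split; lra.
Qed.

End mci_mixing.

(** * Exponential moments and concentration *)

Section clamp.
Context {R : realType}.

(** Truncation fixes [-M, M] and brings every number closer to each point of it. Local approximants
    thus inherit the bound of f at no cost in the error, and an f bounded almost surely can be
    replaced by one bounded everywhere. *)
Definition clamp (M z : R) : R := Num.max (- M) (Num.min z M).

Lemma clamp_le (M z : R) : 0 <= M -> `|clamp M z| <= M.
Proof.
move=> M0; rewrite ler_norml /clamp le_max lexx/= ge_max ge_min lexx orbT andbT.
by rewrite (le_trans _ M0)// oppr_le0.
Qed.

Lemma clamp_id (M z : R) : `|z| <= M -> clamp M z = z.
Proof. by rewrite ler_norml /clamp => /andP[Mz zM]; rewrite min_l// max_r. Qed.

Lemma clamp_dist (M y z : R) : `|y| <= M -> `|y - clamp M z| <= `|y - z|.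
Proof.
rewrite ler_norml /clamp => /andP[My yM].
have [zM|zM] := leP z M; first by have [Mz|Mz] := leP z (- M) => //; rewrite !ger0_norm; lra.
rewrite max_r; last by lra.
by rewrite !ler0_norm; lra.
Qed.

Lemma measurable_clamp (M : R) : measurable_fun setT (clamp M).
Proof. by apply: measurable_maxr => //; exact: measurable_minr. Qed.

End clamp.

Section local_approximation.
Context {R : realType} {d : nat} {dT} {T : measurableType dT}.
Variables (P : probability T R) (A : 'rV[R]_d -> T -> R).
Hypotheses (mA : jointly_measurable A) (sA : stationary P A).
Variables (f : ('rV[R]_d -> R) -> R) (M : R).
Hypotheses (mf : measurable_wrt (sigma_gen coord_ev setT) f) (fM : forall a, `|f a| <= M).

Lemma measurable_wrt_shift (x : 'rV[R]_d) (S S' : set 'rV[R]_d) (g : ('rV[R]_d -> R) -> R) :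
  (forall y, S y -> S' (y + x)) -> measurable_wrt (sigma_gen coord_ev S) g ->
  measurable_wrt (sigma_gen A S') (fun w => g (shift_path A x w)).
Proof.
move=> SS' mg _ [B mB <-]; rewrite setTI.
apply: (@shift_path_preimage _ _ _ _ A x S S' (g @^-1` B)) => //.
by apply: mg; exists B => //; rewrite setTI.
Qed.

Lemma measurable_shifted (x : 'rV[R]_d) : measurable_fun setT (fun w => f (shift_path A x w)).
Proof.
apply: (sigma_gen_fun mA (S := setT)).
exact: (measurable_wrt_shift (S := setT)).
Qed.

Lemma mean_shifted (x : 'rV[R]_d) :
  \int[P]_w f (shift_path A x w) = \int[P]_w f (shift_path A 0 w).
Proof.
rewrite /Rintegral; congr fine.
apply: (integral_shift_path mA sA x (g := EFin \o f)).
move=> _ [B mB <-]; apply: mf; exists (EFin @^-1` B) => //.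
by rewrite -[_ @^-1` _]setTI; exact: EFin_measurable.
Qed.

(** By [doob_dynkin], h is a function of the path that only sees the ball around 0. Evaluated on the
    path shifted by x it only sees the ball around x, and stationarity preserves the almost sure
    error. *)
Lemma local_approximation (l e : R) (h : T -> R) :
  measurable_wrt (sigma_gen A (eball 0 l)) h ->
  {ae P, forall w, `|f (shift_path A 0 w) - h w| <= e} ->
  forall x, exists G : T -> R, [/\ measurable_wrt (sigma_gen A (eball x l)) G,
    forall w, `|G w| <= M & {ae P, forall w, `|f (shift_path A x w) - G w| <= e}].
Proof.
move=> mh fh x.
have M0 : 0 <= M by rewrite (le_trans _ (fM 0)).
have [g [mg hg]] := doob_dynkin (measurable_wrt_sub (@sigma_gen_path _ _ _ _ A _) mh).
have mgc (S : set (set ('rV[R]_d -> R))) : measurable_wrt S g -> measurable_wrt S (fun a => clamp M (g a)).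
  by move=> mgS; exact: (measurable_wrt_comp (measurable_clamp M) mgS).
exists (fun w => clamp M (g (shift_path A x w))); split.
- apply: (measurable_wrt_shift (S := eball 0 l) (g := fun a => clamp M (g a))).
    by move=> y; rewrite /eball/= subr0 addrK.
  exact: mgc.
- by move=> w; exact: clamp_le.
- apply: (ae_shift_path mA sA x (h := fun a => `|f a - clamp M (g a)|)).
    have mg' : measurable_wrt (sigma_gen coord_ev setT) g.
      by apply: measurable_wrt_sub mg; exact: sigma_gen_sub.
    apply/measurable_wrt_sigmaP; apply: measurableT_comp => //.
    apply: measurable_funB; apply/measurable_wrt_sigmaP => //.
    exact: mgc.
  apply: filterS fh => w; rewrite hg; apply: le_trans.
  exact: clamp_dist.
Qed.

End local_approximation.

Section moment_bound.
Context {R : realType} {d : nat} {dT} {T : measurableType dT}.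
Variables (P : probability T R) (A : 'rV[R]_d -> T -> R).
Hypotheses (mA : jointly_measurable A) (sA : stationary P A).
Variables (f : ('rV[R]_d -> R) -> R) (M : R).
Hypotheses (mf : measurable_wrt (sigma_gen coord_ev setT) f) (fM : forall a, `|f a| <= M).

Let m := \int[P]_w f (shift_path A 0 w).

Lemma mean_le : `|m| <= M.
Proof.
have /andP[m1 m2] : - M <= m <= M.
  apply: Rintegral_bounds => [|w]; first exact: (measurable_shifted mA).
  by rewrite -ler_norml.
by rewrite ler_norml m1.
Qed.

(** The local versions G i replace F(x i) twice: in the whole product, so that it factorizes, and
    back in each single factor, where F is exactly centered while G i is not. Each passage costs
    exp(t e sum c), which explains the two occurrences. The constant 8 M^2 is 2 (2 M)^2 from
    [exponential_moment], as F - m is bounded by 2 M. *)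
Lemma moment_bound (I : finType) (x : I -> 'rV[R]_d) (c : I -> R) (h : T -> R) (l r D a e t : R) :
  (forall i, 0 <= c i) -> 0 <= t -> (forall i, t * c i * (2 * M) <= 1) ->
  (forall i j, i != j -> r + 2 * l <= enorm (x i - x j)) ->
  (forall i j, enorm (x i - x j) <= D) ->
  0 <= a -> (tilde_alpha P A r (D + 2 * l) <= a%:E)%E ->
  measurable_wrt (sigma_gen A (eball 0 l)) h ->
  {ae P, forall w, `|f (shift_path A 0 w) - h w| <= e} ->
  (\int[P]_w (expR (t * \sum_i c i * (f (shift_path A (x i) w) - m)))%:E <=
   (expR (t * e * \sum_i c i) * (expR (t * e * \sum_i c i + 8 * M ^+ 2 * t ^+ 2 * \sum_i c i ^+ 2) +
    #|I|%:R * a * expR (2 * M * t * \sum_i c i)))%:E)%E.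
Proof.
move=> c0 t0 tc sep dia a0 ta mh fh.
have M0 : 0 <= M by rewrite (le_trans _ (fM 0)).
have [G GP] := choice (fun i => local_approximation mA sA mf fM mh fh (x i)).
have mFi i : measurable_fun setT (fun w => f (shift_path A (x i) w)) by exact: (measurable_shifted mA).
have mGi i : measurable_fun setT (G i) by case: (GP i) => mG _ _; exact: (sigma_gen_fun mA mG).
pose V i w := expR (t * c i * (G i w - m)).
pose b i := expR (t * c i * (2 * M)).
have tc0 i : 0 <= t * c i by rewrite mulr_ge0.
have Gm i w : `|G i w - m| <= 2 * M.
  rewrite (le_trans (ler_normB _ _))// mulr_natl mulr2n lerD//; last exact: mean_le.
  by case: (GP i).
have Fm i w : `|f (shift_path A (x i) w) - m| <= 2 * M.
  rewrite (le_trans (ler_normB _ _))// mulr_natl mulr2n lerD//; exact: mean_le.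
have V0b i w : 0 <= V i w <= b i.
  rewrite expR_ge0/= ler_expR ler_wpM2l//; exact: le_trans (ler_norm _) (Gm i w).
have mV i : measurable_fun setT (V i).
  by apply: measurableT_comp => //; apply: measurable_funM => //; exact: measurable_funB.
have mwV i : measurable_wrt (sigma_gen A (eball (x i) l)) (V i).
  case: (GP i) => mG _ _; have mk : measurable_fun setT (fun z : R => expR (t * c i * (z - m))).
    apply: measurableT_comp => //; apply: measurable_funM => //; exact: measurable_funB.
  exact: (measurable_wrt_comp mk mG).
have prod_bound := expectation_prod_mixing mA (index_enum_uniq I) mwV V0b (fun i => expR_gt0 _) sep dia a0 ta.
have EV i : \int[P]_w V i w <= expR (t * e * c i + 8 * M ^+ 2 * t ^+ 2 * c i ^+ 2).
  pose X w := f (shift_path A (x i) w) - m.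
  have mX : measurable_fun setT X by exact: measurable_funB.
  have iF : P.-integrable setT (EFin \o (fun w => f (shift_path A (x i) w))).
    exact: (@bounded_integrable _ _ _ P _ M).
  have X0 : \int[P]_w X w = 0.
    rewrite RintegralB//; last exact: (finite_measure_integrable_cst P _ measurableT).
    by rewrite (mean_shifted mA sA mf) [X in _ - X]Rintegral_prob_cst subrr.
  have EX := exponential_moment mX (Fm i) X0 (tc0 i) (tc i).
  have mEX : measurable_fun setT (fun w => expR (t * c i * X w)).
    by apply: measurableT_comp => //; exact: measurable_funM.
  have iEX : P.-integrable setT (EFin \o (fun w => expR (t * c i * X w))).
    apply: (@bounded_integrable _ _ _ P _ (b i)) => // w.
    rewrite ger0_norm ?expR_ge0// ler_expR ler_wpM2l//; exact: le_trans (ler_norm _) (Fm i w).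
  have iV : P.-integrable setT (EFin \o V i).
    apply: (@bounded_integrable _ _ _ P _ (b i)) => // w; case/andP: (V0b i w) => v0 vb.
    by rewrite ger0_norm.
  have H : \int[P]_w V i w <= expR (t * e * c i) * \int[P]_w expR (t * c i * X w).
    rewrite -RintegralZl// -lee_fin /Rintegral !fineK.
    - apply: ae_ge0_le_integral => //.
      + by move=> w _; rewrite lee_fin expR_ge0.
      + exact/measurable_EFinP.
      + by apply/measurable_EFinP; exact: measurable_funM.
      + case: (GP i) => _ _; apply: filterS => w FG _; rewrite lee_fin /V /X -expRD ler_expR.
        have : G i w <= f (shift_path A (x i) w) + e by move: FG; rewrite ler_norml; lra.
        move=> /(ler_wpM2l (tc0 i)); lra.
    - by apply: integrable_fin_num => //; exact: (integrable_scale _ iEX).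
    - exact: integrable_fin_num.
  apply: (le_trans H); rewrite expRD ler_wpM2l ?expR_ge0// (le_trans EX)// ler_expR.
  by rewrite le_eqVlt; apply/orP; left; apply/eqP; ring.
have mprod : measurable_fun setT (fun w => \prod_i V i w) by exact: measurable_prod.
have prod_ge0 w : 0 <= \prod_i V i w by apply: prodr_ge0 => i _; exact: expR_ge0.
apply: (@le_trans _ _ (\int[P]_w (expR (t * e * \sum_i c i) * \prod_i V i w)%:E)%E).
  apply: ae_ge0_le_integral => //.
  - apply/measurable_EFinP; apply: measurableT_comp => //; apply: measurable_funM => //.
    apply: measurable_sum => i; apply: measurable_funM => //; exact: measurable_funB.
  - by move=> w _; rewrite lee_fin mulr_ge0 ?expR_ge0.
  - by apply/measurable_EFinP; exact: measurable_funM.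
  - have /filterS : {ae P, forall w i, `|f (shift_path A (x i) w) - G i w| <= e}.
      by apply: filter_forall => i; case: (GP i).
    apply => w FG _; rewrite lee_fin /V -expR_sum -expRD ler_expR !mulr_sumr -big_split/=.
    apply: ler_sum => i _.
    have : f (shift_path A (x i) w) <= G i w + e by have := FG i; rewrite ler_norml; lra.
    move=> /(ler_wpM2l (tc0 i)); lra.
have iprod : P.-integrable setT (EFin \o (fun w => \prod_i V i w)).
  apply: (@bounded_integrable _ _ _ P _ (\prod_i b i)) => // w.
  by rewrite ger0_norm//; apply: ler_prod => i _.
under eq_integral do rewrite EFinM.
rewrite ge0_integralZl_EFin//; last 2 first.
- by move=> w _; rewrite lee_fin.
- exact/measurable_EFinP.
rewrite EFinM lee_wpmul2l ?lee_fin ?expR_ge0//.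
rewrite -[leLHS]fineK; last exact: integrable_fin_num.
rewrite lee_fin; apply: (le_trans prod_bound).
apply: lerD.
  rewrite mulr_sumr mulr_sumr -big_split/= expR_sum; apply: ler_prod => i _.
  rewrite EV andbT; apply: Rintegral_ge0 => w _; exact: expR_ge0.
rewrite /b -expR_sum; have -> : size (index_enum I) = #|I| by rewrite cardT enumT.
rewrite le_eqVlt; apply/orP; left; apply/eqP; congr (_ * expR _).
by rewrite !mulr_sumr; apply: eq_bigr => i _; ring.
Qed.

End moment_bound.

Lemma measurable_gt {R : realType} {dT} {T : measurableType dT} (X : T -> R) (c : R) :
  measurable_fun setT X -> measurable [set w | c < X w].
Proof.
move=> mX; rewrite (_ : [set _ | _] = setT `&` X @^-1` `]c, +oo[%classic); first exact: mX.
by rewrite setTI; apply/seteqP; split=> w; rewrite /= in_itv/= andbT.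
Qed.

(** * Measurability of the spatial average *)

Section joint_measurability.
Context {R : realType} {d : nat} {dT} {T : measurableType dT}.
Variable (A : 'rV[R]_d -> T -> R).
Hypothesis mA : jointly_measurable A.

(** Prepares the exchange of integrals in y and w. The path events with measurable preimage in the
    product form a sigma-algebra, and joint measurability of A puts the coordinates in it. *)
Lemma measurable_joint_shift (f : ('rV[R]_d -> R) -> R) :
  measurable_wrt (sigma_gen coord_ev setT) f ->
  measurable_fun setT (fun p : 'rV[R]_d * T => f (shift_path A p.1 p.2)).
Proof.
move=> mf _ B mB; rewrite setTI.
have : sigma_gen coord_ev setT (f @^-1` B) by apply: mf; exists B => //; rewrite setTI.
suff : sigma_gen coord_ev setT `<=` image_set_system setT
    (fun p : 'rV[R]_d * T => shift_path A p.1 p.2) measurable.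
  by move=> H /H; rewrite /image_set_system/= setTI.
apply: smallest_sub; first exact/sigma_algebra_image/sigma_algebra_measurable.
move=> _ [x _ [B' mB' <-]]; rewrite /image_set_system/= !setTI.
have mxy : measurable_fun setT (fun p : 'rV[R]_d * T => (x + p.1, p.2)).
  apply/measurable_fun_pair => /=; last exact: measurable_snd.
  rewrite (_ : (fun _ => _) = (fun y => y + x) \o fst).
    by apply: measurableT_comp; [exact: measurable_rV_addr|exact: measurable_fst].
  by apply/funext => p; rewrite /= addrC.
by have := measurableT_comp mA mxy measurableT mB'; rewrite setTI.
Qed.

Lemma measurable_Rintegral_param (g : 'rV[R]_d * T -> R) : measurable_fun setT g ->
  measurable_fun setT (fun w => \int[lebesgue_rV d]_y g (y, w)).
Proof.
move=> mg; apply: (measurableT_comp (fine_measurable measurableT)).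
have mEg : measurable_fun setT (EFin \o g) by exact/measurable_EFinP.
under eq_fun do rewrite integralE.
apply: emeasurable_funB.
- have := measurable_fun_fubini_tonelli_G (m1 := lebesgue_rV d) _ (measurable_funepos mEg) (fun p => funepos_ge0 _ p).
  apply: eq_measurable_fun => w _; apply: eq_integral => y _; rewrite !funeposE//.
- have := measurable_fun_fubini_tonelli_G (m1 := lebesgue_rV d) _ (measurable_funeneg mEg) (fun p => funeneg_ge0 _ p).
  apply: eq_measurable_fun => w _; apply: eq_integral => y _; rewrite !funenegE//.
Qed.

Lemma measurable_enorm_weight (L : R) : measurable_fun setT
  (fun x : 'rV[R]_d => expR (- (L * enorm x))).
Proof.
apply: measurableT_comp => //; apply: measurable_funN.
by apply: measurable_funM => //; exact: measurable_enorm.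
Qed.

Lemma measurable_exp_average (P : probability T R) (f : ('rV[R]_d -> R) -> R) (L : R) :
  measurable_wrt (sigma_gen coord_ev setT) f ->
  measurable_fun setT (exp_average P (local_field A f) L).
Proof.
move=> mf; apply: measurable_funM => //.
apply: (measurable_Rintegral_param (g := fun p => expR (- (L^-1 * enorm p.1)) *
   (f (shift_path A p.1 p.2) - fine 'E_P[local_field A f 0]))).
apply: measurable_funM.
  exact: (measurableT_comp (measurable_enorm_weight _) measurable_fst).
by apply: measurable_funB => //; exact: measurable_joint_shift.
Qed.

End joint_measurability.

(** * Chernoff's inequality for the average *)

Section chernoff.
Context {R : realType} {d : nat} {dT} {T : measurableType dT}.
Variables (P : probability T R) (A : 'rV[R]_d -> T -> R).
Hypotheses (mA : jointly_measurable A) (sA : stationary P A).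
Variables (f : ('rV[R]_d -> R) -> R) (M : R).
Hypotheses (mf : measurable_wrt (sigma_gen coord_ev setT) f) (fM : forall a, `|f a| <= M).

Let m := \int[P]_w f (shift_path A 0 w).

Lemma local_field_mean : fine 'E_P[local_field A f 0] = m.
Proof. by rewrite unlock. Qed.

Let F y w := f (shift_path A y w) - m.

Let Fle y w : `|F y w| <= 2 * M.
Proof.
rewrite /F (le_trans (ler_normB _ _))// mulr_natl mulr2n lerD//.
exact: (mean_le P mA mf fM).
Qed.

Let mFy w : measurable_fun setT (F^~ w).
Proof.
apply: measurable_funB => //.
exact: (measurableT_comp (measurable_joint_shift mA mf) (pair2_measurable w)).
Qed.

(** Half of delta pays for the integral outside the box, so the gain is t delta / 2. Balls of radius
    s/4 around points at mutual distance s leave the gap s/2 at which the mixing coefficient is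
    taken. [Kd] bounds the total weight of the lattice points for every position y of the
    lattice. *)
Lemma chernoff_bound (L s t e delta a Kd : R) (n : nat) (h : T -> R) :
  (0 < d)%N -> 1 <= L -> 0 < s -> s <= L -> 0 <= t -> t * (s / L) ^+ d * (2 * M) <= 1 ->
  0 <= a -> (tilde_alpha P A (s / 2) (d%:R * (2 * n%:R * s) + 2 * (s / 4)) <= a%:E)%E ->
  measurable_wrt (sigma_gen A (eball 0 (s / 4))) h -> 0 <= e ->
  {ae P, forall w, `|f (shift_path A 0 w) - h w| <= e} ->
  2 * M * (4 * d%:R) ^+ d * expR (- (n%:R * s / (2 * L))) <= delta / 2 ->
  Kd = (2 * (1 + d%:R)) ^+ d ->
  (P [set w | delta < exp_average P (local_field A f) L w]%R <=
   (expR (- (t * delta / 2)) * (expR (t * e * Kd) *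
     (expR (t * e * Kd + 8 * M ^+ 2 * t ^+ 2 * ((s / L) ^+ d * Kd)) +
      ((n + n) ^ d)%:R * a * expR (2 * M * t * Kd))))%:E)%E.
Proof.
move=> d0 L1 s0 sL t0 tM a0 ta mh e0 fh tail KdE.
have L0 : 0 < L by rewrite (lt_le_trans _ L1).
have M0 : 0 <= M by rewrite (le_trans _ (fM 0)).
have iL0 : 0 < L^-1 by rewrite invr_gt0.
pose hx w x := L ^- d * (expR (- (L^-1 * enorm x)) * F x w).
have mE := measurable_enorm_weight (d := d) L^-1.
have mhx w : measurable_fun setT (hx w).
  by apply: measurable_funM => //; exact: measurable_funM.
have e1 (x : 'rV[R]_d) : expR (- (L^-1 * enorm x)) <= 1.
  by rewrite -expR0 ler_expR oppr_le0 mulr_ge0 ?enorm_ge0// ltW.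
have iLd0 : 0 <= L ^- d by rewrite invr_ge0 exprn_ge0// ltW.
have hxM w x : `|hx w x| <= 2 * M.
  rewrite /hx normrM ger0_norm// normrM ger0_norm ?expR_ge0//.
  have iLd : L ^- d <= 1 by rewrite invf_le1 ?exprn_gt0// exprn_ege1.
  rewrite -[leRHS]mul1r ler_pM ?mulr_ge0 ?expR_ge0//.
  by rewrite -[leRHS]mul1r ler_pM ?expR_ge0.
pose U w := \int[lebesgue_rV d]_x (hx w x * box_indic s n x).
have XU w : exp_average P (local_field A f) L w <= U w + delta / 2.
  rewrite /exp_average local_field_mean -lerBlDl.
  have bt := box_tail s n d0 iL0 (mFy w) (fun x => Fle x w).
  have -> : U w = L ^- d * \int[lebesgue_rV d]_x (expR (- (L^-1 * enorm x)) * F x w * box_indic s n x).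
    rewrite -RintegralZl//.
      by apply: eq_Rintegral => x _; rewrite /hx mulrA.
    have mPb : measurable_fun setT (fun x => F x w * box_indic s n x).
      by apply: measurable_funM => //; exact: measurable_box_indic.
    apply: eq_integrable (integrable_expR_enormM (K := 2 * M) d0 iL0 mPb _) => //.
      by move=> x _; rewrite mulrA.
    move=> x; rewrite normrM -[leRHS]mulr1 ler_pM//.
    by case: (box_indic01 s n x) => [->|[-> _]]; rewrite ?normr1 ?normr0.
  rewrite -mulrBr; apply: le_trans tail.
  apply: (@le_trans _ _ (L ^- d * (2 * M * expR (- (L^-1 / 2 * (n%:R * s))) * (2 * (d%:R / (L^-1 / 2))) ^+ d))).
    by rewrite ler_wpM2l// (le_trans (ler_norm _)).
  have -> : 2 * (d%:R / (L^-1 / 2)) = 4 * d%:R * L by field; rewrite gt_eqF.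
  have -> : L^-1 / 2 * (n%:R * s) = n%:R * s / (2 * L) by field; rewrite gt_eqF.
  rewrite exprMn le_eqVlt; apply/orP; left; apply/eqP; field.
  by rewrite expf_neq0// gt_eqF.
(* The weight of a lattice point: s^d from the folding, L^-d from the average. The sum is a Riemann
   sum of the exponential weight at mesh s / L <= 1, hence bounded; each term is at most q, so the
   sum of squares gains a factor q. *)
pose c y z := (s / L) ^+ d * expR (- (L^-1 * enorm (y + @lattice R d s n z))).
pose q := (s / L) ^+ d.
have q0 : 0 <= q by rewrite exprn_ge0// divr_ge0// ltW.
have c0 y z : 0 <= c y z by rewrite mulr_ge0 ?expR_ge0.
have cq y z : c y z <= q by rewrite -[leRHS]mulr1 ler_wpM2l.
have sumc y : cube_pdf s y != 0 -> \sum_z c y z <= Kd.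
  move=> yQ; rewrite -mulr_sumr.
  apply: (@le_trans _ _ (q * (2 * (1 + d%:R / (L^-1 * s))) ^+ d)).
    by rewrite ler_wpM2l// lattice_sum.
  rewrite -exprMn KdE; apply: lerXn2r; rewrite ?nnegrE.
  - by rewrite mulr_ge0 ?divr_ge0 ?(ltW s0) ?(ltW L0)// mulr_ge0// addr_ge0// divr_ge0// mulr_ge0 ?(ltW s0)// ltW.
  - by rewrite mulr_ge0// addr_ge0.
  have -> : s / L * (2 * (1 + d%:R / (L^-1 * s))) = 2 * (s / L + d%:R).
    by field; rewrite !gt_eqF.
  by rewrite ler_pM2l// lerD2r ler_pdivrMr// mul1r.
have sumc2 y : cube_pdf s y != 0 -> \sum_z c y z ^+ 2 <= q * Kd.
  move=> yQ; apply: (@le_trans _ _ (\sum_z q * c y z)).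
    by apply: ler_sum => z _; rewrite expr2 ler_wpM2r.
  by rewrite -mulr_sumr ler_wpM2l// sumc.
have Kd0 : 0 <= Kd by rewrite KdE exprn_ge0// mulr_ge0// addr_ge0.
set B := expR (t * e * Kd) * _.
have EB y : cube_pdf s y != 0 ->
    (\int[P]_w (expR (t * \sum_z c y z * F (y + @lattice R d s n z) w))%:E <= B%:E)%E.
  move=> yQ.
  have tc z : t * c y z * (2 * M) <= 1.
    apply: le_trans tM; rewrite ler_wpM2r ?mulr_ge0// ler_wpM2l//; exact: cq.
  have sep z z' : z != z' -> s / 2 + 2 * (s / 4) <=
      enorm (y + @lattice R d s n z - (y + @lattice R d s n z')).
    move=> zz'; rewrite opprD addrACA subrr add0r.
    by apply: le_trans (lattice_sep s0 zz'); lra.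
  have dia z z' : enorm (y + @lattice R d s n z - (y + @lattice R d s n z')) <= d%:R * (2 * n%:R * s).
    by rewrite opprD addrACA subrr add0r; exact: lattice_dist.
  apply: (le_trans (moment_bound mA sA mf fM (c0 y) t0 tc sep dia a0 ta mh fh)).
  have te0 : 0 <= t * e by rewrite mulr_ge0.
  have tes : t * e * \sum_z c y z <= t * e * Kd by rewrite ler_wpM2l// sumc.
  have -> : #|{ffun 'I_d -> 'I_(n + n)}| = ((n + n) ^ d)%N by rewrite card_ffun !card_ord.
  rewrite lee_fin /B ler_pM ?expR_ge0 ?addr_ge0 ?mulr_ge0 ?expR_ge0 ?ler0n ?ler_expR//.
  rewrite lerD//.
    rewrite ler_expR lerD// ler_wpM2l ?sumc2//.
    by rewrite !mulr_ge0 ?sqr_ge0.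
  by rewrite ler_wpM2l ?mulr_ge0 ?ler0n// ler_expR ler_wpM2l ?mulr_ge0// sumc.
(* Jensen bounds the exponential by the integral of J in y; integrating in w first leaves, for each
   y, the exponential moment of one lattice sum. *)
pose J (p : 'rV[R]_d * T) := (cube_pdf s p.1 *
   expR (t * (s ^+ d * \sum_z hx p.2 (p.1 + @lattice R d s n z))))%:E.
have JE y w : J (y, w) = ((cube_pdf s y)%:E * (expR (t * \sum_z c y z * F (y + @lattice R d s n z) w))%:E)%E.
  rewrite /J -EFinM; congr (_ * expR (t * _))%:E; rewrite /= mulr_sumr; apply: eq_bigr => z _.
  by rewrite /hx /c expr_div_n; ring.
have mF : measurable_fun setT (fun p : 'rV[R]_d * T => F p.1 p.2).
  by apply: measurable_funB => //; exact: measurable_joint_shift.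
have mJ : measurable_fun setT J.
  apply/measurable_EFinP; apply: measurable_funM.
    exact: (measurableT_comp (measurable_cube_pdf s) measurable_fst).
  apply: measurableT_comp => //; apply: measurable_funM => //; apply: measurable_funM => //.
  apply: measurable_sum => z; apply: measurable_funM => //.
  have mz : measurable_fun setT (fun p : 'rV[R]_d * T => (p.1 + @lattice R d s n z, p.2)).
    apply/measurable_fun_pair => /=; last exact: measurable_snd.
    exact: (measurableT_comp (measurable_rV_addr _) measurable_fst).
  apply: measurable_funM.
    exact: (measurableT_comp mE (measurableT_comp measurable_fst mz)).
  exact: (measurableT_comp mF mz).
have J0 p : (0 <= J p)%E by rewrite lee_fin mulr_ge0 ?expR_ge0// cube_pdf_ge0.
have UJ w : ((expR (t * U w))%:E <= \int[lebesgue_rV d]_y J (y, w))%E.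
  exact: (expR_box_le n s0 t (mhx w) (hxM w)).
have EJ : (\int[P]_w \int[lebesgue_rV d]_y J (y, w) <= B%:E)%E.
  rewrite -(fubini_tonelli (m1 := lebesgue_rV d) (m2 := P) J mJ J0).
  apply: (@le_trans _ _ (\int[lebesgue_rV d]_y ((cube_pdf s y)%:E * B%:E))%E).
    apply: ge0_le_integral_nonmeas => y _; first by apply: integral_ge0 => w _.
    under eq_integral do rewrite JE.
    have mFy' : measurable_fun setT (fun w => (expR (t * \sum_z c y z * F (y + @lattice R d s n z) w))%:E).
      apply/measurable_EFinP; apply: measurableT_comp => //; apply: measurable_funM => //.
      apply: measurable_sum => z; apply: measurable_funM => //.
      exact: (measurableT_comp mF (pair1_measurable _)).
    rewrite ge0_integralZl_EFin//; last by rewrite cube_pdf_ge0.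
    have [->|yQ] := eqVneq (cube_pdf s y) 0; first by rewrite !mul0e.
    by rewrite lee_wpmul2l ?lee_fin ?cube_pdf_ge0// EB.
  have B0 : 0 <= B.
    by rewrite /B mulr_ge0 ?expR_ge0// addr_ge0 ?expR_ge0// mulr_ge0 ?expR_ge0// mulr_ge0.
  rewrite ge0_integralZr//=.
  - by rewrite integral_cube_pdf// mul1e.
  - by apply/measurable_EFinP; exact: measurable_cube_pdf.
  - by move=> y _; rewrite lee_fin cube_pdf_ge0.
set S := [set w | _].
have mS : measurable S by exact/measurable_gt/measurable_exp_average.
have key : ((expR (t * delta / 2))%:E * P S <= B%:E)%E.
  apply: le_trans EJ.
  have -> : ((expR (t * delta / 2))%:E * P S = \int[P]_w ((expR (t * delta / 2))%:E * (\1_S w)%:E))%E.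
    rewrite ge0_integralZl_EFin ?expR_ge0//; first by rewrite integral_indic// setIT.
    by apply/measurable_EFinP; exact: measurable_indic.
  apply: ge0_le_integral_nonmeas => w _; first by rewrite mule_ge0// lee_fin ?expR_ge0.
  have [Sw|Sw] := pselect (S w); last first.
    by rewrite indicE memNset//= mule0; apply: integral_ge0.
  rewrite indicE mem_set//= mule1; apply: le_trans (UJ w); rewrite lee_fin ler_expR.
  rewrite -mulrA ler_wpM2l//; have := XU w; move: Sw; rewrite /S/=; lra.
rewrite EFinM expRN -[X in (X <= _)%E]mul1e.
rewrite -(_ : ((expR (t * delta / 2))^-1%:E * (expR (t * delta / 2))%:E = 1)%E); last first.
  by rewrite -EFinM mulVf// gt_eqF// expR_gt0.
by rewrite -muleA lee_wpmul2l// lee_fin invr_ge0 expR_ge0.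
Qed.

End chernoff.

Section concentration.
Context {R : realType}.

(** For delta above this bound the event is empty. The estimate is [box_tail] for the empty box, n =
    0. *)
Lemma exp_average_le {d : nat} {dT} {T : measurableType dT} (P : probability T R)
    (A : 'rV[R]_d -> T -> R) (f : ('rV[R]_d -> R) -> R) (M L : R) (w : T) :
  (0 < d)%N -> 1 <= L -> jointly_measurable A ->
  measurable_wrt (sigma_gen coord_ev setT) f -> (forall a, `|f a| <= M) ->
  exp_average P (local_field A f) L w <= 2 * M * (4 * d%:R) ^+ d.
Proof.
move=> d0 L1 mA mf fM; have L0 : 0 < L by rewrite (lt_le_trans _ L1).
have iL0 : 0 < L^-1 by rewrite invr_gt0.
rewrite /exp_average local_field_mean; set m := \int[P]_w _.
pose Phi y := local_field A f y w - m.
have mPhi : measurable_fun setT Phi.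
  apply: measurable_funB => //.
  exact: (measurableT_comp (measurable_joint_shift mA mf) (pair2_measurable w)).
have PhiM y : `|Phi y| <= 2 * M.
  rewrite /Phi (le_trans (ler_normB _ _))// mulr_natl mulr2n lerD//; first exact: fM.
  exact: (mean_le P mA mf fM).
have box0 (x : 'rV[R]_d) : box_indic 1 0 x = 0 :> R.
  case: d d0 x {A f mA mf fM m Phi mPhi PhiM} => // d' _ x.
  rewrite /box_indic (bigD1 ord0)//= mul0r oppr0.
  by rewrite (_ : (0 <= _ < 0) = false) ?mul0r//; lra.
have := box_tail 1 0 d0 iL0 mPhi PhiM.
rewrite [X in _ - X](_ : _ = 0); last first.
  under eq_Rintegral do rewrite box0 mulr0.
  by rewrite Rintegral_cst// mul0r.
rewrite subr0 mul0r mulr0 oppr0 expR0 mulr1 => H.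
have iLd0 : 0 <= L ^- d by rewrite invr_ge0 exprn_ge0// ltW.
apply: (@le_trans _ _ (L ^- d * (2 * M * (2 * (d%:R / (L^-1 / 2))) ^+ d))).
  by rewrite ler_wpM2l// (le_trans (ler_norm _)).
have -> : 2 * (d%:R / (L^-1 / 2)) = 4 * d%:R * L by field; rewrite gt_eqF.
rewrite exprMn le_eqVlt; apply/orP; left; apply/eqP; field.
by rewrite expf_neq0// gt_eqF.
Qed.

(** * Choice of the parameters *)

Section parameters.
Variables (d : nat) (beta C0 K M : R).
Hypotheses (d0 : (0 < d)%N) (beta0 : 0 < beta) (C00 : 0 < C0) (K0 : 0 < K) (M1 : 1 <= M).

Let D : R := d%:R.
Let g := D * beta / (D + beta).
(** [B0] is the deterministic bound of [exp_average_le], and [Kd] the total lattice weight of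
    [chernoff_bound]; neither depends on L. *)
Let B0 := 2 * M * (4 * D) ^+ d.
Let Kd := (2 * (1 + D)) ^+ d.
Let D0 : 0 < D. Proof. by rewrite ltr0n. Qed.
Let g0 : 0 < g. Proof. by rewrite divr_gt0 ?mulr_gt0 ?addr_gt0. Qed.
Let M0 : 0 < M. Proof. exact: lt_le_trans M1. Qed.
Let B00 : 0 < B0. Proof. by rewrite !mulr_gt0// exprn_gt0// mulr_gt0. Qed.
Let Kd0 : 0 < Kd. Proof. by rewrite exprn_gt0// mulr_gt0// addr_gt0. Qed.

Let s (L : R) := L `^ (D / (D + beta)).

Lemma scale_ge1 L : 1 <= L -> 1 <= s L.
Proof.
move=> L1; rewrite /s -[leLHS](powRr0 L); apply: ler_powR => //.
by rewrite divr_ge0 ?addr_ge0 ?ltW.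
Qed.

Lemma scale_le L : 1 <= L -> s L <= L.
Proof.
move=> L1; rewrite /s -[leRHS]powRr1 ?(le_trans _ L1)//; apply: ler_powR => //.
by rewrite ler_pdivrMr ?addr_gt0// mul1r lerDl ltW.
Qed.

Lemma scale_beta L : s L `^ beta = L `^ g.
Proof. by rewrite /s -powRrM; congr (_ `^ _); rewrite /g; field; rewrite gt_eqF// addr_gt0. Qed.

Lemma scale_ratio L : 1 <= L -> (s L / L) ^+ d = (L `^ g)^-1.
Proof.
move=> L1; have L0 : 0 < L by rewrite (lt_le_trans _ L1).
have Y0 : 0 < L `^ g by rewrite powR_gt0.
have H : L `^ g * s L ^+ d = L ^+ d.
  rewrite -!powR_mulrn ?powR_ge0 ?(ltW L0)// /s -powRrM -powRD ?(gt_eqF L0) ?implybT//.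
  by congr (_ `^ _); rewrite /g -/D; field; rewrite gt_eqF// addr_gt0.
rewrite expr_div_n -H; field; rewrite !gt_eqF ?exprn_gt0//.
by rewrite (lt_le_trans _ (scale_ge1 L1)).
Qed.

(* [k] is the ratio [t / (delta L^g)] in the Chernoff bound. It makes the
   quadratic term smaller than the linear gain, and the exponential growth of
   the mixing error smaller than the decay of the mixing coefficient. *)
Lemma chernoff_constants : exists k : R, [/\ 0 < k, k * B0 * (2 * M) <= 1,
  8 * M ^+ 2 * k * Kd <= 8^-1 & 2 * M * k * B0 * Kd <= 2 `^ (- beta) / (2 * K)].
Proof.
(* Each constraint bounds k by the inverse of one x_i, so the inverse of their sum satisfies all of
   them. *)
pose x1 := B0 * (2 * M); pose x2 := 8 * M ^+ 2 * Kd * 8.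
pose x3 := 2 * M * B0 * Kd * (2 * K) / 2 `^ (- beta).
have x10 : 0 < x1 by rewrite /x1 mulr_gt0// mulr_gt0.
have x20 : 0 < x2 by rewrite /x2 mulr_gt0// mulr_gt0// mulr_gt0// exprn_gt0.
have b2 : 0 < 2 `^ (- beta) :> R by rewrite powR_gt0.
have x30 : 0 < x3 by rewrite /x3 divr_gt0// mulr_gt0// mulr_gt0// mulr_gt0// mulr_gt0.
have S0 : 0 < x1 + x2 + x3 by rewrite !addr_gt0.
exists (x1 + x2 + x3)^-1; split.
- by rewrite invr_gt0.
- by rewrite -mulrA -/x1 mulrC ler_pdivrMr// mul1r; lra.
- rewrite (_ : _ * _ * Kd = x2 / 8 / (x1 + x2 + x3)); last by rewrite /x2; field; rewrite gt_eqF.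
  rewrite ler_pdivrMr//; lra.
- have Sx3 : x3 <= x1 + x2 + x3 by lra.
  move: (x1 + x2 + x3) S0 Sx3 => S S0 Sx3.
  rewrite (_ : _ * _ * Kd = x3 * (2 `^ (- beta) / (2 * K)) / S); last first.
    by rewrite /x3; field; rewrite !gt_eqF.
  rewrite ler_pdivrMr// mulrC ler_wpM2l//.
  by rewrite divr_ge0 ?(ltW b2)// mulr_ge0// ltW.
Qed.

(** The assumption bounds delta below by a multiple of L^(-g/2), and both errors decay
    exponentially, in s L and in L. Below the threshold [K1] the final bound will hold trivially. *)
Lemma nontrivial_regime : exists K1 : R, 0 < K1 /\ forall delta L : R, 0 < delta -> 1 <= L ->
  K1 <= delta ^+ 2 * L `^ g ->
  C0 * expR (- (s L / 4 / C0)) * Kd <= delta / 16 /\ B0 * expR (- (L / 2)) <= delta / 2.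
Proof.
have c0 : 0 < (2 * C0)^-1 by rewrite invr_gt0 mulr_gt0.
have [K5 [K50 H5]] := powR_le_expR beta c0 (@ltr01 R).
have [K6 [K60 H6]] := powR_le_expR g (@ltr01 R) (@ltr01 R).
pose y5 := 16 * Kd * C0; pose y6 := 2 * B0.
have y50 : 0 < y5 by rewrite !mulr_gt0.
have y60 : 0 < y6 by rewrite mulr_gt0.
exists (y5 ^+ 2 * K5 + y6 ^+ 2 * K6); split.
  by rewrite addr_gt0// mulr_gt0// exprn_gt0.
move=> delta L dl0 L1 HK.
have L0 : 0 < L by rewrite (lt_le_trans _ L1).
have Y0 : 0 < L `^ g by rewrite powR_gt0.
(* After squaring, the claim reads y^2 <= delta^2 expR (u + u), and the power of L in the lower
   bound on delta is traded for the exponential. It is applied with u = s L / (4 C0), then with u =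
   L / 2. *)
have crit (y u k : R) : 0 < y -> 0 < k -> y ^+ 2 * k <= delta ^+ 2 * L `^ g ->
    L `^ g <= k * expR (u + u) -> y * expR (- u) <= delta.
  move=> y0 k0 h1 h2; rewrite -(@ler_pXn2r _ 2)// ?nnegrE ?mulr_ge0 ?expR_ge0 ?(ltW y0) ?(ltW dl0)//.
  have h3 : delta ^+ 2 * L `^ g <= delta ^+ 2 * (k * expR (u + u)) by rewrite ler_wpM2l ?sqr_ge0.
  have h4 := le_trans h1 h3.
  rewrite exprMn expRN exprVn ler_pdivrMr ?exprn_gt0 ?expR_gt0//.
  rewrite -(ler_pM2r k0) (le_trans h4)// expRD le_eqVlt; apply/orP; left; apply/eqP; ring.
split.
- have := crit y5 (s L / 4 / C0) K5 y50 K50.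
  rewrite -scale_beta => /(_ _ _) H.
  have : y5 * expR (- (s L / 4 / C0)) <= delta.
    apply: H; first by rewrite scale_beta (le_trans _ HK)// lerDl mulr_ge0 ?sqr_ge0// ltW.
    have := H5 _ (scale_ge1 L1); rewrite powRr1; last by rewrite (le_trans _ (scale_ge1 L1)).
    move=> /le_trans; apply; rewrite ler_wpM2l ?(ltW K50)// ler_expR le_eqVlt.
    by apply/orP; left; apply/eqP; field; rewrite gt_eqF.
  by rewrite /y5; move: (expR _) => ex; lra.
- have : y6 * expR (- (L / 2)) <= delta.
    apply: (crit y6 (L / 2) K6) => //.
      by rewrite (le_trans _ HK)// lerDr mulr_ge0 ?sqr_ge0// ltW.
    have := H6 _ L1; rewrite powRr1 ?(ltW L0)// mul1r => /le_trans; apply.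
    by rewrite ler_wpM2l ?(ltW K60)// ler_expR; lra.
  by rewrite /y6; move: (expR _) => ex; lra.
Qed.

(** A quarter of the rate of the mixing coefficient at distance s L / 2, which is 4 [cst_decay] in
    units of L^g. One quarter absorbs the polynomial factors, two absorb the growth exp(2 M t Kd),
    and one is left. *)
Let cst_decay := 2 `^ (- beta) / (4 * K).

Lemma polynomial_factor : exists K2 : R, 0 < K2 /\ forall (L : R) (n : nat), 1 <= L ->
  n%:R <= 2 * L ^+ 2 -> n%:R * s L <= 2 * L ^+ 2 ->
  ((n + n) ^ d)%:R * (K * (1 + (D * (2 * n%:R * s L) + 2 * (s L / 4))) `^ K) <=
  K2 * expR (cst_decay * L `^ g).
Proof.
have c0 : 0 < cst_decay by rewrite divr_gt0 ?powR_gt0 ?mulr_gt0.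
pose p := 2 * D + 2 * K.
have [K3 [K30 H3]] := powR_le_expR p c0 g0.
pose k := 4 ^+ d * (K * (6 * D) `^ K).
have k0 : 0 < k by rewrite mulr_gt0 ?exprn_gt0// mulr_gt0// powR_gt0// mulr_gt0.
exists (k * K3); split; first by rewrite mulr_gt0.
move=> L n L1 nL nsL; rewrite -[leRHS]mulrA.
have L0 : 0 < L by rewrite (lt_le_trans _ L1).
apply: (@le_trans _ _ (k * L `^ p)); last by rewrite ler_wpM2l ?(ltW k0)// H3.
have D1 : 1 <= D by rewrite ler1n.
have sL := scale_le L1; have s1 := scale_ge1 L1.
have L2 : L <= L ^+ 2 by rewrite expr2 -[leLHS]mulr1 ler_wpM2l// ltW.
(* 4 L^2 bounds n + n, and 6 D L^2 bounds 1 plus the diameter of the union of the balls, as s L <= L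
   <= L^2 and D >= 1. *)
have -> : k * L `^ p = (4 * L ^+ 2) ^+ d * (K * (6 * D * L ^+ 2) `^ K).
  have e1 : L ^+ 2 ^+ d = L `^ (2 * D) by rewrite -exprM -powR_mulrn ?(ltW L0)// natrM.
  have e2 : (L ^+ 2) `^ K = L `^ (2 * K) by rewrite -powR_mulrn ?(ltW L0)// -powRrM.
  rewrite /k /p exprMn e1 (@powRM _ (6 * D) (L ^+ 2)) ?sqr_ge0 ?mulr_ge0 ?(ltW D0)//.
  rewrite e2 powRD ?(gt_eqF L0) ?implybT//; ring.
apply: ler_pM; rewrite ?ler0n ?mulr_ge0 ?powR_ge0 ?(ltW K0)//.
  rewrite natrX; apply: lerXn2r; rewrite ?nnegrE ?ler0n//; last by rewrite natrD; lra.
  by rewrite mulr_ge0// sqr_ge0.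
rewrite ler_wpM2l ?(ltW K0)//; apply: ge0_ler_powR; rewrite ?nnegrE ?(ltW K0)//.
- rewrite addr_ge0// addr_ge0 ?mulr_ge0 ?(ltW D0) ?ler0n ?divr_ge0//; lra.
- by rewrite !mulr_ge0 ?sqr_ge0// ltW.
- have h1 : D * (2 * n%:R * s L) <= D * (4 * L ^+ 2) by rewrite ler_wpM2l ?(ltW D0)//; lra.
  have h2 : L ^+ 2 <= D * L ^+ 2 by rewrite -[leLHS]mul1r ler_wpM2r ?sqr_ge0.
  lra.
Qed.

Lemma half_scale_beta L : (s L / 2) `^ beta = 2 `^ (- beta) * L `^ g.
Proof.
rewrite -scale_beta powRM ?powR_ge0 ?invr_ge0// mulrC; congr (_ * _).
by rewrite -[2^-1]powR_inv1// -powRrM mulN1r.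
Qed.

(** From the gain t delta / 2, the two passages to local versions take t delta / 16 each and the
    quadratic term t delta / 8; the remaining t delta / 4 is the first exponent. The second summand
    is the mixing error, whose rate in L^g becomes one in delta^2 L^g because delta <= B0. *)
Lemma chernoff_exponents (k K2 L delta e N a t : R) :
  0 < k -> t = k * delta * L `^ g -> 8 * M ^+ 2 * k * Kd <= 8^-1 -> 2 * M * k * B0 * Kd <= 2 `^ (- beta) / (2 * K) ->
  0 < K2 -> 1 <= L -> 0 < delta -> delta <= B0 -> e * Kd <= delta / 16 ->
  N * a <= K2 * expR (cst_decay * L `^ g) ->
  expR (- (t * delta / 2)) * (expR (t * e * Kd) *
    (expR (t * e * Kd + 8 * M ^+ 2 * t ^+ 2 * ((s L / L) ^+ d * Kd)) +
      N * (a * expR (- (K^-1 * (s L / 2) `^ beta))) * expR (2 * M * t * Kd))) <=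
  expR (- (k / 4 * (delta ^+ 2 * L `^ g))) +
  K2 * expR (- (cst_decay / B0 ^+ 2 * (delta ^+ 2 * L `^ g))).
Proof.
move=> k0 tE kq kM K20 L1 dl0 dlB eK Na.
have L0 : 0 < L by rewrite (lt_le_trans _ L1).
have Y0 : 0 < L `^ g by rewrite powR_gt0.
have teK : t * e * Kd <= t * delta / 16.
  by rewrite -mulrA -[leRHS]mulrA ler_wpM2l// tE !mulr_ge0// ltW.
have td : t * delta = k * (delta ^+ 2 * L `^ g) by rewrite tE; ring.
have td0 : 0 <= t * delta by rewrite td !mulr_ge0 ?sqr_ge0// ltW.
rewrite scale_ratio// half_scale_beta mulrA -expRD mulrDr; apply: lerD.
  rewrite -expRD ler_expR.
  have -> : 8 * M ^+ 2 * t ^+ 2 * ((L `^ g)^-1 * Kd) = (8 * M ^+ 2 * k * Kd) * (t * delta).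
    by rewrite tE; field; rewrite gt_eqF.
  have := ler_wpM2r td0 kq; lra.
have c0 : 0 < cst_decay by rewrite divr_gt0 ?powR_gt0 ?mulr_gt0.
have kMc : 2 * M * t * Kd <= 2 * cst_decay * L `^ g.
  apply: (@le_trans _ _ (2 * M * k * B0 * Kd * L `^ g)).
    rewrite (_ : 2 * M * t * Kd = delta * (2 * M * k * Kd * L `^ g)); last by rewrite tE; ring.
    rewrite (_ : 2 * M * k * B0 * Kd * L `^ g = B0 * (2 * M * k * Kd * L `^ g)); last by ring.
    by rewrite ler_wpM2r// !mulr_ge0// ltW.
  rewrite ler_pM2r//; apply: (le_trans kM).
  by rewrite /cst_decay le_eqVlt; apply/orP; left; apply/eqP; field; rewrite gt_eqF.
have decay : K^-1 * (2 `^ (- beta) * L `^ g) = 4 * cst_decay * L `^ g.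
  by rewrite /cst_decay; field; rewrite gt_eqF.
apply: (@le_trans _ _ (1 * (K2 * expR (cst_decay * L `^ g) *
    expR (- (K^-1 * (2 `^ (- beta) * L `^ g))) * expR (2 * cst_decay * L `^ g)))).
  rewrite (_ : N * (a * _) * _ = N * a *
    (expR (- (K^-1 * (2 `^ (- beta) * L `^ g))) * expR (2 * M * t * Kd))); last by ring.
  apply: (@le_trans _ _ (expR (- (t * delta / 2) + t * e * Kd) * (K2 * expR (cst_decay * L `^ g) *
    (expR (- (K^-1 * (2 `^ (- beta) * L `^ g))) * expR (2 * M * t * Kd))))).
    by rewrite ler_wpM2l ?expR_ge0// ler_wpM2r// mulr_ge0 ?expR_ge0.
  rewrite -[X in _ <= 1 * X]mulrA ler_pM ?expR_ge0 ?mulr_ge0 ?expR_ge0 ?(ltW K20)//.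
    rewrite -[leRHS]expR0 ler_expR; lra.
  by rewrite ler_wpM2l ?mulr_ge0 ?expR_ge0 ?(ltW K20)// ler_wpM2l ?expR_ge0// ler_expR.
rewrite mul1r decay -mulrA -mulrA ler_wpM2l ?(ltW K20)// -!expRD ler_expR.
have : cst_decay / B0 ^+ 2 * (delta ^+ 2 * L `^ g) <= cst_decay * L `^ g.
  rewrite mulrAC -mulrA ler_wpM2l ?(ltW c0)// ler_pdivrMr ?exprn_gt0// mulrC ler_wpM2l ?(ltW Y0)//.
  by apply: lerXn2r; rewrite ?nnegrE ?(ltW dl0) ?(ltW B00).
rewrite -[4 * _ * _]mulrA -[2 * cst_decay * _]mulrA.
move: (cst_decay * L `^ g) (cst_decay / _ * _) => u v; lra.
Qed.

Lemma concentration_bounded : exists C : R, 0 < C /\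
  forall dT (T : measurableType dT) (P : probability T R) (A : 'rV[R]_d -> T -> R)
    (f : ('rV[R]_d -> R) -> R),
  jointly_measurable A -> stationary P A -> mixing_bound P A beta K ->
  measurable_wrt (sigma_gen coord_ev setT) f -> (forall a, `|f a| <= M) ->
  (forall l, 0 <= l -> exists h : T -> R, measurable_wrt (sigma_gen A (eball 0 l)) h /\
    {ae P, forall w, `|f (shift_path A 0 w) - h w| <= C0 * expR (- (l / C0))}) ->
  forall delta L : R, 0 < delta -> 1 <= L ->
  (P [set w | (delta < exp_average P (local_field A f) L w)%R] <=
    (C * expR (- (C^-1 * delta ^+ 2 * L `^ g)))%:E)%E.
Proof.
have [k [k0 kB kq kM]] := chernoff_constants.
have [K1 [K10 HK1]] := nontrivial_regime.
have [K2 [K20 HK2]] := polynomial_factor.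
have c0 : 0 < cst_decay by rewrite divr_gt0 ?powR_gt0 ?mulr_gt0.
have c1 : 0 < cst_decay / B0 ^+ 2 by rewrite divr_gt0 ?exprn_gt0.
have k4 : 0 < k / 4 by rewrite divr_gt0.
(* 1 + K2 is the sum of the prefactors of the two exponentials and the two inverses their rates; K1
   and expR 1 make the bound at least 1 when V < K1. *)
pose C := 1 + K2 + (k / 4)^-1 + (cst_decay / B0 ^+ 2)^-1 + K1 + expR 1.
have e1 : 0 < expR 1 :> R := expR_gt0 1.
have ik : 0 < (k / 4)^-1 by rewrite invr_gt0.
have ic : 0 < (cst_decay / B0 ^+ 2)^-1 by rewrite invr_gt0.
have [Ck Cc CK2] : [/\ (k / 4)^-1 <= C, (cst_decay / B0 ^+ 2)^-1 <= C & 1 + K2 <= C].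
  by move: ik ic; rewrite /C; move: (_^-1) (_^-1) => x y *; split; lra.
have C_gt0 : 0 < C by rewrite !addr_gt0.
exists C; split => // dT T P A f mA sA mix mf fM loc delta L dl0 L1.
have L0 : 0 < L by rewrite (lt_le_trans _ L1).
have Y0 : 0 < L `^ g by rewrite powR_gt0.
set S := [set w | _].
have [dB|dB] := leP B0 delta.
  rewrite (_ : S = set0); first by rewrite measure0 lee_fin mulr_ge0 ?expR_ge0// ltW.
  apply/seteqP; split => // w; rewrite /S/= ltNge (le_trans _ dB)//.
  exact: (exp_average_le P w d0 L1 mA mf fM).
rewrite -mulrA; set V := delta ^+ 2 * L `^ g.
have V0 : 0 < V by rewrite mulr_gt0// exprn_gt0.
have [VK|VK] := ltP V K1.
  apply: (@le_trans _ _ 1%E); first exact/probability_le1/measurable_gt/measurable_exp_average.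
  rewrite lee_fin; apply: (@le_trans _ _ (expR 1 * expR (- 1))).
    by rewrite -expRD subrr expR0.
  rewrite ler_pM ?expR_ge0 ?ler_expR//; first by rewrite /C; lra.
  by rewrite lerN2 mulrC ler_pdivrMr// mul1r /C; lra.
have [eK tail0] := HK1 _ _ dl0 L1 VK.
have s1 := scale_ge1 L1; have sL := scale_le L1.
have s0 : 0 < s L by rewrite (lt_le_trans _ s1).
(* The least choice that surely puts n s above L^2, so that the tail exponent n s / (2 L) is at
   least L / 2, while n s <= L^2 + s stays polynomial. *)
pose n := (Num.truncn (L ^+ 2 / s L)).+1.
have L21 : 1 <= L ^+ 2 by rewrite exprn_ege1.
have [nl nu] : L ^+ 2 <= n%:R * s L /\ n%:R * s L <= L ^+ 2 + s L.
  have q0 : 0 <= L ^+ 2 / s L by rewrite divr_ge0 ?sqr_ge0// ltW.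
  have /andP[h1 h2] := truncn_itv q0; split.
    by rewrite -ler_pdivrMr// ltW.
  by rewrite /n -natr1 mulrDl mul1r lerD2r -ler_pdivlMr.
have L2 : L <= L ^+ 2 by rewrite expr2 -[leLHS]mulr1 ler_wpM2l// ltW.
have nsL : n%:R * s L <= 2 * L ^+ 2 by lra.
have nL : n%:R <= 2 * L ^+ 2.
  by apply: le_trans nsL; rewrite -[leLHS]mulr1 ler_wpM2l.
set e := C0 * expR (- (s L / 4 / C0)) in eK.
have s4 : 0 <= s L / 4 by rewrite divr_ge0// ltW.
have [h [mh fh]] := loc _ s4.
pose a := K * (1 + (D * (2 * n%:R * s L) + 2 * (s L / 4))) `^ K * expR (- (K^-1 * (s L / 2) `^ beta)).
have tail : B0 * expR (- (n%:R * s L / (2 * L))) <= delta / 2.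
  apply: le_trans tail0; rewrite ler_wpM2l ?(ltW B00)// ler_expR lerN2.
  by rewrite ler_pdivlMr ?mulr_gt0//; lra.
pose t := k * delta * L `^ g.
have t0 : 0 <= t by rewrite !mulr_ge0 ?(ltW k0) ?(ltW dl0) ?(ltW Y0).
have a0 : 0 <= a by rewrite !mulr_ge0 ?expR_ge0 ?powR_ge0// ltW.
have tM : t * (s L / L) ^+ d * (2 * M) <= 1.
  rewrite scale_ratio// (_ : t / _ = k * delta); last by rewrite /t; field; rewrite gt_eqF.
  by apply: le_trans kB; rewrite ler_wpM2r ?mulr_ge0 ?(ltW M0)// ler_wpM2l ?(ltW k0) ?(ltW dB).
have ta : (tilde_alpha P A (s L / 2) (d%:R * (2 * n%:R * s L) + 2 * (s L / 4)) <= a%:E)%E.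
  apply: mix; last by rewrite divr_ge0// ltW.
  by rewrite addr_ge0 ?mulr_ge0 ?ler0n ?divr_ge0 ?(ltW s0).
have e0 : 0 <= e by rewrite mulr_ge0 ?expR_ge0// ltW.
have := chernoff_bound mA sA mf fM d0 L1 s0 sL t0 tM a0 ta mh e0 fh tail erefl.
move=> /le_trans; apply; rewrite lee_fin.
have := chernoff_exponents k0 erefl kq kM K20 L1 dl0 (ltW dB) eK (HK2 _ _ L1 nL nsL).
move=> /le_trans; apply; rewrite -/V.
have CE (c : R) : 0 < c -> c^-1 <= C -> expR (- (c * V)) <= expR (- (C^-1 * V)).
  move=> c_gt0 cC; rewrite ler_expR lerN2 ler_wpM2r ?(ltW V0)//.
  by rewrite -[leRHS]invrK lef_pV2 ?posrE ?invr_gt0.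
apply: (@le_trans _ _ ((1 + K2) * expR (- (C^-1 * V)))).
  by rewrite mulrDl mul1r lerD// ?ler_wpM2l ?(ltW K20)// CE.
by rewrite ler_wpM2r ?expR_ge0.
Qed.

End parameters.

End concentration.

(** * Changing f on a null set of paths *)

Section modification.
Context {R : realType} {d : nat} {dT} {T : measurableType dT}.
Variables (P : probability T R) (A : 'rV[R]_d -> T -> R).
Hypotheses (mA : jointly_measurable A) (sA : stationary P A).
Variables (f g : ('rV[R]_d -> R) -> R).
Hypotheses (mf : measurable_wrt (sigma_gen coord_ev setT) f)
  (mg : measurable_wrt (sigma_gen coord_ev setT) g).
Hypothesis fg : {ae P, forall w, f (shift_path A 0 w) = g (shift_path A 0 w)}.

(** For each y the two fields agree almost surely by stationarity, but the null set depends on y. By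
    Tonelli, for almost every w they agree for almost every y, which suffices for the integrals. *)
Lemma exp_average_ae (L : R) : {ae P, forall w,
  exp_average P (local_field A f) L w = exp_average P (local_field A g) L w}.
Proof.
pose u (p : 'rV[R]_d * T) := (f (shift_path A p.1 p.2) - g (shift_path A p.1 p.2))%:E.
have mu : measurable_fun setT u.
  by apply/measurable_EFinP; apply: measurable_funB; exact: measurable_joint_shift.
have mau : measurable_fun setT (fun p => `|u p|%E) by exact: measurableT_comp.
have u0 y : (\int[P]_w `|u (y, w)| = 0)%E.
  apply/ae_eq_integral_abs => //; first exact: (measurableT_comp mu (pair1_measurable y)).
  have : {ae P, forall w, `|f (shift_path A y w) - g (shift_path A y w)| <= 0}.
    apply: (ae_shift_path mA sA y (h := fun a => `|f a - g a|)).
      by apply/measurable_wrt_sigmaP; apply: measurableT_comp => //;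
        apply: measurable_funB; apply/measurable_wrt_sigmaP.
    by apply: filterS fg => w ->; rewrite subrr normr0.
  by apply: filterS => w; rewrite normr_le0 /u /= => /eqP -> _.
have : {ae P, forall w, (\int[lebesgue_rV d]_y `|u (y, w)| = 0)%E}.
  have mint : measurable_fun setT (fun w => \int[lebesgue_rV d]_y `|u (y, w)|)%E.
    exact: (measurable_fun_fubini_tonelli_G (m1 := lebesgue_rV d) _ mau).
  have : ae_eq P setT (fun w => \int[lebesgue_rV d]_y `|u (y, w)|)%E (cst 0%E).
    apply/ae_eq_integral_abs => //.
    under eq_integral do rewrite gee0_abs ?integral_ge0//.
    rewrite -(fubini_tonelli (m1 := lebesgue_rV d) (m2 := P) (fun p => `|u p|%E) mau)//.
    by under eq_integral do rewrite u0; rewrite integral0.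
  by apply: filterS => w /(_ I).
apply: filterS => w uw.
have muw : measurable_fun setT (fun y => u (y, w)) by exact: (measurableT_comp mu (pair2_measurable w)).
have {uw} := (ae_eq_integral_abs (lebesgue_rV d) measurableT muw).1 uw => uw.
have mean : fine 'E_P[local_field A f 0] = fine 'E_P[local_field A g 0].
  rewrite unlock; congr fine; apply: ae_eq_integral => //.
  - by apply/measurable_EFinP; exact: (measurable_shifted mA mf 0).
  - by apply/measurable_EFinP; exact: (measurable_shifted mA mg 0).
  - by apply: filterS fg => v fgv _; rewrite /local_field /=; congr EFin.
rewrite /exp_average mean; congr (_ * fine _); apply: ae_eq_integral => //.
- apply/measurable_EFinP; apply: measurable_funM; first exact: measurable_enorm_weight.
  apply: measurable_funB => //.
  exact: (measurableT_comp (measurable_joint_shift mA mf) (pair2_measurable w)).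
- apply/measurable_EFinP; apply: measurable_funM; first exact: measurable_enorm_weight.
  apply: measurable_funB => //.
  exact: (measurableT_comp (measurable_joint_shift mA mg) (pair2_measurable w)).
- apply: filterS uw => y /(_ I) [/eqP]; rewrite subr_eq0 => /eqP fgy _.
  by rewrite /= /local_field fgy.
Qed.

End modification.

(* Without a version, [cond_exp] is the constant 0, which is measurable too. *)
Lemma measurable_wrt_cond_exp {R : realType} {dT} {T : measurableType dT} (P : probability T R)
    (G : set (set T)) (X : T -> R) : sigma_algebra setT G -> measurable_wrt G (cond_exp P G X).
Proof.
move=> sG; rewrite /cond_exp; case: xgetP => [Y _ []//|_].
exact: (measurable_wrt_cst sG).
Qed.

Theorem proposition1p9 (R : realType) (d : nat) (beta C0 C1 M : R) :
  (0 < d)%N -> 0 < beta -> 0 < C0 -> 0 < C1 ->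
  exists C : R, 0 < C /\
    forall (dT : measure_display) (T : measurableType dT) (P : probability T R)
      (A : 'rV[R]_d -> T -> R) (f : ('rV[R]_d -> R) -> R),
    jointly_measurable A ->
    stationary P A ->
    (alpha_mixing P A /\
       (forall D l : R, 0 <= D -> 0 <= l ->
          (tilde_alpha P A l D <=
             (C1 * (1 + D) `^ C1 * expR (- (C1^-1 * l `^ beta)))%:E)%E)) \/
    (exists wt : R -> R, osc_MCI P A wt /\
       (forall l : R, 0 <= l -> wt l <= C1 * expR (- (C1^-1 * l `^ beta)))) ->
    measurable_wrt
      (sigma_gen (fun (x : 'rV[R]_d) (a : 'rV[R]_d -> R) => a x) setT) f ->
    {ae P, forall w, `|f (A^~ w)| <= M} ->
    (forall l : R, 0 <= l ->
       (ess_sup P (fun w => (`|f (A^~ w) -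
            cond_exp P (sigma_gen A (eball 0 l)) (fun w' => f (A^~ w')) w|)%:E)
        <= (C0 * expR (- (l / C0)))%:E)%E) ->
    forall delta L : R, 0 < delta -> 1 <= L ->
      (P [set w | (delta < exp_average P (local_field A f) L w)%R] <=
         (C * expR (- (C^-1 * delta ^+ 2 *
            (`|ln delta| + 1) `^ (- (d%:R * beta / (d%:R + beta))) *
            L `^ (d%:R * beta / (d%:R + beta)))))%:E)%E.
Proof.
move=> d0 beta0 C00 C10.
have [K' [K'0 mciK]] := osc_MCI_mixing_bound d beta0 C10.
have K0 : 0 < C1 + K' by rewrite addr_gt0.
(* M is an arbitrary real, whereas [concentration_bounded] wants a bound that is at least 1. *)
have M1 : 1 <= `|M| + 1 by rewrite lerDr.
have [C [C_gt0 HC]] := concentration_bounded d0 beta0 C00 K0 M1.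
exists C; split => // dT T P A f mA sA mix mf fM loc delta L dl0 L1.
have mixK : mixing_bound P A beta (C1 + K').
  case: mix => [[_ mix]|[wt [mci wtC]]].
    by apply: (@mixing_bound_weaken _ _ _ _ _ _ _ C1) => //; rewrite lerDl ltW.
  by apply: (@mixing_bound_weaken _ _ _ _ _ _ _ K') => //; [rewrite lerDr ltW|exact: mciK mci wtC].
(* [f] is bounded only almost surely on the paths of [A]. *)
pose g := clamp (`|M| + 1) \o f.
have path0 w : shift_path A 0 w = A^~ w by apply/funext => y; rewrite /shift_path addr0.
have mg : measurable_wrt (sigma_gen coord_ev setT) g.
  exact: (measurable_wrt_comp (measurable_clamp _) mf).
have gM a : `|g a| <= `|M| + 1 by apply: clamp_le; rewrite addr_ge0.
have fg : {ae P, forall w, f (shift_path A 0 w) = g (shift_path A 0 w)}.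
  apply: filterS fM => w fw; rewrite path0 /g /= clamp_id//.
  by rewrite (le_trans fw)// (le_trans (ler_norm M))// lerDl.
(* Of the conditional expectation only its measurability and the uniform error are used. *)
have locg l : 0 <= l -> exists h : T -> R, measurable_wrt (sigma_gen A (eball 0 l)) h /\
    {ae P, forall w, `|g (shift_path A 0 w) - h w| <= C0 * expR (- (l / C0))}.
  move=> l0; exists (cond_exp P (sigma_gen A (eball 0 l)) (fun w' => f (A^~ w'))); split.
    by apply: measurable_wrt_cond_exp; exact: smallest_sigma_algebra.
  have /ess_supP locl := loc l l0.
  by apply: filterS2 fg locl => w <-; rewrite path0 lee_fin.
have := HC _ _ P A g mA sA mixK mg gM locg delta L dl0 L1.
have -> : P [set w | delta < exp_average P (local_field A g) L w] =
          P [set w | delta < exp_average P (local_field A f) L w].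
  have ms (k : ('rV[R]_d -> R) -> R) : measurable_wrt (sigma_gen coord_ev setT) k ->
      measurable [set w | delta < exp_average P (local_field A k) L w].
    by move=> mk; exact/measurable_gt/measurable_exp_average.
  have PE (S : set T) : measurable S -> P S = (\int[P]_w (\1_S w)%:E)%E.
    by move=> mS; rewrite integral_indic// setIT.
  rewrite !PE; [|exact: ms..].
  apply: ae_eq_integral => //; [exact/measurable_EFinP/measurable_indic/ms..|].
  apply: filterS (exp_average_ae mA sA mf mg fg L) => w fgw _.
  by rewrite !indicE; congr ((nat_of_bool _)%:R)%:E; apply/idP/idP; rewrite !inE /= fgw.
have log1 : (`|ln delta| + 1) `^ (- (d%:R * beta / (d%:R + beta))) <= 1.
  rewrite -[leRHS](powRr0 (`|ln delta| + 1)) ler_powR ?lerDr//.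
  by rewrite oppr_le0 divr_ge0 ?mulr_ge0 ?addr_ge0 ?ler0n// ltW.
move=> /le_trans; apply; rewrite lee_fin ler_wpM2l ?(ltW C_gt0)// ler_expR lerN2.
rewrite ler_wpM2r ?powR_ge0// -[leRHS]mulr1 ler_wpM2l//.
by rewrite mulr_ge0 ?invr_ge0 ?sqr_ge0// ltW.
Qed.
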